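(* Let $R \in \mathbb{C}_p(z)$ be a nonconstant rational function and let $\widehat{X} \subset \mathbb{H}_p$ be a connected set containing at least two points such that $R_*(\widehat{X}) \subset \widehat{X}$. Then either $\widehat{X}$ contains a rational point of $\mathbb{H}_p$ fixed by $R_*$, or there exists an attracting fixed point $z_0 \in \mathbb{P}(\mathbb{C}_p)$ of $R$ such that $\widehat{X}$ contains a half-geodesic issuing from $z_0$.
   Context: $p$ is a prime, $\mathbb{C}_p$ the completion of an algebraic closure of $\mathbb{Q}_p$ with norm $|\cdot|$, $\mathbb{P}(\mathbb{C}_p)=\mathbb{C}_p\cup\{\infty\}$. A fixed point $z_0$ of $R$ is attracting if its multiplier $R'(z_0)$ has norm $<1$. Balls. For $a\in\mathbb{C}_p$, $r>0$: if $r\in|\mathbb{C}_p^*|$, $\{|z-a|<r\}$ is an open and $\{|z-a|\le r\}$ a closed ball of $\mathbb{C}_p$; if $r\notin|\mathbb{C}_p^*|$ these two sets coincide and form an irrational ball of $\mathbb{C}_p$. A ball of $\mathbb{P}(\mathbb{C}_p)$ is open (resp. closed, irrational) if it is an open (resp. closed, irrational) ball of $\mathbb{C}_p$ or the complement of a closed (resp. open, irrational) ball of $\mathbb{C}_p$. Ends. Let $(B_i)_{i\ge0}$ be an increasing sequence of closed or irrational balls such that $B=\bigcup_i B_i$ is an open ball, an irrational ball, or $\mathbb{P}(\mathbb{C}_p)$ (with $B_i\ne B$). Then $\{B-B_i\}_{i\ge0}$ is called an evanescent chain. Two evanescent chains $\{B-B_i\}$, $\{B'-B'_i\}$ are equivalent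 if for every $N\ge0$ there is $n\ge N$ with $B_N\subset B'_n$ and $B'_N\subset B_n$ (then $B=B'$). An end $\mathcal{P}$ is an equivalence class of evanescent chains; $B_{\mathcal{P}}:=B$. The end is singular if $B_{\mathcal{P}}=\mathbb{P}(\mathbb{C}_p)$, rational if $B_{\mathcal{P}}$ is an open ball, irrational if $B_{\mathcal{P}}$ is an irrational ball. Nonsingular ends correspond bijectively to open or irrational balls. Points of $\mathbb{H}_p$ are sets of ends. Singular points: $\{\mathcal{P}\}$ with $\mathcal{P}$ singular. Irrational points: $\{\mathcal{P},\mathcal{P}'\}$ with $\mathcal{P},\mathcal{P}'$ irrational and $B_{\mathcal{P}}\sqcup B_{\mathcal{P}'}=\mathbb{P}(\mathbb{C}_p)$. Rational points: sets of ends of the balls $\varphi(B(\zeta))$, $\zeta\in\mathbb{P}(\overline{\mathbb{F}}_p)$, where $\varphi$ is an automorphism of $\mathbb{P}(\mathbb{C}_p)$ and $B(\zeta)$ is the set of points of $\mathbb{P}(\mathbb{C}_p)$ whose reduction is $\zeta$ (with $B(\infty)=\{|z|>1\}\cup\{\infty\}$). $\mathbb{H}_p$ is the set of all these points and $\mathbb{H}_p^{\mathbb{R}}$ the set of nonsingular ones. For nonsingular $\mathcal{S}$ the balls $B_{\mathcal{P}}$, $\mathcal{P}\in\mathcal{S}$, are called the balls associated to $\mathcal{S}$; they partition $\mathbb{P}(\mathbb{C}_p)$. A nonsingular $\mathcal{S}$ separates $X\subset\mathbb{P}(\mathbb{C}_p)$ if $X$ meets at least two balls associated to $\mathcal{S}$.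 Topology. For nonsingular $\mathcal{S},\mathcal{S}'$ let $D$ (resp. $D'$) be the complement of the ball associated to $\mathcal{S}$ (resp. $\mathcal{S}'$) containing $\infty$; set $d(\mathcal{S},\mathcal{S}')=\log_p\frac{\operatorname{diam}(D\cup D')^2}{\operatorname{diam}(D)\operatorname{diam}(D')}$ (diameters for $|\cdot|$). This distance extends to a complete distance on $\mathbb{H}_p$, in which a singular point $\{\mathcal{P}\}$, with $\mathcal{P}$ defined by an evanescent chain $\{D_i\}$, is the limit of the points having $D_i$ as an associated ball. Connectedness refers to this topology. Half-geodesics. For $z\in\mathbb{P}(\mathbb{C}_p)$ and $\mathcal{S}\in\mathbb{H}_p^{\mathbb{R}}$, let $\mathcal{P}\in\mathcal{S}$ be the end with $z\in B_{\mathcal{P}}$. The half-geodesic joining $z$ and $\mathcal{S}$ (issuing from $z$) is the set of points of $\mathbb{H}_p^{\mathbb{R}}$ that separate both $B_{\mathcal{P}}-\{z\}$ and its complement. After a change of coordinate, $z=0$, $\mathcal{S}$ is the point having $\{|w|<p^{r_0}\}$ as associated ball, and the half-geodesic is the set of points having $\{|w|<p^r\}$ as associated ball, $r<r_0$. Action of $R$. For every end $\mathcal{P}$ there is an end $R_*(\mathcal{P})$ of the same nature and an integer $\deg_R(\mathcal{P})\ge1$ such that for each evanescent chain $\{C_i\}$ defining $\mathcal{P}$, for $N$ large, $\{R(C_i)\}_{i\ge N}$ is an evanescent chain defining $R_*(\mathcal{P})$ and $R:C_i\to R(C_i)$ has degree $\deg_R(\mathcal{P})$ for $i\ge N$. For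 $\mathcal{S}\in\mathbb{H}_p$, $R_*(\mathcal{S})$ is the unique point of $\mathbb{H}_p$ containing $R_*(\mathcal{P})$ for all $\mathcal{P}\in\mathcal{S}$. *)

(* Defs.v *)
From HB Require Import structures.
From mathcomp Require Import all_boot all_order all_algebra.
From mathcomp Require Import all_classical all_reals topology normedtype sequences exp.
Import Order.TTheory GRing.Theory Num.Theory.
Import numFieldNormedType.Exports.

Set Implicit Arguments.
Unset Strict Implicit.
Unset Printing Implicit Defensive.

Local Open Scope classical_set_scope.
Local Open Scope ring_scope.

(* The field C_p, described up to isometric isomorphism as the completion of
   an algebraic closure of the completion of rat for the p-adic norm. *)

Section Valued.
Context {R : realType}.

Record ultrametric_abs (K : fieldType) (v : K -> R) : Prop := UltrametricAbs {
  uabs_ge0 : forall x, 0 <= v x;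
  uabs_eq0 : forall x, v x = 0 <-> x = 0;
  uabsM : forall x y, v (x * y) = v x * v y;
  uabsD : forall x y, v (x + y) <= Num.max (v x) (v y) }.

Definition abs_complete (K : fieldType) (v : K -> R) : Prop :=
  forall u : nat -> K,
    (forall e : R, 0 < e -> exists N : nat, forall m n : nat,
       (N <= m)%N -> (N <= n)%N -> v (u m - u n) < e) ->
    exists l : K, forall e : R, 0 < e -> exists N : nat, forall n : nat,
       (N <= n)%N -> v (u n - l) < e.

Definition is_completion (K L : fieldType) (vK : K -> R) (vL : L -> R)
    (j : {rmorphism K -> L}) : Prop :=
  [/\ ultrametric_abs vL, abs_complete vL, (forall x, vL (j x) = vK x) &
      forall (y : L) (e : R), 0 < e -> exists x : K, vL (y - j x) < e].

Definition is_algebraic_closure (K L : fieldType) (j : {rmorphism K -> L}) :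
    Prop :=
  GRing.closed_field_axiom L /\ forall y : L, algebraicOver j y.

Definition padic_abs (p : nat) (q : rat) : R :=
  if q == 0 then 0
  else p%:R ^+ logn p `|denq q|%N / p%:R ^+ logn p `|numq q|%N.

Definition is_Cp (p : nat) (K : fieldType) (v : K -> R) : Prop :=
  exists (Qp : fieldType) (vQp : Qp -> R) (i : {rmorphism rat -> Qp})
         (Qpbar : fieldType) (vbar : Qpbar -> R)
         (j : {rmorphism Qp -> Qpbar}) (k : {rmorphism Qpbar -> K}),
    [/\ is_completion (padic_abs p) vQp i,
        is_algebraic_closure j,
        ultrametric_abs vbar /\ (forall x, vbar (j x) = vQp x) &
        is_completion vbar v k].

End Valued.

Structure padicComplexType (p : nat) (R : realType) := PadicComplex {
  Cp_sort :> fieldType;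
  Cp_abs : Cp_sort -> R;
  Cp_axiom : is_Cp p Cp_abs }.

Section ProjectiveLine.
Context {p : nat} {R : realType}.
Variable K : padicComplexType p R.
Local Notation abs := (@Cp_abs p R K).

(* None is the point at infinity. *)
Definition P1 : Type := option K.

(* num f and den f are coprime, den f is nonzero and f = num f / den f; they
   are unique up to a common nonzero scalar. *)
Definition num (f : {fraction {poly K}}) : {poly K} :=
  \n_(repr f) %/ gcdp \n_(repr f) \d_(repr f).
Definition den (f : {fraction {poly K}}) : {poly K} :=
  \d_(repr f) %/ gcdp \n_(repr f) \d_(repr f).

Definition rat_eval (f : {fraction {poly K}}) (z : P1) : P1 :=
  match z with
  | Some x => if (den f).[x] == 0 then None
              else Some ((num f).[x] / (den f).[x])
  | None => if (size (den f) < size (num f))%N then None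
            else Some ((num f)`_(size (den f)).-1 / lead_coef (den f))
  end.

Definition nonconstant (f : {fraction {poly K}}) : Prop :=
  ~ exists c : K, f = tofrac c%:P.

(* The rational function 1 / f (1 / w): den f and num f are evaluated at 1 / w
   and multiplied by w ^+ m.-1. *)
Definition inv_conj (f : {fraction {poly K}}) : {fraction {poly K}} :=
  let m := maxn (size (num f)) (size (den f)) in
  let rv (q : {poly K}) : {poly K} := \poly_(i < m) q`_(m.-1 - i) in
  tofrac (rv (den f)) / tofrac (rv (num f)).

Definition rat_deriv (f : {fraction {poly K}}) (x : K) : K :=
  ((num f)^`() * den f - num f * (den f)^`()).[x] / (den f).[x] ^+ 2.

(* Only meaningful at a fixed point of f. *)
Definition multiplier (f : {fraction {poly K}}) (z : P1) : K :=
  match z with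
  | Some x => rat_deriv f x
  | None => rat_deriv (inv_conj f) 0
  end.

Definition attracting_fixed_point (f : {fraction {poly K}}) (z : P1) : Prop :=
  rat_eval f z = z /\ abs (multiplier f z) < 1.

Definition mobius (a b c d : K) (z : P1) : P1 :=
  match z with
  | Some x => if c * x + d == 0 then None else Some ((a * x + b) / (c * x + d))
  | None => if c == 0 then None else Some (a / c)
  end.

Definition P1_automorphism (phi : P1 -> P1) : Prop :=
  exists a b c d : K, a * d - b * c != 0 /\ phi = mobius a b c d.

(* The residue field is taken as the set of classes modulo the open unit ball
   of the elements of norm at most 1, and P^1 of the residue field as
   [range reduction]. *)
Definition reduction (z : P1) : option (set K) :=
  match z with
  | Some x => if abs x <= 1 then Some [set y | abs (y - x) < 1] else None
  | None => None
  end.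

Definition value_group : set R := [set r | exists2 x : K, x != 0 & abs x = r].

Definition affine_open_ball (B : set P1) : Prop :=
  exists (a : K) (r : R), [/\ 0 < r, value_group r &
    B = Some @` [set z | abs (z - a) < r]].

Definition affine_closed_ball (B : set P1) : Prop :=
  exists (a : K) (r : R), [/\ 0 < r, value_group r &
    B = Some @` [set z | abs (z - a) <= r]].

Definition affine_irrational_ball (B : set P1) : Prop :=
  exists (a : K) (r : R), [/\ 0 < r, ~ value_group r &
    B = Some @` [set z | abs (z - a) < r]].

Definition open_ball (B : set P1) : Prop :=
  affine_open_ball B \/ affine_closed_ball (~` B).

Definition closed_ball (B : set P1) : Prop :=
  affine_closed_ball B \/ affine_open_ball (~` B).

Definition irrational_ball (B : set P1) : Prop :=
  affine_irrational_ball B \/ affine_irrational_ball (~` B).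

Record is_chain (B : set P1) (Bs : nat -> set P1) : Prop := IsChain {
  chain_closed_or_irr : forall i, closed_ball (Bs i) \/ irrational_ball (Bs i);
  chain_increasing : forall i, Bs i `<=` Bs i.+1;
  chain_bigcup : B = \bigcup_i Bs i;
  chain_union_kind : [\/ open_ball B, irrational_ball B | B = setT];
  chain_neq : forall i, Bs i <> B }.

Record chain : Type := Chain {
  chain_union : set P1;
  chain_ball : nat -> set P1;
  chainP : is_chain chain_union chain_ball }.

(* The members of the evanescent chain itself. *)
Definition chain_set (c : chain) (i : nat) : set P1 :=
  chain_union c `\` chain_ball c i.

Definition chain_equiv (c c' : chain) : Prop :=
  forall N : nat, exists n : nat, [/\ (N <= n)%N,
    chain_ball c N `<=` chain_ball c' n & chain_ball c' N `<=` chain_ball c n].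

Record P1_end : Type := P1End {
  end_chains :> set chain;
  end_class : exists c : chain, end_chains = [set c' | chain_equiv c c'] }.

(* The ball B_P of an end P; all the chains defining P have the same union. *)
Definition end_ball (P : P1_end) : set P1 :=
  \bigcup_(c in (P : set chain)) chain_union c.

Definition singular_end (P : P1_end) : Prop := end_ball P = setT.
Definition irrational_end (P : P1_end) : Prop := irrational_ball (end_ball P).

Definition singular_point (S : set P1_end) : Prop :=
  exists2 P : P1_end, singular_end P & S = [set P].

Definition irrational_point (S : set P1_end) : Prop :=
  exists P P' : P1_end, [/\ irrational_end P /\ irrational_end P',
    end_ball P `&` end_ball P' = set0,
    end_ball P `|` end_ball P' = setT &
    S = [set P; P']].

Definition rational_point (S : set P1_end) : Prop :=
  exists2 phi : P1 -> P1, P1_automorphism phi &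
    S = [set P | exists2 zeta, range reduction zeta &
                   end_ball P = phi @` (reduction @^-1` [set zeta])].

Record Hp : Type := HpPoint {
  Hp_ends :> set P1_end;
  Hp_axiom : [\/ singular_point Hp_ends, irrational_point Hp_ends |
                 rational_point Hp_ends] }.

Definition HpR : set Hp := [set S : Hp | ~ singular_point S].

Definition associated_ball (S : Hp) (B : set P1) : Prop :=
  exists2 P : P1_end, (S : set P1_end) P & end_ball P = B.

Definition separates (S : Hp) (X : set P1) : Prop :=
  exists B B' : set P1, [/\ associated_ball S B, associated_ball S B',
    B <> B', X `&` B !=set0 & X `&` B' !=set0].

(* For D a subset of the affine line. *)
Definition diam (D : set P1) : R :=
  sup [set r | exists x y : K, [/\ D (Some x), D (Some y) & r = abs (x - y)]].

(* The complement of the associated ball that contains infinity. *)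
Definition finite_part (S : Hp) : set P1 :=
  ~` \bigcup_(B in [set B | associated_ball S B /\ B None]) B.

Definition dist_HpR (S S' : Hp) : R :=
  let D := finite_part S in let D' := finite_part S' in
  ln (diam (D `|` D') ^+ 2 / (diam D * diam D')) / ln p%:R.

(* Sequences of nonsingular points whose limit is S: a singular point is the
   limit of the points having the members of one of its chains as associated
   balls. *)
Definition approximates (u : nat -> Hp) (S : Hp) : Prop :=
  (HpR S /\ forall i, u i = S) \/
  (exists (P : P1_end) (c : chain),
     [/\ singular_end P, (S : set P1_end) = [set P], (P : set chain) c &
         forall i, HpR (u i) /\ associated_ball (u i) (chain_set c i)]).

(* The extension of dist_HpR; the limit exists and does not depend on the
   approximating sequences. *)
Definition dist_Hp (S S' : Hp) : R :=
  get [set l : R | exists u v : nat -> Hp, [/\ approximates u S,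
    approximates v S' & (fun i => dist_HpR (u i) (v i)) @ \oo --> l]].

Definition Hp_open (O : set Hp) : Prop :=
  forall S : Hp, O S ->
    exists2 e : R, 0 < e & forall T : Hp, dist_Hp S T < e -> O T.

Lemma Hp_openT : Hp_open setT.
Proof. by move=> S _; exists 1. Qed.

Lemma Hp_openI : setI_closed Hp_open.
Proof.
move=> A B oA oB S [/oA[e e0 eA] /oB[e' e'0 eB]].
exists (Num.min e e'); first by rewrite lt_min e0.
by move=> T; rewrite lt_min => /andP[/eA ? /eB ?].
Qed.

Lemma Hp_open_bigcup (I : Type) (f : I -> set Hp) :
  (forall i, Hp_open (f i)) -> Hp_open (\bigcup_i f i).
Proof.
move=> of_ S [i _ /of_[e e0 ef]].
by exists e => // T /ef ?; exists i.
Qed.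

HB.instance Definition _ := gen_eqMixin Hp.
HB.instance Definition _ := gen_choiceMixin Hp.
HB.instance Definition _ :=
  isOpenTopological.Build Hp Hp_openT Hp_openI Hp_open_bigcup.

Definition half_geodesic (z : P1) (S : Hp) (G : set Hp) : Prop :=
  HpR S /\ exists P : P1_end, [/\ (S : set P1_end) P, end_ball P z &
    G = [set T | [/\ HpR T, separates T (end_ball P `\ z) &
                     separates T (~` (end_ball P `\ z))]]].

(* Graph of the action of f on ends: chain_set c determines the end defined by
   c, hence each P has a unique image Q. *)
Definition end_image (f : {fraction {poly K}}) (P Q : P1_end) : Prop :=
  forall c : chain, (P : set chain) c -> \forall N \near \oo,
    exists2 c' : chain, (Q : set chain) c' &
      forall i, chain_set c' i = rat_eval f @` chain_set c (N + i)%N.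

(* Graph of the action of f on Hp: T contains the images of all the ends in S. *)
Definition Hp_image (f : {fraction {poly K}}) (S T : Hp) : Prop :=
  forall P : P1_end, (S : set P1_end) P ->
    exists2 Q : P1_end, end_image f P Q & (T : set P1_end) Q.

End ProjectiveLine.

Arguments P1 {p R} K.
Arguments Hp {p R} K.

(* Main.v *)
From mathcomp Require Import all_boot all_order all_algebra.
From mathcomp Require Import all_classical all_reals topology normedtype sequences exp.
From mathcomp Require Import ring lra zify.
Require Import Defs.
Import Order.TTheory GRing.Theory Num.Theory.
Import numFieldNormedType.Exports.

(** Write zeta_(a, r) for the point of H_p attached to the disc |z - a| <= r
    and, for a point S, let delta_S(x) be the value at S of |z - x|; thus
    delta_S(x) = max(|a - x|, r) at S = zeta_(a, r).  The functions delta_S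
    separate points and are Lipschitz on the logarithmic scale for the
    distance, so removing zeta_(a, r) disconnects { delta(a) < r } from the
    rest, and a connected X contains all the points zeta_(a, r) that separate
    two of its points.  With f = N / M, the image of S has
    delta(x) = |N - x M|_S / |M|_S, Gauss norms when S = zeta_(a, r).

    Start from zeta_(a, r) in X that f moves.  If it moves towards infinity,
    follow zeta_(a, t) for increasing t; if it moves into a disc
    |z - b| < r, the dominant terms of N - z M and (b - z) M agree there, so
    the disc contains a fixed point z0 of f, and one follows zeta_(z0, t) for
    decreasing t.  Either every point of the ray moves towards its end, which
    is then attracting, and the ray lies in X by convexity; or there is a
    first t0 with |f - z0| = t0 at zeta_(z0, t0).  Since |f - z0| is a
    monomial in t on the near side of t0, where points move towards the end,
    its exponent there is at most 0; hence t0 is in the value group, the images of the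
    points just before it already lie on the other side, and zeta_(z0, t0) is
    in X.  If that point is not fixed, f moves it into a disc |z - b| < t0 that
    contains fewer fixed points of f, and induction on their number
    concludes. *)

Set Implicit Arguments.
Unset Strict Implicit.
Unset Printing Implicit Defensive.

Local Open Scope classical_set_scope.
Local Open Scope ring_scope.

(** * Ultrametric absolute values and completions *)

(** The action on [Hp] is only a relation between sets of ends, so X can be said to contain an image
    only once the image point has been exhibited. This is done at the points zeta_(a, r), by
    computing images of thin annuli; it rests on C_p being algebraically closed, which [is_Cp] does
    not assert and which is proved for the completion. Singular points are never mapped: they enter
    through the functions delta, and convexity then leads to radii in the value group, which is
    dense and divisible.

    At t0 itself the ray gives no information: X need not be closed, so zeta_(z0, t0) cannot be
    reached as a limit. This is why the exponent of the monomial is examined: it forces the image of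
    a nearby point onto zeta_(z0, t0) or past it.

    The ray to infinity is handled by the same real-variable argument, applied to the inverse of |f
    - a| as a function of 1 / t, without any change of coordinate on the projective line. *)

Section UltrametricAbs.
Context {R : realType} {K : fieldType} {v : K -> R}.
Hypothesis hv : ultrametric_abs v.

Lemma uabs0 : v 0 = 0. Proof. exact/(uabs_eq0 hv). Qed.

Lemma uabs_neq0 x : x != 0 -> v x != 0.
Proof. by apply: contraNN => /eqP/(uabs_eq0 hv)/eqP. Qed.

Lemma uabs_gt0 x : x != 0 -> 0 < v x.
Proof. by move=> x0; rewrite lt0r uabs_neq0 //= (uabs_ge0 hv). Qed.

Lemma uabs1 : v 1 = 1.
Proof.
have v10 := uabs_neq0 (oner_neq0 K).
by apply: (mulfI v10); rewrite -(uabsM hv) !mulr1.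
Qed.

Lemma uabsX x n : v (x ^+ n) = v x ^+ n.
Proof. by elim: n => [|n IH]; rewrite ?expr0 ?uabs1 // !exprS (uabsM hv) IH. Qed.

Lemma uabsN x : v (- x) = v x.
Proof.
have : v (- x) ^+ 2 = v x ^+ 2 by rewrite -!uabsX sqrrN.
by move/(pexpIrn (isT : (0 < 2)%N)); apply; rewrite ?nnegrE (uabs_ge0 hv).
Qed.

Lemma uabsBC x y : v (x - y) = v (y - x).
Proof. by rewrite -uabsN opprB. Qed.

Lemma uabsB x y : v (x - y) <= Num.max (v x) (v y).
Proof. by rewrite -(uabsN y); exact: (uabsD hv). Qed.

Lemma uabsV x : v x^-1 = (v x)^-1.
Proof.
have [->|x0] := eqVneq x 0; first by rewrite invr0 uabs0 invr0.
by apply: (mulfI (uabs_neq0 x0)); rewrite -(uabsM hv) !divff ?uabs1 // uabs_neq0.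
Qed.

Lemma uabs_div x y : v (x / y) = v x / v y.
Proof. by rewrite (uabsM hv) uabsV. Qed.

Lemma uabsD_le x y e : v x <= e -> v y <= e -> v (x + y) <= e.
Proof. by move=> xe ye; rewrite (le_trans (uabsD hv _ _)) // ge_max xe. Qed.

Lemma uabsD_lt x y e : v x < e -> v y < e -> v (x + y) < e.
Proof. by move=> xe ye; rewrite (le_lt_trans (uabsD hv _ _)) // gt_max xe. Qed.

Lemma uabsB_le x y e : v x <= e -> v y <= e -> v (x - y) <= e.
Proof. by move=> xe ye; rewrite (le_trans (uabsB _ _)) // ge_max xe. Qed.

Lemma uabsB_lt x y e : v x < e -> v y < e -> v (x - y) < e.
Proof. by move=> xe ye; rewrite (le_lt_trans (uabsB _ _)) // gt_max xe. Qed.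

Lemma uabs_addl x y : v y < v x -> v (x + y) = v x.
Proof.
move=> yx; apply/eqP; rewrite eq_le; apply/andP; split.
  exact: uabsD_le (lexx _) (ltW yx).
rewrite leNgt; apply/negP => xyx.
by have := uabsB_lt xyx yx; rewrite addrK ltxx.
Qed.

Lemma uabs_sum (I : Type) (r : seq I) (P : pred I) (F : I -> K) e : 0 <= e ->
  (forall i, P i -> v (F i) <= e) -> v (\sum_(i <- r | P i) F i) <= e.
Proof.
move=> e0 Fe; apply: (big_ind (fun x => v x <= e)) => //; first by rewrite uabs0.
by move=> x y; exact: uabsD_le.
Qed.

Lemma uabs_sum_lt (I : Type) (r : seq I) (P : pred I) (F : I -> K) e : 0 < e ->
  (forall i, P i -> v (F i) < e) -> v (\sum_(i <- r | P i) F i) < e.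
Proof.
move=> e0 Fe; apply: (big_ind (fun x => v x < e)) => //; first by rewrite uabs0.
by move=> x y; exact: uabsD_lt.
Qed.

Lemma uabs_prod (I : Type) (r : seq I) (F : I -> K) :
  v (\prod_(i <- r) F i) = \prod_(i <- r) v (F i).
Proof.
apply: (big_morph v) => [x y|]; [exact: uabsM | exact: uabs1].
Qed.

End UltrametricAbs.

(** * Factorisation over an algebraically closed field *)

Section ClosedField.
Context {L : fieldType}.
Hypothesis Lclosed : GRing.closed_field_axiom L.

Lemma closed_factor (P : {poly L}) :
  exists s : seq L, P = lead_coef P *: \prod_(c <- s) ('X - c%:P).
Proof.
have [n] := ubnP (size P); elim: n => // n IH in P * => sPn.
(* The zero polynomial falls in this case: its leading coefficient 0 makes the empty list work. *)
have [sP|sP] := leqP (size P) 1.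
  exists [::]; rewrite big_nil alg_polyC {1}(size1_polyC sP).
  by rewrite lead_coefE; case: (size P) sP => [|[]].
have /(PreClosedField.closed_rootP Lclosed)[x /factor_theorem[Q PE]] : size P != 1.
  by rewrite neq_ltn sP orbT.
have P0 : P != 0 by rewrite -size_poly_gt0 (ltn_trans _ sP).
have Q0 : Q != 0 by apply: contraNneq P0 => Q0; rewrite PE Q0 mul0r.
have [|s QE] := IH Q.
  by move: sPn; rewrite PE size_Mmonic ?monicXsubC // size_XsubC addn2 /=.
exists (x :: s); rewrite big_cons {1}PE {1}QE.
by rewrite PE lead_coefM lead_coefXsubC mulr1 -scalerAl mulrC.
Qed.

End ClosedField.

(** * Roots in the completion of an algebraically closed field *)

Section CompletionClosed.
Context {R : realType} {K L : fieldType} {vK : K -> R} {vL : L -> R}.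
Context {j : {rmorphism K -> L}}.
Hypothesis uK : ultrametric_abs vK.
Hypothesis Kclosed : GRing.closed_field_axiom K.
Hypothesis cmp : is_completion vK vL j.

Let uL : ultrametric_abs vL. Proof. by case: cmp. Qed.
Let cL : abs_complete vL. Proof. by case: cmp. Qed.
Let vj x : vL (j x) = vK x. Proof. by case: cmp. Qed.
Let dense y e : 0 < e -> exists x : K, vL (y - j x) < e.
Proof. by case: cmp => _ _ _; apply. Qed.

Variables (n : nat) (a : nat -> L) (M : R).
Hypotheses (n_gt0 : (0 < n)%N) (M1 : 1 <= M) (aM : forall i, (i < n)%N -> vL (a i) <= M).

Let M0 : 0 < M. Proof. exact: lt_le_trans M1. Qed.
Let P (x : L) : L := x ^+ n - \sum_(i < n) a i * x ^+ i.

(* One step of the approximation of a root: replace the coefficients by close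
   elements of K and take the root nearest to x. *)
Lemma root_step (x : K) (t e : R) : 0 < t -> t <= M -> 0 < e ->
  vK x <= M -> vL (P (j x)) <= t ^+ n ->
  exists y : K, [/\ vK y <= M, vL (P (j y)) <= e & vK (x - y) <= t].
Proof.
move=> t0 tM e0 xM Px.
(* An error on the i-th coefficient is multiplied by |z| ^ i <= M ^ n, hence the division by M ^
   n. *)
pose e' := Num.min e (t ^+ n) / M ^+ n.
have tn0 : 0 < t ^+ n by rewrite exprn_gt0.
have e'0 : 0 < e' by rewrite divr_gt0 ?exprn_gt0 // lt_min e0.
have [b bP] : exists b : nat -> K, forall i, vL (a i - j (b i)) < e'.
  by exists (fun i => sval (cid (dense (a i) e'0))) => i; case: cid.
have close z : vK z <= M ->
    vL (P (j z) - j (z ^+ n - \sum_(i < n) b i * z ^+ i)) <= Num.min e (t ^+ n).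
  move=> zM; rewrite /P rmorphB rmorphXn rmorph_sum /=.
  set u := j z ^+ n.
  have -> : forall s s' : L, u - s - (u - s') = s' - s by move=> s s'; ring.
  rewrite -sumrB; apply: (uabs_sum uL) => [|i _].
    by rewrite le_min (ltW e0) ltW.
  rewrite rmorphM rmorphXn /= -mulrBl (uabsM uL) (uabsX uL) vj uabsBC //.
  apply: (@le_trans _ _ (e' * M ^+ n)); last by rewrite /e' divfK // expf_neq0 ?gt_eqF.
  apply: ler_pM; rewrite ?(uabs_ge0 uL) ?exprn_ge0 ?(uabs_ge0 uK) ?(ltW (bP _)) //.
  apply: (@le_trans _ _ (M ^+ i)); first by rewrite lerXn2r ?nnegrE ?(uabs_ge0 uK) ?(ltW M0).
  by rewrite ler_weXn2l // ltnW.
pose Q : {poly K} := 'X^n - \poly_(i < n) b i.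
have QE z : Q.[z] = z ^+ n - \sum_(i < n) b i * z ^+ i.
  by rewrite /Q !hornerE horner_poly.
have sQ : size Q = n.+1.
  by rewrite /Q size_polyDl size_polyXn // size_polyN ltnS size_poly.
have lQ : lead_coef Q = 1.
  by rewrite /Q lead_coefDl ?lead_coefXn // size_polyN size_polyXn ltnS size_poly.
have [s sE] := closed_factor Kclosed Q.
have ss : size s = n.
  by move: sQ; rewrite sE lQ scale1r size_prod_XsubC => -[].
have Qx : vK Q.[x] <= t ^+ n.
  rewrite QE -vj; have := close _ xM; rewrite le_min => /andP[_ h].
  by rewrite -(subKr (P (j x)) (j _)); apply: uabsB_le.
(* |Q(x)| is the product of the distances from x to the n roots; if all of them exceeded t, it would
   exceed t ^ n. *)
have [y ys xy] : exists2 y, y \in s & vK (x - y) <= t.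
  apply: contrapT => H; move: Qx.
  rewrite sE lQ scale1r horner_prod uabs_prod // leNgt => /negP; apply.
  have: forall y, y \in s -> t < vK (x - y).
    by move=> y ys; rewrite ltNge; apply/negP => h; apply: H; exists y.
  rewrite -ss; have: (0 < size s)%N by rewrite ss.
  case: (s) => // y0 s' _; elim: s' y0 => [|y1 s' IH] y0 h.
    by rewrite big_seq1 expr1 hornerXsubC h ?mem_head.
  rewrite big_cons exprS ltr_pM ?exprn_ge0 ?(ltW t0) //.
    by rewrite hornerXsubC h ?mem_head.
  by apply: IH => y ys'; apply: h; rewrite inE ys' orbT.
have yM : vK y <= M.
  by rewrite -(subKr x y); apply: uabsB_le => //; apply: le_trans tM.
exists y; split=> //.
have := close _ yM; rewrite -QE; have -> : Q.[y] = 0.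
  by rewrite sE lQ scale1r; apply/eqP; rewrite -/(root _ _) root_prod_XsubC.
by rewrite rmorph0 subr0 le_min => /andP[].
Qed.

(** The factor M ^ n bounds (x ^ i - y ^ i) / (x - y), the remaining factor M bounds the
    coefficients. *)
Lemma P_lip (x y : L) : vL x <= M -> vL y <= M ->
  vL (P x - P y) <= vL (x - y) * (M ^+ n * M).
Proof.
move=> xM yM; rewrite /P.
have powM z i : (i <= n)%N -> vL z <= M -> vL (z ^+ i) <= M ^+ n.
  move=> ni zM; rewrite (uabsX uL); apply: (@le_trans _ _ (M ^+ i)).
    by rewrite lerXn2r ?nnegrE ?(uabs_ge0 uL) ?(ltW M0).
  by rewrite ler_weXn2l.
have pw i : (i <= n)%N -> vL (x ^+ i - y ^+ i) <= vL (x - y) * M ^+ n.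
  move=> ni; rewrite subrXX (uabsM uL) ler_wpM2l ?(uabs_ge0 uL) //.
  apply: uabs_sum; rewrite ?exprn_ge0 ?(ltW M0) // => k _.
  rewrite (uabsM uL) !(uabsX uL).
  apply: (@le_trans _ _ (M ^+ (i.-1 - k) * M ^+ k)).
    by rewrite ler_pM ?exprn_ge0 ?(uabs_ge0 uL) // lerXn2r ?nnegrE ?(uabs_ge0 uL) ?(ltW M0).
  rewrite -exprD ler_weXn2l // subnK ?(leq_trans (leq_pred _)) //.
  by case: (i) k => [[]|i'] // k; rewrite -ltnS.
have -> : x ^+ n - \sum_(i < n) a i * x ^+ i - (y ^+ n - \sum_(i < n) a i * y ^+ i) =
   (x ^+ n - y ^+ n) - (\sum_(i < n) a i * (x ^+ i - y ^+ i)).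
  by under [in RHS]eq_bigr => i _ do rewrite mulrBr; rewrite sumrB; ring.
apply: uabsB_le => //.
  rewrite (le_trans (pw _ (leqnn _))) // ler_wpM2l ?(uabs_ge0 uL) //.
  by rewrite ler_peMr ?exprn_ge0 ?(ltW M0).
apply: uabs_sum => // [|i _].
  by rewrite !mulr_ge0 ?(uabs_ge0 uL) ?exprn_ge0 ?(ltW M0).
rewrite (uabsM uL) mulrA mulrC ler_pM ?(uabs_ge0 uL) ?aM //.
by rewrite pw // ltnW.
Qed.

(** Iterating [root_step] with t halved at each step gives a Cauchy sequence along which P tends to
    0; the limit is a root by [P_lip]. *)
Lemma completion_root : exists x : L, P x = 0.
Proof.
pose h : R := 2^-1.
have h0 : 0 < h by rewrite invr_gt0.
have h1 : h < 1 by rewrite invf_lt1 // ltr1n.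
pose t m := M * h ^+ m.
have t0 m : 0 < t m by rewrite mulr_gt0 ?exprn_gt0.
have tM m : t m <= M by rewrite ler_piMr ?(ltW M0) // exprn_ile1 ?(ltW h0) ?(ltW h1).
have te e : 0 < e -> exists N, forall m, (N <= m)%N -> t m < e.
  move=> e0.
  have : (fun m => t m) @ \oo --> (0 : R).
    rewrite -(mulr0 M); apply: cvgM; first exact: cvg_cst.
    by apply: cvg_expr; rewrite ger0_norm ?(ltW h0).
  move=> /cvgrPdist_lt tc; have [N _ H] := tc e e0.
  by exists N => m Nm; have := H m Nm; rewrite /= sub0r normrN ger0_norm ?(ltW (t0 _)).
pose ok m x := vK x <= M /\ vL (P (j x)) <= t m ^+ n.
(* The premise [ok m x] stays under the existential so that choice yields a total map; the value 0
   outside [ok] is never met. *)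
have stp m x : exists y, ok m x -> ok m.+1 y /\ vK (x - y) <= t m.
  have [[xM Px]|nok] := pselect (ok m x); last by exists 0 => /nok.
  have tn : 0 < t m.+1 ^+ n by rewrite exprn_gt0.
  by have [y [yM Py xy]] := root_step (t0 m) (tM m) tn xM Px; exists y => _.
have [nxt nxtP] : exists nxt : nat -> K -> K, forall m x, ok m x -> ok m.+1 (nxt m x) /\
     vK (x - nxt m x) <= t m.
  by exists (fun m x => sval (cid (stp m x))) => m x; case: cid.
pose u := fix u m := if m is m'.+1 then nxt m' (u m') else 0.
(* The iteration can start at 0, since P(0) is the opposite of [a 0], of norm at most M <= M ^ n. *)
have u0 : ok 0 (u 0%N).
  split; first by rewrite uabs0 // ltW.
  rewrite /t expr0 mulr1 /= rmorph0 /P expr0n eqn0Ngt n_gt0 sub0r (uabsN uL).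
  apply: (@le_trans _ _ M); last by rewrite ler_eXnr.
  apply: uabs_sum => [||[[|i] ni] _] //=; first exact: ltW.
    by rewrite mulr1 aM.
  by rewrite expr0n mulr0 uabs0 // ltW.
have uok m : ok m (u m).
  by elim: m => // m /nxtP[].
have udist m k : vK (u m - u (m + k)%N) <= t m.
  elim: k => [|k IH]; first by rewrite addn0 subrr uabs0 // ltW.
  rewrite -(subrK (u (m + k)%N) (u m)) -addrA; apply: uabsD_le => //.
  rewrite addnS; apply: (le_trans (proj2 (nxtP _ _ (uok _)))).
  rewrite /t ler_pM2l // exprD ler_piMr ?exprn_ge0 ?(ltW h0) //.
  by rewrite exprn_ile1 ?(ltW h0) ?(ltW h1).
have cau : forall e : R, 0 < e -> exists N : nat, forall m k : nat,
       (N <= m)%N -> (N <= k)%N -> vL (j (u m) - j (u k)) < e.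
  move=> e /te[N H]; exists N => m k Nm Nk; rewrite -rmorphB vj.
  wlog mk : m k Nm Nk / (m <= k)%N.
    by move=> W; case: (leqP m k) => [/W|/ltnW/W]; [apply|rewrite uabsBC //; apply].
  by rewrite -(subnKC mk) (le_lt_trans (udist _ _)) // H.
have [l lP] := cL cau.
have lM : vL l <= M.
  have [N NP] := lP _ M0.
  rewrite -(subKr (j (u N)) l); apply: uabsB_le => //; first by rewrite vj; case: (uok N).
  exact/ltW/NP.
exists l; apply/(uabs_eq0 uL)/eqP; rewrite eq_le (uabs_ge0 uL) andbT.
apply/ler_addgt0Pl => e e0; rewrite addr0.
have C0 : 0 < M ^+ n * M by rewrite mulr_gt0 ?exprn_gt0.
have [N1 H1] := lP (e / (M ^+ n * M)) (divr_gt0 e0 C0).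
have m1 : 0 < Num.min e 1 by rewrite lt_min e0 /=.
have [N2 H2] := te _ m1.
pose m := maxn N1 N2; have [uM Pu] := uok m.
rewrite -(subKr (P (j (u m))) (P l)); apply: uabsB_le => //.
  apply: (le_trans Pu); have := H2 m (leq_maxr _ _); rewrite lt_min => /andP[te1 t1].
  apply: le_trans (ltW te1).
  by apply: ler_iXnr => //; apply: ltW.
apply: le_trans (P_lip _ _) _ => //; first by rewrite vj.
by rewrite -ler_pdivlMr //; apply/ltW/H1; exact: leq_maxl.
Qed.

End CompletionClosed.

Lemma completion_closed (R : realType) (K L : fieldType) (vK : K -> R) (vL : L -> R)
    (j : {rmorphism K -> L}) : ultrametric_abs vK -> GRing.closed_field_axiom K ->
  is_completion vK vL j -> GRing.closed_field_axiom L.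
Proof.
move=> uK Kc cmp n a n0; have [uL _ _ _] := cmp.
pose M := \big[Num.max/1]_(i < n) vL (a i).
have M1 : 1 <= M by exact: bigmax_ge_id.
have aM i : (i < n)%N -> vL (a i) <= M.
  by move=> ni; exact: (le_bigmax _ (fun i : 'I_n => vL (a i)) (Ordinal ni)).
have [x /eqP] := completion_root uK Kc cmp n0 M1 aM.
by rewrite subr_eq0 => /eqP xE; exists x.
Qed.

(** * The value group and balls of C_p *)

Section PadicComplex.
Context {p : nat} {R : realType} {K : padicComplexType p R}.
Local Notation abs := (@Cp_abs p R K).
Local Notation value_group := (value_group K).

Lemma Cp_ultra : ultrametric_abs abs.
Proof. by have [Qp [vQp [i [Qb [vb [j [k [_ _ _ []]]]]]]]] := Cp_axiom K. Qed.

Lemma Cp_complete : abs_complete abs.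
Proof. by have [Qp [vQp [i [Qb [vb [j [k [_ _ _ []]]]]]]]] := Cp_axiom K. Qed.

Lemma Cp_closed : GRing.closed_field_axiom K.
Proof.
have [Qp [vQp [i [Qb [vb [j [k [_ [closedQb _] [ub _] cmp]]]]]]]] := Cp_axiom K.
exact: completion_closed ub closedQb cmp.
Qed.

Lemma abs_p : prime p -> abs p%:R = p%:R^-1.
Proof.
move=> pp; have [Qp [vQp [i [Qb [vb [j [k [[_ _ hi _] _ [_ hj] [_ _ hk _]]]]]]]]] := Cp_axiom K.
have -> : (p%:R : K) = k (j (i p%:R)) by rewrite !rmorph_nat.
rewrite hk hj hi /padic_abs pnatr_eq0 -[(p : nat) == 0%N]negbK -lt0n prime_gt0 //=.
have -> : (p%:R : rat) = (Posz p)%:~R by [].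
by rewrite numq_int denq_int /= logn1 lognE pp prime_gt0 // dvdnn divnn prime_gt0 //= logn1 mul1r.
Qed.

Lemma value_group_abs x : x != 0 -> value_group (abs x).
Proof. by move=> x0; exists x. Qed.

Lemma value_group_gt0 r : value_group r -> 0 < r.
Proof. by case=> x x0 <-; exact: uabs_gt0 Cp_ultra _ x0. Qed.

Lemma value_groupM r s : value_group r -> value_group s -> value_group (r * s).
Proof.
move=> [x x0 <-] [y y0 <-]; exists (x * y); first by rewrite mulf_neq0.
exact: uabsM Cp_ultra _ _.
Qed.

Lemma value_groupV r : value_group r -> value_group r^-1.
Proof.
move=> [x x0 <-]; exists x^-1; rewrite ?invr_eq0 //; exact: uabsV Cp_ultra _.
Qed.

Lemma value_groupX r n : value_group r -> value_group (r ^+ n).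
Proof.
move=> [x x0 <-]; exists (x ^+ n); first by rewrite expf_neq0.
exact: uabsX Cp_ultra _ _.
Qed.

Lemma Cp_nth_root (x : K) n : (0 < n)%N -> exists y, y ^+ n = x.
Proof.
move=> n0; have [y yE] := Cp_closed (fun i => if i == 0%N then x else 0) n0.
exists y; rewrite yE; case: n n0 {yE} => // n _.
rewrite big_ord_recl /= expr0 mulr1 big1 ?addr0 // => i _.
by rewrite mul0r.
Qed.

(** Since C_p is algebraically closed, its value group is divisible; this is what puts the radius of
    a turning point, a root of an element of the group, into the group. *)
Lemma value_group_root r n : (0 < n)%N -> 0 <= r -> value_group (r ^+ n) -> value_group r.
Proof.
move=> n0 r0 [x x0 xE]; have [y yx] := Cp_nth_root x n0.
exists y; first by apply: contraNneq x0 => y0; rewrite -yx y0 expr0n gtn_eqF.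
apply: (pexpIrn n0); rewrite ?nnegrE ?(uabs_ge0 Cp_ultra) //.
by rewrite -(uabsX Cp_ultra) yx.
Qed.

Hypothesis p_prime : prime p.

(** On the scale of log_p the group contains every rational q: a root of order [denq q] of an
    element of norm p ^ [numq q] has norm p ^ q. *)
Lemma value_group_dense x y : 0 <= x -> x < y -> exists r, [/\ value_group r, x < r & r < y].
Proof.
wlog x0 : x / 0 < x.
  move=> W; rewrite le_eqVlt => /predU1P[<- y0|x0 xy]; last exact: W (ltW _) xy.
  have [|||r [vr h1 h2]] := W (y / 2) _ _ _; try by lra.
  by exists r; split=> //; apply: lt_trans h1; lra.
move=> _ xy; have y0 : 0 < y by exact: lt_trans xy.
have q1 : 1 < p%:R :> R by rewrite ltr1n prime_gt1.
have q0 : 0 < p%:R :> R by lra.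
have l0 : 0 < ln (p%:R : R) by rewrite ln_gt0.
have lxy : ln x / ln p%:R < ln y / ln p%:R by rewrite ltr_pM2r ?invr_gt0 // ltr_ln.
have [q] := rat_in_itvoo lxy; rewrite in_itv /= => /andP[].
rewrite ltr_pdivrMr // ltr_pdivlMr // => xq qy.
have pK0 : (p%:R : K) != 0.
  apply/eqP => p0; have := abs_p p_prime; rewrite p0 (uabs0 Cp_ultra) => /esym/eqP.
  by rewrite invr_eq0 gt_eqF.
have vp : value_group p%:R by rewrite -[p%:R]invrK; apply: value_groupV; exists p%:R => //; exact: abs_p.
have [c [vc lc]] : exists c : R, value_group c /\ ln c = (numq q)%:~R * ln p%:R.
  case: (numq q) => k.
    by exists (p%:R ^+ k); split; [exact: value_groupX|rewrite lnXn // -[ln _ *+ k]mulr_natl].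
  exists (p%:R ^+ k.+1)^-1; split; first exact/value_groupV/value_groupX.
  by rewrite lnV ?posrE ?exprn_gt0 // lnXn // NegzE mulrNz mulNr -[ln _ *+ _]mulr_natl.
have d0 : (0 < `|denq q|)%N by rewrite absz_gt0 denq_neq0.
have [b b0 bc] := vc; have [a ab] := Cp_nth_root b d0.
have a0 : a != 0 by apply: contraNneq b0 => a0; rewrite -ab a0 expr0n gtn_eqF.
have va := uabs_gt0 Cp_ultra a0.
exists (abs a); split; first exact: value_group_abs.
all: rewrite -ltr_ln ?posrE //.
all: have : ln (abs a) = ratr q * ln p%:R;
  [ have : ln (abs a) *+ `|denq q| = (numq q)%:~R * ln p%:R
      by rewrite -lnXn // -(uabsX Cp_ultra) ab bc lc
  | by move=> -> ].
all: have dE : ((denq q)%:~R : R) = (`|denq q|%N)%:R by rewrite natr_absz ger0_norm // denq_ge0.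
all: have d0R : (`|denq q|%N)%:R != 0 :> R by rewrite pnatr_eq0 -lt0n.
all: move=> h; apply: (mulfI d0R); rewrite mulr_natl h /ratr dE; field; exact: d0R.
Qed.

Lemma value_group_between r s : 0 <= r -> r < s -> exists z, z != 0 /\ (r < abs z /\ abs z < s).
Proof. by move=> r0 /(value_group_dense r0)[_ [[z z0 <-] h1 h2]]; exists z. Qed.

End PadicComplex.

(** * Balls of the affine line and their radii *)

Section Balls.
Context {p : nat} {R : realType} {K : padicComplexType p R}.
Local Notation abs := (@Cp_abs p R K).
Local Notation value_group := (value_group K).
Local Notation uC := (@Cp_ultra p R K).
Implicit Types (a b x y z : K) (r s t : R).

(** Both are used for all r > 0. Outside the value group they coincide ([cball_irr]), so the two
    formulas also cover irrational balls. *)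
Definition cball a r : set (P1 K) := Some @` [set z | abs (z - a) <= r].
Definition oball a r : set (P1 K) := Some @` [set z | abs (z - a) < r].

Lemma cballP a r z : cball a r (Some z) <-> abs (z - a) <= r.
Proof. by split=> [[y ? [<-]] //|h]; exists z. Qed.

Lemma oballP a r z : oball a r (Some z) <-> abs (z - a) < r.
Proof. by split=> [[y ? [<-]] //|h]; exists z. Qed.

Lemma cball_None a r : ~ cball a r None. Proof. by case. Qed.

Lemma oball_None a r : ~ oball a r None. Proof. by case. Qed.

Lemma absBC x y : abs (x - y) = abs (y - x). Proof. exact: uabsBC uC _ _. Qed.

Lemma abs_ge0 x : 0 <= abs x. Proof. exact: uabs_ge0 uC _. Qed.

Lemma abs_eq0 x : (abs x == 0) = (x == 0).
Proof. by apply/eqP/eqP => /(uabs_eq0 uC). Qed.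

Lemma abs0 : abs 0 = 0. Proof. exact: uabs0 uC. Qed.

Lemma abs_trans y x z r : abs (x - y) <= r -> abs (y - z) <= r -> abs (x - z) <= r.
Proof. by move=> h1 h2; rewrite -(subrK y x) -addrA; apply: (uabsD_le uC). Qed.

Lemma abs_lttrans y x z r : abs (x - y) < r -> abs (y - z) < r -> abs (x - z) < r.
Proof. by move=> h1 h2; rewrite -(subrK y x) -addrA; apply: (uabsD_lt uC). Qed.

Lemma abs_dom x y z : abs (y - z) < abs (x - y) -> abs (x - z) = abs (x - y).
Proof. by move=> h; have -> : x - z = (x - y) + (y - z); [ring|rewrite (uabs_addl uC)]. Qed.

Lemma cball_center a b r : abs (a - b) <= r -> cball a r = cball b r.
Proof.
move=> ab; apply/seteqP; split=> _ [z /= h <-]; apply/cballP.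
  exact: abs_trans ab.
by apply: abs_trans h _; rewrite absBC.
Qed.

Lemma oball_center a b r : abs (a - b) < r -> oball a r = oball b r.
Proof.
move=> ab; apply/seteqP; split=> _ [z /= h <-]; apply/oballP.
  exact: abs_lttrans ab.
by apply: abs_lttrans h _; rewrite absBC.
Qed.

Lemma oball_sub_cball a r : oball a r `<=` cball a r.
Proof. by move=> _ [z /= h <-]; apply/cballP/ltW. Qed.

Lemma cball_mem a r : 0 <= r -> cball a r (Some a).
Proof. by move=> r0; apply/cballP; rewrite subrr abs0. Qed.

Lemma oball_mem a r : 0 < r -> oball a r (Some a).
Proof. by move=> r0; apply/oballP; rewrite subrr abs0. Qed.

Lemma cball_irr a r : 0 < r -> ~ value_group r -> cball a r = oball a r.
Proof.
move=> r0 vr; apply/seteqP; split; last exact: oball_sub_cball.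
move=> _ [z /= h <-]; apply/oballP; rewrite lt_neqAle h andbT.
apply/eqP => zr; apply: vr; rewrite -zr; apply: value_group_abs.
by rewrite -abs_eq0 zr gt_eqF.
Qed.

Hypothesis p_prime : prime p.

(** Density of the value group makes radii visible in the point sets: the inclusions and equalities
    of balls below are decided by such a point. *)
Lemma between_pt a r s : 0 <= r -> r < s -> exists z, r < abs (z - a) /\ abs (z - a) < s.
Proof.
move=> r0 /(value_group_between (K := K) p_prime r0)[y [_ h]].
by exists (a + y); rewrite addrC addKr.
Qed.

Lemma oball_sub_radius a b r s : 0 < r -> oball a r `<=` oball b s ->
  r <= s /\ abs (a - b) < s.
Proof.
move=> r0 sub; have ab := (oballP _ _ _).1 (sub _ (oball_mem a r0)).
split=> //; rewrite leNgt; apply/negP => sr.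
have [z [h1 h2]] := between_pt a (le_trans (abs_ge0 _) (ltW ab)) sr.
have /oballP zb := sub (Some z) ((oballP _ _ _).2 h2).
rewrite absBC in ab; have := abs_lttrans zb ab.
by rewrite ltNge (ltW h1).
Qed.

Lemma cball_sub_radius a b r s : 0 < r -> cball a r `<=` cball b s ->
  r <= s /\ abs (a - b) <= s.
Proof.
move=> r0 sub; have ab := (cballP _ _ _).1 (sub _ (cball_mem a (ltW r0))).
split=> //; rewrite leNgt; apply/negP => sr.
have [z [h1 h2]] := between_pt a (le_trans (abs_ge0 _) ab) sr.
have /cballP zb := sub (Some z) ((cballP _ _ _).2 (ltW h2)).
rewrite absBC in ab; have := abs_trans zb ab.
by rewrite leNgt h1.
Qed.

(** The case to exclude is r = s outside the value group, where both balls are the same set. *)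
Lemma cball_sub_oball_radius a b r s : cball a r `<=` oball b s -> 0 < r ->
  cball a r <> oball b s -> r < s /\ abs (a - b) < s.
Proof.
move=> sub r0 neq; have ab := (oballP _ _ _).1 (sub _ (cball_mem a (ltW r0))).
split=> //; rewrite ltNge; apply/negP => sr; apply: neq.
apply/seteqP; split=> //; rewrite -(oball_center ab).
by move=> _ [z /= h <-]; apply/cballP; apply: le_trans sr; apply: ltW.
Qed.

Lemma oball_inj a b r s : 0 < r -> 0 < s -> oball a r = oball b s ->
  r = s /\ abs (a - b) < r.
Proof.
move=> r0 s0 e; have [|rs ab] := @oball_sub_radius a b r s r0; first by rewrite e.
have [|sr _] := @oball_sub_radius b a s r s0; first by rewrite e.
have rsE : r = s by apply/eqP; rewrite eq_le rs.
by split=> //; rewrite rsE.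
Qed.

Lemma cball_inj a b r s : 0 < r -> 0 < s -> cball a r = cball b s ->
  r = s /\ abs (a - b) <= r.
Proof.
move=> r0 s0 e; have [|rs ab] := @cball_sub_radius a b r s r0; first by rewrite e.
have [|sr _] := @cball_sub_radius b a s r s0; first by rewrite e.
have rsE : r = s by apply/eqP; rewrite eq_le rs.
by split=> //; rewrite rsE.
Qed.

End Balls.

(** * Gauss norms of polynomials *)

Section GaussNorm.
Context {p : nat} {R : realType} {K : padicComplexType p R}.
Local Notation abs := (@Cp_abs p R K).
Local Notation uC := (@Cp_ultra p R K).
Implicit Types (P Q : {poly K}) (r s t e : R) (i j l n : nat).

Definition gaussnorm P t : R := \big[Num.max/0]_(i < size P) (abs P`_i * t ^+ i).

Lemma gaussnorm_ge P i t : 0 <= t -> abs P`_i * t ^+ i <= gaussnorm P t.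
Proof.
move=> t0; have [iP|Pi] := ltnP i (size P).
  exact: (le_bigmax _ (fun i : 'I_(size P) => abs P`_i * t ^+ i) (Ordinal iP)).
by rewrite nth_default // abs0 mul0r /gaussnorm; exact: bigmax_ge_id.
Qed.

Lemma gaussnorm_ge0 P t : 0 <= gaussnorm P t.
Proof. exact: bigmax_ge_id. Qed.

Lemma gaussnorm_le P t e : 0 <= e -> (forall i, abs P`_i * t ^+ i <= e) -> gaussnorm P t <= e.
Proof. by move=> e0 h; apply: bigmax_le. Qed.

Lemma gaussnorm_gt0 P t : P != 0 -> 0 < t -> 0 < gaussnorm P t.
Proof.
move=> P0 t0; apply: lt_le_trans (gaussnorm_ge P (size P).-1 (ltW t0)).
by rewrite mulr_gt0 ?exprn_gt0 // (uabs_gt0 uC) // -lead_coefE lead_coef_eq0.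
Qed.

Lemma gaussnorm_attained P t : P != 0 -> 0 < t ->
  exists2 i, (i < size P)%N & gaussnorm P t = abs P`_i * t ^+ i.
Proof.
move=> P0 t0; apply: contrapT => H.
have := gaussnorm_gt0 P0 t0; suff : gaussnorm P t < gaussnorm P t by rewrite ltxx.
rewrite {1}/gaussnorm; apply: bigmax_lt => [|[i iP] _]; first exact: gaussnorm_gt0.
rewrite lt_neqAle gaussnorm_ge ?(ltW t0) // andbT.
by apply/eqP => /= h; apply: H; exists i.
Qed.

Lemma gaussnorm0 t : gaussnorm 0 t = 0.
Proof. by rewrite /gaussnorm size_poly0 big_ord0. Qed.

Lemma gaussnormD P Q t : 0 <= t -> gaussnorm (P + Q) t <= Num.max (gaussnorm P t) (gaussnorm Q t).
Proof.
move=> t0; apply: gaussnorm_le => [|i]; first by rewrite le_max gaussnorm_ge0.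
rewrite coefD; have [h|h] := leP (abs P`_i) (abs Q`_i).
  apply: (@le_trans _ _ (abs Q`_i * t ^+ i)); last by rewrite le_max gaussnorm_ge ?orbT.
  by rewrite ler_wpM2r ?exprn_ge0 // (uabsD_le uC).
apply: (@le_trans _ _ (abs P`_i * t ^+ i)); last by rewrite le_max gaussnorm_ge.
by rewrite ler_wpM2r ?exprn_ge0 // (uabsD_le uC) // ltW.
Qed.

Lemma gaussnormZ c P t : 0 <= t -> gaussnorm (c *: P) t = abs c * gaussnorm P t.
Proof.
move=> t0; have [->|c0] := eqVneq c 0; first by rewrite scale0r gaussnorm0 abs0 mul0r.
have ac := uabs_gt0 uC c0.
apply/eqP; rewrite eq_le; apply/andP; split.
  apply: gaussnorm_le => [|i]; first by rewrite mulr_ge0 ?gaussnorm_ge0 ?abs_ge0.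
  by rewrite coefZ (uabsM uC) -mulrA ler_pM2l // gaussnorm_ge.
rewrite -ler_pdivlMl //; apply: gaussnorm_le => [|i].
  by rewrite mulr_ge0 ?invr_ge0 ?gaussnorm_ge0 ?abs_ge0.
rewrite ler_pdivlMl // mulrA -(uabsM uC) -coefZ; exact: gaussnorm_ge.
Qed.

Lemma gaussnormN P t : 0 <= t -> gaussnorm (- P) t = gaussnorm P t.
Proof. by move=> t0; rewrite -scaleN1r gaussnormZ // (uabsN uC) (uabs1 uC) mul1r. Qed.

Lemma gaussnormB P Q t : 0 <= t -> gaussnorm (P - Q) t <= Num.max (gaussnorm P t) (gaussnorm Q t).
Proof. by move=> t0; rewrite -(gaussnormN Q t0); exact: gaussnormD. Qed.

Lemma gaussnorm_dom P Q t : 0 <= t -> gaussnorm Q t < gaussnorm P t -> gaussnorm (P + Q) t = gaussnorm P t.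
Proof.
move=> t0 h; apply/eqP; rewrite eq_le; apply/andP; split.
  by rewrite (le_trans (gaussnormD _ _ t0)) // ge_max lexx ltW.
rewrite leNgt; apply/negP => h'.
have := gaussnormB (P + Q) Q t0; rewrite addrK le_max leNgt h' /=.
by rewrite leNgt h.
Qed.

Lemma gaussnormC c t : 0 <= t -> gaussnorm c%:P t = abs c.
Proof.
move=> t0; rewrite -[c%:P]mulr1 mul_polyC gaussnormZ // /gaussnorm size_poly1 big_ord_recl big_ord0.
by rewrite coef1 /= (uabs1 uC) expr0 mulr1 max_l // mulr1.
Qed.

(* Gauss's lemma for a linear factor: the coefficient next to the largest
   (resp. at any) index attaining the norm of P attains the norm of the product
   if |c| <= t (resp. |c| > t). *)
Lemma gaussnorm_XsubC c P t : 0 < t ->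
  gaussnorm (('X - c%:P) * P) t = Num.max (abs c) t * gaussnorm P t.
Proof.
move=> t0; have t0' := ltW t0.
have [->|P0] := eqVneq P 0; first by rewrite mulr0 gaussnorm0 mulr0.
have gP := gaussnorm_gt0 P0 t0.
have m0 : 0 <= Num.max (abs c) t by rewrite le_max t0' orbT.
have cE i : (('X - c%:P) * P)`_i.+1 = P`_i - c * P`_i.+1.
  by rewrite mulrBl coefB coefXM coefCM.
have c0E : (('X - c%:P) * P)`_0 = - (c * P`_0).
  by rewrite mulrBl coefB coefXM coefCM sub0r.
have cle i : abs (c * P`_i) * t ^+ i <= abs c * gaussnorm P t.
  by rewrite (uabsM uC) -mulrA ler_wpM2l ?abs_ge0 // gaussnorm_ge.
have tle i : abs P`_i * t ^+ i.+1 <= t * gaussnorm P t.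
  by rewrite exprS mulrCA ler_wpM2l // gaussnorm_ge.
have tm : t * gaussnorm P t <= Num.max (abs c) t * gaussnorm P t.
  by rewrite ler_pM2r // le_max lexx orbT.
have cm : abs c * gaussnorm P t <= Num.max (abs c) t * gaussnorm P t.
  by rewrite ler_pM2r // le_max lexx.
apply/eqP; rewrite eq_le; apply/andP; split.
  apply: gaussnorm_le => [|[|i]]; first by rewrite mulr_ge0 ?gaussnorm_ge0.
    by rewrite c0E (uabsN uC); apply: le_trans cm; apply: cle.
  rewrite cE; have [h|h] := leP (abs P`_i) (abs (c * P`_i.+1)).
    apply: (le_trans _ cm); apply: le_trans (cle i.+1).
    by rewrite ler_wpM2r ?exprn_ge0 // (uabsB_le uC).
  apply: (le_trans _ tm); apply: le_trans (tle i).
  by rewrite ler_wpM2r ?exprn_ge0 // (uabsB_le uC) // ltW.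
have [tc|ct] := leP (abs c) t; last first.
  have [i _ gi] := gaussnorm_attained P0 t0.
  apply: le_trans (gaussnorm_ge _ i t0'); rewrite gi mulrA -(uabsM uC).
  rewrite ler_pM2r ?exprn_gt0 //; case: i gi => [|i] gi.
    by rewrite c0E (uabsN uC).
  rewrite cE addrC (uabs_addl uC) (uabsN uC) //.
  rewrite -(ltr_pM2r (exprn_gt0 i.+1 t0)); apply: le_lt_trans (tle i) _.
  by rewrite (uabsM uC) -mulrA -gi ltr_pM2r.
have exi : exists i, (i < size P)%N && (gaussnorm P t == abs P`_i * t ^+ i).
  by have [i iP gi] := gaussnorm_attained P0 t0; exists i; rewrite iP gi eqxx.
have bnd i : (i < size P)%N && (gaussnorm P t == abs P`_i * t ^+ i) -> (i <= size P)%N.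
  by case/andP => /ltnW.
case: (ex_maxnP exi bnd) => i /andP[iP /eqP gi] imax.
apply: le_trans (gaussnorm_ge _ i.+1 t0').
have ti : abs P`_i * t ^+ i.+1 = t * gaussnorm P t by rewrite gi exprS mulrCA.
rewrite cE (uabs_addl uC) ?ti // (uabsN uC) -(ltr_pM2r (exprn_gt0 i.+1 t0)) ti.
rewrite (uabsM uC) -mulrA.
have [iS|Si] := ltnP i.+1 (size P); last first.
  by rewrite nth_default // abs0 mul0r mulr0 mulr_gt0.
have lt1 : abs P`_i.+1 * t ^+ i.+1 < gaussnorm P t.
  rewrite lt_neqAle gaussnorm_ge // andbT; apply/eqP => h.
  by have := imax i.+1; rewrite iS h eqxx ltnn => /(_ isT).
apply: (@le_lt_trans _ _ (t * (abs P`_i.+1 * t ^+ i.+1))); last by rewrite ltr_pM2l.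
by rewrite ler_wpM2r ?mulr_ge0 ?abs_ge0 ?exprn_ge0.
Qed.

(** The formula shows the norm as a piecewise monomial function of t, whose exponent changes only at
    the norms of the roots. *)
Lemma gaussnorm_factor (P : {poly K}) : exists s : seq K,
  [/\ P = lead_coef P *: \prod_(c <- s) ('X - c%:P) &
      forall t, 0 < t -> gaussnorm P t = abs (lead_coef P) * \prod_(c <- s) Num.max (abs c) t].
Proof.
have [s sE] := closed_factor (@Cp_closed p R K) P; exists s; split=> // t t0.
rewrite {1}sE gaussnormZ ?(ltW t0) //; congr (_ * _).
elim: (s) => [|c s' IH]; first by rewrite !big_nil -polyC1 gaussnormC ?(ltW t0) // (uabs1 uC).
by rewrite !big_cons gaussnorm_XsubC // IH.
Qed.

Lemma factor_root P (s : seq K) x : P = lead_coef P *: \prod_(c <- s) ('X - c%:P) ->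
  x \in s -> root P x.
Proof.
move=> -> xs; rewrite rootE hornerZ mulf_eq0; apply/orP; right.
by rewrite -/(root _ _) root_prod_XsubC.
Qed.

(** Without roots in |z| < r each factor max(|c|, r) is |c|, and the norm would equal the absolute
    value of the constant coefficient. *)
Lemma exists_root_ball P r : 0 < r -> abs P`_0 < gaussnorm P r ->
  exists2 z, root P z & abs z < r.
Proof.
move=> r0; have [s [sE gE]] := gaussnorm_factor P.
move=> h; apply: contrapT => H; move: h; apply/negP; rewrite -leNgt gE //.
rewrite -horner_coef0 {2}sE hornerZ (uabsM uC) ler_wpM2l ?abs_ge0 //.
rewrite horner_prod (uabs_prod uC) big_seq [leRHS]big_seq.
apply: ler_prod => c cs; rewrite le_max (ltW r0) orbT /=.
rewrite hornerXsubC sub0r (uabsN uC) ge_max lexx leNgt.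
by apply/negP => cr; apply: H; exists c => //; apply: factor_root sE cs.
Qed.

(* Around the radius of a sphere without roots the norm is a monomial t ^+ m;
   comparing with the two coefficients gives m <= i and j <= m. *)
Lemma exists_root_sphere P t i j : 0 < t -> P != 0 -> (i < j)%N ->
  gaussnorm P t = abs P`_i * t ^+ i -> gaussnorm P t = abs P`_j * t ^+ j ->
  exists2 z, root P z & abs z = t.
Proof.
move=> t0 P0 ij gi gj; have [s [sE gE]] := gaussnorm_factor P.
apply: contrapT => H.
have neq c : c \in s -> abs c != t.
  by move=> cs; apply/eqP => ct; apply: H; exists c => //; apply: factor_root sE cs.
have [e [e0 et] [m eE]] : exists2 e, 0 < e /\ e < t & exists m, forall u, t - e < u -> u < t + e ->
    gaussnorm P u = gaussnorm P t * (u / t) ^+ m.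
  suff [e [e0 et] [m eE]] : exists2 e, 0 < e /\ e < t & exists m, forall u, t - e < u -> u < t + e ->
    \prod_(c <- s) Num.max (abs c) u = \prod_(c <- s) Num.max (abs c) t * (u / t) ^+ m.
    exists e => //; exists m => u h1 h2.
    have u0 : 0 < u by apply: lt_trans h1; rewrite subr_gt0.
    by rewrite (gE _ u0) (gE _ t0) (eE u h1 h2) mulrA.
  (* The exponent m counts the roots with |c| < t, and e is kept at most the distance from t to each
     |c|. *)
  elim: (s) neq => [|c s' IH] neq.
    exists (t / 2); first by split; lra.
    by exists 0%N => u _ _; rewrite !big_nil expr0 mulr1.
  have [|e [e0 et] [m eE]] := IH.
    by move=> d ds; apply: neq; rewrite inE ds orbT.
  have : abs c != t by apply: neq; rewrite mem_head.
  rewrite neq_lt => /orP[ct|tc].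
    exists (Num.min e (t - abs c)).
      by rewrite lt_min gt_min et e0 subr_gt0 ct.
    exists m.+1 => u h1 h2.
    have [a1 a2] : u < t + e /\ t - e < u.
      move: h1 h2; rewrite -ltrBlDl lt_min => h1 /andP[h2 h3]; split; first by rewrite -ltrBlDl.
      by move: h1; rewrite ltrBlDr -ltrBlDl lt_min => /andP[+ _]; rewrite ltrBlDl -ltrBlDr.
    have cu : abs c < u.
      move: h1; rewrite ltrBlDr -ltrBlDl lt_min => /andP[_]; lra.
    rewrite !big_cons eE // max_r ?(ltW cu) // max_r ?(ltW ct) // exprS.
    by field; rewrite gt_eqF.
  exists (Num.min e (abs c - t)).
    by rewrite lt_min gt_min et e0 subr_gt0 tc.
  exists m => u h1 h2.
  have [a1 a2] : u < t + e /\ t - e < u.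
    move: h1 h2; rewrite -ltrBlDl lt_min => h1 /andP[h2 h3]; split; first by rewrite -ltrBlDl.
    by move: h1; rewrite ltrBlDr -ltrBlDl lt_min => /andP[+ _]; rewrite ltrBlDl -ltrBlDr.
  have uc : u < abs c.
    move: h2; rewrite -ltrBlDl lt_min => /andP[_]; lra.
  by rewrite !big_cons eE // max_l ?(ltW uc) // max_l ?(ltW tc) // mulrA.
have gP := gaussnorm_gt0 P0 t0.
have cmp u l : t - e < u -> u < t + e -> gaussnorm P t = abs P`_l * t ^+ l ->
   (u / t) ^+ l <= (u / t) ^+ m.
  move=> h1 h2 gl; rewrite -(ler_pM2l gP) -eE // gl -mulrA -exprMn.
  rewrite mulrCA divff ?gt_eqF // mulr1; apply: gaussnorm_ge.
  by apply: ltW; apply: lt_trans h1; rewrite subr_gt0.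
have mi : (m <= i)%N.
  rewrite -(@ler_iXn2l _ ((t - e / 2) / t)).
  - by apply: cmp gi; lra.
  - by rewrite divr_gt0 //; lra.
  - by rewrite ltr_pdivrMr //; lra.
have jm : (j <= m)%N.
  rewrite -(@ler_eXn2l _ ((t + e / 2) / t)).
  - by apply: cmp gj; lra.
  - by rewrite ltr_pdivlMr //; lra.
by move: (leq_trans jm mi); rewrite leqNgt ij.
Qed.

(** When a single term dominates, |P| is constant and nonzero on the sphere |z| = t. *)
Definition dominates P j t := forall l, l != j -> abs P`_l * t ^+ l < abs P`_j * t ^+ j.

Lemma dominates_gaussnorm P j t : 0 <= t -> dominates P j t -> gaussnorm P t = abs P`_j * t ^+ j.
Proof.
move=> t0 dom; apply/eqP; rewrite eq_le gaussnorm_ge // andbT.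
apply: gaussnorm_le => [|i]; first by rewrite mulr_ge0 ?abs_ge0 ?exprn_ge0.
by have [->//|/dom/ltW] := eqVneq i j.
Qed.

Lemma dominates_gt0 P j t : 0 <= t -> dominates P j t -> 0 < abs P`_j * t ^+ j.
Proof.
move=> t0 dom; apply: le_lt_trans (dom j.+1 _); last by rewrite gtn_eqF.
by rewrite mulr_ge0 ?abs_ge0 ?exprn_ge0.
Qed.

Lemma dominates_horner P j z : dominates P j (abs z) -> abs P.[z] = abs P`_j * abs z ^+ j.
Proof.
move=> dom; have jP : (j < size P)%N.
  rewrite ltnNge; apply/negP => h; have := dominates_gt0 (abs_ge0 _) dom.
  by rewrite nth_default // abs0 mul0r ltxx.
rewrite horner_coef (bigD1 (Ordinal jP)) //= (uabs_addl uC) (uabsM uC) (uabsX uC) //.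
apply: (uabs_sum_lt uC) => [|i ij]; first exact: dominates_gt0 (abs_ge0 _) dom.
by rewrite (uabsM uC) (uabsX uC); apply: dom.
Qed.

(** Only the finitely many indices below [size P] are compared, so one e serves for all of them. *)
Lemma strict_near P j r : exists2 e, 0 < e & forall t, r - e < t -> t < r + e ->
  forall i, abs P`_i * r ^+ i < abs P`_j * r ^+ j -> (i < size P)%N ->
            abs P`_i * t ^+ i < abs P`_j * t ^+ j.
Proof.
have: \forall t \near r, forall i : 'I_(size P), abs P`_i * r ^+ i < abs P`_j * r ^+ j ->
   abs P`_i * t ^+ i < abs P`_j * t ^+ j.
  suff H (i : 'I_(size P)) : \forall t \near r,
      abs P`_i * r ^+ i < abs P`_j * r ^+ j -> abs P`_i * t ^+ i < abs P`_j * t ^+ j.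
    exact: filter_forall H.
  have [h|h] := ltP (abs P`_i * r ^+ i) (abs P`_j * r ^+ j); last first.
    by near=> t.
  have : (abs P`_j * t ^+ j - abs P`_i * t ^+ i) @[t --> r] -->
      abs P`_j * r ^+ j - abs P`_i * r ^+ i.
    by apply: cvgB; (apply: cvgM; [exact: cvg_cst|exact: realfun.exprn_continuous]).
  move=> /cvgr_gt/(_ 0); rewrite subr_gt0 => /(_ h); apply: filterS => t.
  by rewrite subr_gt0.
case/nbhs_ballP => e /= e0 h; exists e => // t h1 h2 i hi iP.
by apply: (h t _ (Ordinal iP)) => //; rewrite /ball /= ltr_norml; apply/andP; split; lra.
Unshelve. all: by end_near. Qed.

(** j is the smallest index attaining the norm at r. Lower indices are strictly smaller at r, hence
    near r; higher ones are at most equal at r and decrease faster when t goes down. *)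
Lemma dominates_left P r : P != 0 -> 0 < r -> exists j, [/\ P`_j != 0,
  gaussnorm P r = abs P`_j * r ^+ j &
  exists2 e, 0 <= e < r & forall t, e < t -> t < r -> dominates P j t].
Proof.
move=> P0 r0; have r0' := ltW r0; have gP := gaussnorm_gt0 P0 r0.
have exi : exists i, gaussnorm P r == abs P`_i * r ^+ i.
  by have [i _ gi] := gaussnorm_attained P0 r0; exists i; rewrite gi.
case: (ex_minnP exi) => j /eqP gj jmin.
have j0 : P`_j != 0 by apply/eqP => h; move: gP; rewrite gj h abs0 mul0r ltxx.
exists j; split=> //.
have [e e0 near] := strict_near P j r.
exists (Num.max 0 (r - e)); first by rewrite le_max lexx /= gt_max r0 /=; lra.
move=> t; rewrite gt_max => /andP[t0 et] tr l lj.
have jt : 0 < abs P`_j * t ^+ j by rewrite mulr_gt0 ?exprn_gt0 // (uabs_gt0 uC).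
have [lP|Pl] := ltnP l (size P); last by rewrite nth_default // abs0 mul0r.
have [l_lt|l_ge] := ltnP l j.
  apply: near => //; first by lra.
  rewrite -gj lt_neqAle gaussnorm_ge // andbT eq_sym.
  by apply: contraTN l_lt => /jmin; rewrite -leqNgt.
have {l_ge lj}jl : (j < l)%N by rewrite ltn_neqAle eq_sym lj.
have trn (n : nat) : t ^+ n = r ^+ n * (t / r) ^+ n.
  by rewrite -exprMn mulrC divfK ?gt_eqF.
apply: (@le_lt_trans _ _ (abs P`_j * r ^+ j * (t / r) ^+ l)).
  rewrite trn mulrA ler_wpM2r ?exprn_ge0 ?divr_ge0 ?(ltW t0) //.
  by rewrite -gj gaussnorm_ge.
rewrite [ltRHS](_ : _ = abs P`_j * r ^+ j * (t / r) ^+ j); last by rewrite trn mulrA.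
rewrite ltr_pM2l ?mulr_gt0 ?exprn_gt0 ?(uabs_gt0 uC) //.
by rewrite ltr_iXn2l ?divr_gt0 // ltr_pdivrMr // mul1r.
Qed.

(** Here j is the largest index attaining the norm at r, as higher powers grow faster when t goes
    up. *)
Lemma dominates_right P r : P != 0 -> 0 < r -> exists j, [/\ P`_j != 0,
  gaussnorm P r = abs P`_j * r ^+ j &
  exists2 e, r < e & forall t, r < t -> t < e -> dominates P j t].
Proof.
move=> P0 r0; have r0' := ltW r0; have gP := gaussnorm_gt0 P0 r0.
have exi : exists i, gaussnorm P r == abs P`_i * r ^+ i.
  by have [i _ gi] := gaussnorm_attained P0 r0; exists i; rewrite gi.
have bnd i : gaussnorm P r == abs P`_i * r ^+ i -> (i <= size P)%N.
  move=> /eqP h; rewrite leqNgt; apply/negP => /ltnW Pi; move: gP.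
  by rewrite h nth_default // abs0 mul0r ltxx.
case: (ex_maxnP exi bnd) => j /eqP gj jmax.
have j0 : P`_j != 0 by apply/eqP => h; move: gP; rewrite gj h abs0 mul0r ltxx.
exists j; split=> //.
have [e e0 near] := strict_near P j r.
exists (r + e); first by lra.
move=> t rt et l lj; have t0 : 0 < t by lra.
have jt : 0 < abs P`_j * t ^+ j by rewrite mulr_gt0 ?exprn_gt0 // (uabs_gt0 uC).
have [lP|Pl] := ltnP l (size P); last by rewrite nth_default // abs0 mul0r.
have [l_gt|l_le] := ltnP j l.
  apply: near => //; first by lra.
  rewrite -gj lt_neqAle gaussnorm_ge // andbT eq_sym.
  by apply: contraTN l_gt => /jmax; rewrite -leqNgt.
have {l_le lj}jl : (l < j)%N by rewrite ltn_neqAle lj.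
have trn (n : nat) : t ^+ n = r ^+ n * (t / r) ^+ n.
  by rewrite -exprMn mulrC divfK ?gt_eqF.
apply: (@le_lt_trans _ _ (abs P`_j * r ^+ j * (t / r) ^+ l)).
  rewrite trn mulrA ler_wpM2r ?exprn_ge0 ?divr_ge0 ?(ltW t0) //.
  by rewrite -gj gaussnorm_ge.
rewrite [ltRHS](_ : _ = abs P`_j * r ^+ j * (t / r) ^+ j); last by rewrite trn mulrA.
rewrite ltr_pM2l ?mulr_gt0 ?exprn_gt0 ?(uabs_gt0 uC) //.
by rewrite ltr_eXn2l // ltr_pdivlMr // mul1r.
Qed.

Lemma dominates_small P : P`_0 != 0 -> exists2 e, 0 < e & forall t, 0 < t -> t < e -> dominates P 0 t.
Proof.
move=> P0; have [e e0 near] := strict_near P 0 0; exists e => // t t0 te [|l] // _.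
have [lP|Pl] := ltnP l.+1 (size P); last first.
  by rewrite nth_default // abs0 mul0r expr0 mulr1 (uabs_gt0 uC).
by apply: near => //; [lra|lra|rewrite expr0n mulr0 expr0 mulr1 (uabs_gt0 uC)].
Qed.

Lemma dominates_large P : P != 0 -> exists2 e, 0 < e & forall t, e < t -> dominates P (size P).-1 t.
Proof.
move=> P0; pose n := (size P).-1; have nP : P`_n != 0 by rewrite -lead_coefE lead_coef_eq0.
have an := uabs_gt0 uC nP.
have sP : size P = n.+1 by rewrite /n prednK // lt0n size_poly_eq0.
exists (\big[Num.max/1]_(i < n) (abs P`_i / abs P`_n)).
  by apply: lt_le_trans (bigmax_ge_id _ _ _ _).
move=> t Tt l ln; have t1 : 1 < t by apply: le_lt_trans Tt; exact: bigmax_ge_id.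
have t0 : 0 < t by lra.
move: ln; rewrite neq_lt ltEnat => /orP[/= ln|/= nl]; last first.
  by rewrite nth_default ?sP // abs0 mul0r mulr_gt0 ?exprn_gt0.
apply: (@lt_le_trans _ _ (abs P`_n * t * t ^+ l)).
  rewrite ltr_pM2r ?exprn_gt0 // -ltr_pdivrMl // mulrC.
  apply: le_lt_trans Tt.
  exact: (le_bigmax _ (fun i : 'I_n => abs P`_i / abs P`_n) (Ordinal ln)).
by rewrite -mulrA -exprS ler_pM2l // ler_eXn2l.
Qed.

End GaussNorm.

(** * Images of annuli under a rational function *)

(** The quotient construction of [{fraction D}] is opened here only; what follows uses the resulting
    identity. *)
Lemma frac_repr (D : idomainType) (f : {fraction D}) :
  f * tofrac \d_(repr f) = tofrac \n_(repr f).
Proof.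
rewrite -{1}[f]generic_quotient.reprK; unlock tofrac.
rewrite -[LHS]FracField.pi_mul; apply/generic_quotient.eqmodP => /=.
rewrite /FracField.equivf /FracField.mulf /= !numden_Ratio ?oner_neq0 ?mulf_neq0 //.
  by rewrite !mulr1 mulrC.
all: by rewrite ?oner_neq0 ?denom_ratioP.
Qed.

Lemma real_nth_root (R : realType) (x : R) n : 0 < x -> (0 < n)%N -> exists2 y, 0 < y & y ^+ n = x.
Proof.
move=> x0 n0; exists (x `^ n%:R^-1); first exact: powR_gt0.
rewrite -powR_mulrn ?powR_ge0 // -powRrM mulVf ?powRr1 ?(ltW x0) //.
by rewrite pnatr_eq0 -lt0n.
Qed.

Section RationalMap.
Context {p : nat} {R : realType} {K : padicComplexType p R}.
Local Notation abs := (@Cp_abs p R K).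
Local Notation uC := (@Cp_ultra p R K).
Local Notation value_group := (value_group K).
Implicit Types (P Q : {poly K}) (r s t e : R) (i j k l n : nat) (a b c w z : K)
  (f : {fraction {poly K}}).

Lemma gcd_numden_neq0 f : gcdp \n_(repr f) \d_(repr f) != 0.
Proof. by rewrite gcdp_eq0 negb_and denom_ratioP orbT. Qed.

Lemma num_gcd f : num f * gcdp \n_(repr f) \d_(repr f) = \n_(repr f).
Proof. by rewrite /num divpK // dvdp_gcdl. Qed.

Lemma den_gcd f : den f * gcdp \n_(repr f) \d_(repr f) = \d_(repr f).
Proof. by rewrite /den divpK // dvdp_gcdr. Qed.

Lemma den_neq0 f : den f != 0.
Proof.
by apply/eqP => h; have := den_gcd f; rewrite h mul0r => /esym/eqP; rewrite (negPf (denom_ratioP _)).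
Qed.

Lemma numden_coprime f : coprimep (num f) (den f).
Proof. by apply: coprimep_div_gcd; rewrite denom_ratioP orbT. Qed.

Lemma numden_nroot f z : root (num f) z -> root (den f) z -> False.
Proof. by move=> rn rd; have := coprimep_root (numden_coprime f) rn; rewrite -rootE rd. Qed.

Lemma frac_numden f : f * tofrac (den f) = tofrac (num f).
Proof.
have g0 := gcd_numden_neq0 f; have := frac_repr f.
rewrite -[X in _ = tofrac X]num_gcd -[X in _ * tofrac X = _]den_gcd !tofracM mulrA.
by apply: mulIf; rewrite tofrac_eq0.
Qed.

(** This gives access to the reduced pair of a function presented as some quotient, such as
    [inv_conj f]. *)
Lemma numden_cross f P Q : Q != 0 -> f = tofrac P / tofrac Q -> num f * Q = P * den f.
Proof.
move=> Q0 fE; apply/eqP; rewrite -tofrac_eq !tofracM -frac_numden fE.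
by rewrite mulrAC divfK ?tofrac_eq0.
Qed.

Lemma nonconstant_sub f c : nonconstant f -> num f - c *: den f != 0.
Proof.
move=> nc; apply/eqP => /eqP; rewrite subr_eq0 => /eqP h; apply: nc; exists c.
apply: (@mulIf _ (tofrac (den f))); first by rewrite tofrac_eq0 den_neq0.
by rewrite frac_numden h -mul_polyC tofracM.
Qed.

Definition shift a P : {poly K} := P \Po ('X + a%:P).

Lemma shiftD a P Q : shift a (P + Q) = shift a P + shift a Q.
Proof. exact: rmorphD. Qed.

Lemma shiftB a P Q : shift a (P - Q) = shift a P - shift a Q.
Proof. exact: rmorphB. Qed.

Lemma shiftZ a c P : shift a (c *: P) = c *: shift a P.
Proof. exact: linearZ. Qed.

Lemma shiftM a P Q : shift a (P * Q) = shift a P * shift a Q.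
Proof. exact: rmorphM. Qed.

Lemma shift_horner a P z : (shift a P).[z] = P.[z + a].
Proof. by rewrite /shift horner_comp !hornerE. Qed.

Lemma shift_root a P z : root (shift a P) z = root P (z + a).
Proof. by rewrite !rootE shift_horner. Qed.

Lemma shift0 a P : (shift a P)`_0 = P.[a].
Proof. by rewrite -horner_coef0 shift_horner add0r. Qed.

Lemma size_shift a P : size (shift a P) = size P.
Proof. by rewrite /shift size_comp_poly2 // size_XaddC. Qed.

Lemma shift_eq0 a P : (shift a P == 0) = (P == 0).
Proof. by rewrite -!size_poly_eq0 size_shift. Qed.

Lemma shift_XsubC a c : shift a ('X - c%:P) = 'X - (c - a)%:P.
Proof. by rewrite /shift comp_polyB comp_polyX comp_polyC polyCB; ring. Qed.

Lemma lead_coef_shift a P : lead_coef (shift a P) = lead_coef P.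
Proof. by rewrite /shift lead_coef_comp ?size_XaddC // lead_coefXaddC expr1n mulr1. Qed.

Definition gn P a t := gaussnorm (shift a P) t.

Lemma gn_gt0 P a t : P != 0 -> 0 < t -> 0 < gn P a t.
Proof. by move=> P0 t0; rewrite gaussnorm_gt0 // shift_eq0. Qed.

(** By factorisation it is enough to treat X - c, where max(|c - a|, t) depends only on the closed
    disc of radius t around a. *)
Lemma gn_center P a b t : 0 < t -> abs (a - b) <= t -> gn P a t = gn P b t.
Proof.
move=> t0 ab; rewrite /gn.
have [s sE] := closed_factor (@Cp_closed p R K) P; rewrite sE !shiftZ.
rewrite !gaussnormZ ?(ltW t0) //; congr (_ * _).
elim: (s) => [|c s' IH].
  by rewrite !big_nil /shift -polyC1 !comp_polyC.
rewrite !big_cons !shiftM !shift_XsubC !gaussnorm_XsubC // IH; congr (_ * _).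
have [h|h] := leP (abs (c - a)) t.
  by rewrite max_r //; exact: abs_trans h ab.
by rewrite (abs_dom (y := a)) ?max_l ?(ltW h) // (le_lt_trans ab).
Qed.

Lemma gn_value_group P a t : P != 0 -> value_group t -> value_group (gn P a t).
Proof.
move=> P0 vt; have t0 := value_group_gt0 vt.
have sP0 : shift a P != 0 by rewrite shift_eq0.
have [i _ gi] := gaussnorm_attained sP0 t0; have := gaussnorm_gt0 sP0 t0.
rewrite /gn gi pmulr_lgt0 ?exprn_gt0 // => Pi.
apply: value_groupM; last exact: value_groupX.
by apply: value_group_abs; rewrite -abs_eq0 gt_eqF.
Qed.

Definition annulus a r s : set (P1 K) := Some @` [set z | r < abs (z - a) /\ abs (z - a) < s].

Lemma annulusP a r s z : annulus a r s (Some z) <-> (r < abs (z - a) /\ abs (z - a) < s).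
Proof. by split=> [[y ? [<-]] //|h]; exists z. Qed.

Lemma rat_eval_fin f z : (den f).[z] != 0 -> rat_eval f (Some z) = Some ((num f).[z] / (den f).[z]).
Proof. by move=> /negPf h; rewrite /= h. Qed.

Lemma rat_eval_root f z w : root (num f - w *: den f) z -> rat_eval f (Some z) = Some w.
Proof.
rewrite rootE hornerD hornerN hornerZ subr_eq0 => /eqP h.
have d0 : (den f).[z] != 0.
  by apply/eqP => d0; apply: (@numden_nroot f z); rewrite rootE ?h d0 ?mulr0.
by rewrite rat_eval_fin // h mulfK.
Qed.

(** For surjectivity, the condition on w says that the dominant terms of P and of (w - b) Q have the
    same size at radius t. As i differs from j, P - (w - b) Q attains its norm at two indices, and
    [exists_root_sphere] gives a root of modulus t, which f sends to w. *)
Lemma image_annulus_raw f a b x y i j : 0 <= x -> i != j ->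
  (forall t, x < t -> t < y -> dominates (shift a (num f - b *: den f)) i t /\
                            dominates (shift a (den f)) j t) ->
  rat_eval f @` annulus a x y = Some @` [set w | exists t, [/\ x < t, t < y &
    abs (w - b) * (abs (shift a (den f))`_j * t ^+ j) =
    abs (shift a (num f - b *: den f))`_i * t ^+ i]].
Proof.
move=> x0 ij dom; set P := shift a (num f - b *: den f) in dom *.
set Q := shift a (den f) in dom *.
apply/seteqP; split=> [_ [_ [z [xz zy] <-] <-]|_ [w [t [xt ty wE] <-]]].
  have [dP dQ] := dom _ xz zy.
  have QE := dominates_horner dQ; have PE := dominates_horner dP.
  move: QE PE; rewrite /Q /P !shift_horner subrK hornerD hornerN hornerZ => QE PE.
  have dz : (den f).[z] != 0.
    by rewrite -abs_eq0 QE gt_eqF // dominates_gt0 ?abs_ge0.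
  rewrite rat_eval_fin //; exists ((num f).[z] / (den f).[z]) => //.
  exists (abs (z - a)); split=> //.
  by rewrite -/Q -/P -QE -PE -(uabsM uC) mulrBl divfK.
have t0 : 0 < t by exact: le_lt_trans xt.
have [dP dQ] := dom _ xt ty.
have SE : shift a (num f - w *: den f) = P - (w - b) *: Q.
  by rewrite /P /Q !shiftB !shiftZ scalerBl opprB addrA subrK.
set S := shift a (num f - w *: den f) in SE.
have cS l : S`_l = P`_l - (w - b) * Q`_l by rewrite SE coefB coefZ.
have Pi0 := dominates_gt0 (ltW t0) dP.
have Qj0 := dominates_gt0 (ltW t0) dQ.
have wb : 0 < abs (w - b) by rewrite -(pmulr_lgt0 _ Qj0) wE.
have wQ l : abs ((w - b) * Q`_l) * t ^+ l = abs (w - b) * (abs Q`_l * t ^+ l).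
  by rewrite (uabsM uC) mulrA.
have Si : abs S`_i * t ^+ i = abs P`_i * t ^+ i.
  congr (_ * _); rewrite cS (uabs_addl uC) // (uabsN uC).
  rewrite -(ltr_pM2r (exprn_gt0 i t0)) wQ -wE ltr_pM2l //; exact: dQ.
have Sj : abs S`_j * t ^+ j = abs P`_i * t ^+ i.
  rewrite cS addrC (uabs_addl uC) ?(uabsN uC) ?wQ //.
  rewrite -(ltr_pM2r (exprn_gt0 j t0)) wQ wE; apply: dP; by rewrite eq_sym.
have gS : gaussnorm S t = abs P`_i * t ^+ i.
  apply/eqP; rewrite eq_le -{2}Si gaussnorm_ge ?(ltW t0) // andbT.
  apply: gaussnorm_le => [|l]; first exact: ltW.
  rewrite cS; have [h|h] := leP (abs P`_l) (abs ((w - b) * Q`_l)).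
    apply: (@le_trans _ _ (abs ((w - b) * Q`_l) * t ^+ l)).
      by rewrite ler_wpM2r ?exprn_ge0 ?(ltW t0) // (uabsB_le uC).
    rewrite wQ -wE ler_pM2l //; have [->//|/dQ/ltW//] := eqVneq l j.
  apply: (@le_trans _ _ (abs P`_l * t ^+ l)).
    by rewrite ler_wpM2r ?exprn_ge0 ?(ltW t0) // (uabsB_le uC) // ltW.
  by have [->//|/dP/ltW//] := eqVneq l i.
have S0 : S != 0 by apply/eqP => h; move: gS; rewrite h gaussnorm0 => /eqP; rewrite lt_eqF.
have [z rz zt] : exists2 z, root S z & abs z = t.
  move: ij; rewrite neq_lt ltEnat /= => /orP[ij|ij].
    by apply: (@exists_root_sphere _ _ _ S t i j) => //; rewrite gS.
  by apply: (@exists_root_sphere _ _ _ S t j i) => //; rewrite gS.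
exists (Some (z + a)); first by apply/annulusP; rewrite addrK zt.
by apply: rat_eval_root; rewrite -shift_root.
Qed.

Lemma monomial_annulus_incr b C x y k : (0 < k)%N -> 0 < C -> 0 < x -> 0 < y ->
  [set w | exists t, [/\ x < t, t < y & abs (w - b) = C * t ^+ k]] =
  [set w | C * x ^+ k < abs (w - b) /\ abs (w - b) < C * y ^+ k].
Proof.
move=> k0 C0 x0 y0; have cmp (u v : R) : 0 < u -> 0 < v -> (C * u ^+ k < C * v ^+ k) = (u < v).
  by move=> u0 v0; rewrite ltr_pM2l // ltr_pXn2r // nnegrE ltW.
apply/seteqP; split=> w /= [].
  by move=> t [xt ty ->]; have t0 := lt_trans x0 xt; rewrite !cmp.
move=> h1 h2; have w0 : 0 < abs (w - b) by apply: lt_trans h1; rewrite mulr_gt0 ?exprn_gt0.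
have [t t0 tE] := real_nth_root (divr_gt0 w0 C0) k0.
have wE : abs (w - b) = C * t ^+ k by rewrite tE mulrCA divff ?gt_eqF // mulr1.
by exists t; split; rewrite // -?(cmp _ _ x0 t0) -?(cmp _ _ t0 y0) -wE.
Qed.

(** Substituting 1 / t for t reduces this to the increasing case. *)
Lemma monomial_annulus_decr b C x y k : (0 < k)%N -> 0 < C -> 0 < x -> 0 < y ->
  [set w | exists t, [/\ x < t, t < y & abs (w - b) * t ^+ k = C]] =
  [set w | C / y ^+ k < abs (w - b) /\ abs (w - b) < C / x ^+ k].
Proof.
move=> k0 C0 x0 y0.
have -> : [set w | exists t, [/\ x < t, t < y & abs (w - b) * t ^+ k = C]] =
  [set w | exists t, [/\ y^-1 < t, t < x^-1 & abs (w - b) = C * t ^+ k]].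
  apply/seteqP; split=> w /= [t [h1 h2 h3]].
    have t0 := lt_trans x0 h1.
    exists t^-1; rewrite !ltf_pV2 ?posrE //; split=> //.
    by rewrite -h3 -mulrA -exprMn divff ?gt_eqF // expr1n mulr1.
  have t0 : 0 < t by apply: lt_trans h1; rewrite invr_gt0.
  exists t^-1; rewrite -[x]invrK -[y]invrK !ltf_pV2 ?posrE ?invr_gt0 //; split=> //.
  by rewrite h3 -mulrA -exprMn divff ?gt_eqF // expr1n mulr1.
by rewrite monomial_annulus_incr ?invr_gt0 // !exprVn.
Qed.

Lemma image_annulus f a b x y i j : 0 < x -> x < y -> i != j ->
  (forall t, x < t -> t < y -> dominates (shift a (num f - b *: den f)) i t /\
                            dominates (shift a (den f)) j t) ->
  let C := abs (shift a (num f - b *: den f))`_i / abs (shift a (den f))`_j in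
  if (j < i)%N then
    rat_eval f @` annulus a x y = annulus b (C * x ^+ (i - j)) (C * y ^+ (i - j))
  else
    rat_eval f @` annulus a x y = annulus b (C / y ^+ (j - i)) (C / x ^+ (j - i)).
Proof.
move=> x0 xy ij dom; have y0 := lt_trans x0 xy.
have [t [xt ty]] : exists t, x < t /\ t < y by exists ((x + y) / 2); lra.
have [dP dQ] := dom _ xt ty; have t0 := lt_trans x0 xt.
have := dominates_gt0 (ltW t0) dP; have := dominates_gt0 (ltW t0) dQ.
rewrite !pmulr_lgt0 ?exprn_gt0 // => Q0 P0 C.
have C0 : 0 < C by exact: divr_gt0.
rewrite (image_annulus_raw (ltW x0) ij dom).
set A := abs _`_i in P0 C C0 *; set B := abs _`_j in Q0 C C0 *.
have AE : A = C * B by rewrite divfK ?gt_eqF.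
case: ltnP => ji.
  rewrite /annulus -monomial_annulus_incr ?subn_gt0 //; congr (_ @` _).
  apply/seteqP; split=> w /= [u [h1 h2 h3]]; exists u; split=> //.
    have u0 := lt_trans x0 h1; have D0 : 0 < B * u ^+ j by rewrite mulr_gt0 ?exprn_gt0.
    apply: (mulIf (lt0r_neq0 D0)); rewrite h3 -{1}(subnK (ltnW ji)) exprD AE; ring.
  rewrite h3 -{2}(subnK (ltnW ji)) exprD AE; ring.
have {}ij : (i < j)%N by rewrite ltn_neqAle ij.
rewrite /annulus -monomial_annulus_decr ?subn_gt0 //; congr (_ @` _).
apply/seteqP; split=> w /= [u [h1 h2 h3]]; exists u; split=> //.
  have u0 := lt_trans x0 h1; have D0 : 0 < B * u ^+ i by rewrite mulr_gt0 ?exprn_gt0.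
  apply: (mulIf (lt0r_neq0 D0)); rewrite -mulrA.
  have -> : u ^+ (j - i) * (B * u ^+ i) = B * u ^+ j.
    by rewrite mulrCA -exprD subnK.
  by rewrite h3 AE mulrA.
have -> : u ^+ j = u ^+ (j - i) * u ^+ i by rewrite -exprD subnK.
by rewrite AE -h3; ring.
Qed.

(* Subtracting b kills the coefficient of index j, so |f - b| is minimal at
   zeta_(a, r), and num f - b *: den f and den f never share the dominant index
   j: this makes the exponents in image_annulus nonzero. *)
Lemma gn_best f a r j : 0 < r -> (shift a (den f))`_j != 0 ->
  gn (den f) a r = abs (shift a (den f))`_j * r ^+ j ->
  let b := (shift a (num f))`_j / (shift a (den f))`_j in
  (shift a (num f - b *: den f))`_j = 0 /\
  forall c, gn (num f - c *: den f) a r =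
    Num.max (abs (b - c) * gn (den f) a r) (gn (num f - b *: den f) a r).
Proof.
move=> r0 Qj gj b; set P := num f - b *: den f.
have Pj : (shift a P)`_j = 0 by rewrite /P shiftB shiftZ coefB coefZ divfK // subrr.
split=> // c.
have cE : num f - c *: den f = P + (b - c) *: den f.
  by rewrite /P scalerBl addrA subrK.
have sE : shift a (num f - c *: den f) = shift a P + (b - c) *: shift a (den f).
  by rewrite cE shiftD shiftZ.
have bn : gaussnorm ((b - c) *: shift a (den f)) r = abs (b - c) * gn (den f) a r.
  by rewrite gaussnormZ // ltW.
have ge1 : abs (b - c) * gn (den f) a r <= gn (num f - c *: den f) a r.
  rewrite {2}/gn; apply: le_trans (gaussnorm_ge _ j (ltW r0)).
  by rewrite sE coefD Pj add0r coefZ (uabsM uC) gj mulrA.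
apply/eqP; rewrite eq_le; apply/andP; split.
  by rewrite {1}/gn sE (le_trans (gaussnormD _ _ (ltW r0))) // bn maxC.
rewrite ge_max ge1 /= {1}/gn.
have -> : shift a P = shift a (num f - c *: den f) - (b - c) *: shift a (den f).
  by rewrite sE addrK.
apply: le_trans (gaussnormB _ _ (ltW r0)) _.
by rewrite ge_max lexx bn ge1.
Qed.

(* f maps zeta_(a, r) to zeta_(b, s), expressed by the values |f - c|. *)
Definition gauss_image f a r b s :=
  0 < s /\ forall c, gn (num f - c *: den f) a r = Num.max (abs (b - c)) s * gn (den f) a r.

Lemma gauss_image_best f a r j : nonconstant f -> 0 < r -> (shift a (den f))`_j != 0 ->
  gn (den f) a r = abs (shift a (den f))`_j * r ^+ j ->
  let b := (shift a (num f))`_j / (shift a (den f))`_j in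
  (shift a (num f - b *: den f))`_j = 0 /\
  gauss_image f a r b (gn (num f - b *: den f) a r / gn (den f) a r).
Proof.
move=> nc r0 Qj gj b; have [Pj bE] := gn_best r0 Qj gj.
have d0 : 0 < gn (den f) a r by rewrite gn_gt0 ?den_neq0.
split=> //; split; first by rewrite divr_gt0 // gn_gt0 // nonconstant_sub.
by move=> c; rewrite bE -/b maxr_pMl ?(ltW d0) // divfK ?gt_eqF.
Qed.

(** The annuli x < |z - a| < r represent the direction of a at zeta_(a, r), and k is the gap between
    the dominant indices of [num f - b *: den f] and [den f]. In the first alternative this
    direction goes to the ball |w - b| < s, in the second to the direction of infinity. *)
Lemma gauss_image_left f a r : nonconstant f -> 0 < r -> exists b s k e,
  [/\ gauss_image f a r b s, (0 < k)%N, 0 < e < r &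
   (forall x, e < x -> x < r -> rat_eval f @` annulus a x r = annulus b (s * (x / r) ^+ k) s) \/
   (forall x, e < x -> x < r -> rat_eval f @` annulus a x r = annulus b s (s * (r / x) ^+ k))].
Proof.
move=> nc r0; have Q0 : shift a (den f) != 0 by rewrite shift_eq0 den_neq0.
have [j [Qj gj [e1 /andP[e10 e1r] d1]]] := dominates_left Q0 r0.
have [Pj [s0 bE]] := gauss_image_best nc r0 Qj gj; set b := _ / _ in Pj s0 bE.
have P0 : shift a (num f - b *: den f) != 0 by rewrite shift_eq0 nonconstant_sub.
have [i [Pi gi [e2 /andP[e20 e2r] d2]]] := dominates_left P0 r0.
have ij : i != j by apply: contraNneq Pi => ->; rewrite Pj.
set s := _ / _ in s0 bE.
pose C := abs (shift a (num f - b *: den f))`_i / abs (shift a (den f))`_j.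
have aQ : 0 < abs (shift a (den f))`_j by exact: uabs_gt0 uC _ _.
have sE : s * r ^+ j = C * r ^+ i.
  rewrite /s /gn gi gj /C; field.
  by rewrite expf_neq0 ?gt_eqF.
(* The bound r / 2 keeps e positive, since [image_annulus] needs a positive inner radius. *)
pose e := Num.max (Num.max e1 e2) (r / 2).
have e0 : 0 < e < r.
  by rewrite lt_max !gt_max e1r e2r /=; apply/andP; split; [apply/orP; right|]; lra.
have ex x : e < x -> [/\ e1 < x, e2 < x & 0 < x].
  by rewrite !gt_max => /andP[/andP[-> ->]] h; split=> //; lra.
have dom x : e < x -> forall t, x < t -> t < r ->
  dominates (shift a (num f - b *: den f)) i t /\ dominates (shift a (den f)) j t.
  move=> /ex[h1 h2 _] t xt tr; split.
    by apply: d2 => //; exact: lt_trans xt.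
  by apply: d1 => //; exact: lt_trans xt.
have [ji|ij'] := ltnP j i.
  exists b, s, (i - j)%N, e; split; rewrite ?subn_gt0 //; left=> x ex' xr.
  have [_ _ x0] := ex _ ex'.
  have := image_annulus x0 xr ij (dom _ ex'); rewrite ji -/C => ->.
  have sE' : s = C * r ^+ (i - j).
    apply: (mulIf (expf_neq0 j (lt0r_neq0 r0))).
    by rewrite sE -[RHS]mulrA -exprD subnK // ltnW.
  have -> : s * (x / r) ^+ (i - j) = C * x ^+ (i - j).
    by rewrite sE' -[LHS]mulrA -exprMn mulrCA divff ?mulr1 // gt_eqF.
  by rewrite -sE'.
have {}ij' : (i < j)%N by rewrite ltn_neqAle ij.
exists b, s, (j - i)%N, e; split; rewrite ?subn_gt0 //; right=> x ex' xr.
have [_ _ x0] := ex _ ex'.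
have := image_annulus x0 xr ij (dom _ ex'); rewrite ltnNge (ltnW ij') /= -/C => ->.
have sE' : s * r ^+ (j - i) = C.
  apply: (mulIf (expf_neq0 i (lt0r_neq0 r0))).
  by rewrite -sE -[LHS]mulrA -exprD subnK // ltnW.
have <- : C / x ^+ (j - i) = s * (r / x) ^+ (j - i).
  by rewrite -sE' -[LHS]mulrA -expr_div_n.
by rewrite -sE' mulfK // expf_neq0 // gt_eqF.
Qed.

(** The same for the direction of infinity at zeta_(a, r): it is kept in the first alternative and
    sent to |w - b| < s in the second. *)
Lemma gauss_image_right f a r : nonconstant f -> 0 < r -> exists b s k e,
  [/\ gauss_image f a r b s, (0 < k)%N, r < e &
   (forall x, r < x -> x < e -> rat_eval f @` annulus a r x = annulus b s (s * (x / r) ^+ k)) \/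
   (forall x, r < x -> x < e -> rat_eval f @` annulus a r x = annulus b (s * (r / x) ^+ k) s)].
Proof.
move=> nc r0; have Q0 : shift a (den f) != 0 by rewrite shift_eq0 den_neq0.
have [j [Qj gj [e1 re1 d1]]] := dominates_right Q0 r0.
have [Pj [s0 bE]] := gauss_image_best nc r0 Qj gj; set b := _ / _ in Pj s0 bE.
have P0 : shift a (num f - b *: den f) != 0 by rewrite shift_eq0 nonconstant_sub.
have [i [Pi gi [e2 re2 d2]]] := dominates_right P0 r0.
have ij : i != j by apply: contraNneq Pi => ->; rewrite Pj.
set s := _ / _ in s0 bE.
pose C := abs (shift a (num f - b *: den f))`_i / abs (shift a (den f))`_j.
have aQ : 0 < abs (shift a (den f))`_j by exact: uabs_gt0 uC _ _.
have sE : s * r ^+ j = C * r ^+ i.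
  rewrite /s /gn gi gj /C; field.
  by rewrite expf_neq0 ?gt_eqF.
pose e := Num.min e1 e2.
have e0 : r < e by rewrite lt_min re1 re2.
have dom x : x < e -> forall t, r < t -> t < x ->
  dominates (shift a (num f - b *: den f)) i t /\ dominates (shift a (den f)) j t.
  rewrite lt_min => /andP[h1 h2] t rt tx; split.
    by apply: d2 => //; exact: lt_trans h2.
  by apply: d1 => //; exact: lt_trans h1.
have [ji|ij'] := ltnP j i.
  exists b, s, (i - j)%N, e; split; rewrite ?subn_gt0 //; left=> x rx xe.
  have := image_annulus r0 rx ij (dom _ xe); rewrite ji -/C => ->.
  have sE' : s = C * r ^+ (i - j).
    apply: (mulIf (expf_neq0 j (lt0r_neq0 r0))).
    by rewrite sE -[RHS]mulrA -exprD subnK // ltnW.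
  have -> : s * (x / r) ^+ (i - j) = C * x ^+ (i - j).
    by rewrite sE' -[LHS]mulrA -exprMn mulrCA divff ?mulr1 // gt_eqF.
  by rewrite -sE'.
have {}ij' : (i < j)%N by rewrite ltn_neqAle ij.
exists b, s, (j - i)%N, e; split; rewrite ?subn_gt0 //; right=> x rx xe.
have x0 := lt_trans r0 rx.
have := image_annulus r0 rx ij (dom _ xe); rewrite ltnNge (ltnW ij') /= -/C => ->.
have sE' : s * r ^+ (j - i) = C.
  apply: (mulIf (expf_neq0 i (lt0r_neq0 r0))).
  by rewrite -sE -[LHS]mulrA -exprD subnK // ltnW.
have <- : C / x ^+ (j - i) = s * (r / x) ^+ (j - i).
  by rewrite -sE' -[LHS]mulrA -expr_div_n.
by rewrite -sE' mulfK // expf_neq0 // gt_eqF.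
Qed.

Lemma gauss_image_center f a a' r b s : 0 < r -> abs (a - a') <= r ->
  gauss_image f a r b s -> gauss_image f a' r b s.
Proof.
move=> r0 aa' [s0 h]; split=> // c.
by rewrite -!(gn_center _ r0 aa').
Qed.

(** The function c -> max(|b - c|, s) has minimum s, attained at b; evaluating at both centres
    compares the discs. Different dominant indices produce different centres b, and this identifies
    them. *)
Lemma gauss_image_uniq f a r b s b' s' : 0 < r ->
  gauss_image f a r b s -> gauss_image f a r b' s' -> s = s' /\ abs (b - b') <= s.
Proof.
move=> r0 [s0 h] [s0' h'].
have d0 : 0 < gn (den f) a r by rewrite gn_gt0 ?den_neq0.
have E c : Num.max (abs (b - c)) s = Num.max (abs (b' - c)) s'.
  by apply: (mulIf (lt0r_neq0 d0)); rewrite -h -h'.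
have e1 : s = Num.max (abs (b' - b)) s' by rewrite -E subrr abs0 max_r // ltW.
have e2 : s' = Num.max (abs (b - b')) s by rewrite E subrr abs0 max_r // ltW.
have ss' : s = s'.
  apply/eqP; rewrite eq_le; apply/andP; split.
    by rewrite e2 le_max lexx orbT.
  by rewrite e1 le_max lexx orbT.
by split=> //; rewrite ss' e2 le_max lexx.
Qed.

End RationalMap.

(** * Ends *)

Section Ends.
Context {p : nat} {R : realType} {K : padicComplexType p R}.
Local Notation abs := (@Cp_abs p R K).
Local Notation uC := (@Cp_ultra p R K).
Local Notation value_group := (value_group K).
Local Notation chain := (chain K).
Local Notation P1_end := (P1_end K).
Implicit Types (r s t e : R) (i j k l n N : nat) (a b x y z w : K) (c : chain)
  (P Q : P1_end) (B : set (P1 K)).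

Lemma chain_ball_mono c i j : (i <= j)%N -> chain_ball c i `<=` chain_ball c j.
Proof.
move=> /subnKC <-; elim: (j - i)%N => [|n IH]; first by rewrite addn0.
by rewrite addnS; apply: (subset_trans IH); exact: chain_increasing (chainP c) _.
Qed.

Lemma chain_ball_sub c i : chain_ball c i `<=` chain_union c.
Proof. by rewrite (chain_bigcup (chainP c)) => x Bx; exists i. Qed.

Lemma chain_unionP c (x : P1 K) : chain_union c x -> exists i, chain_ball c i x.
Proof. by rewrite (chain_bigcup (chainP c)) => -[i _ Bx]; exists i. Qed.

(** Closed and irrational balls are merged and sorted by whether they contain infinity. *)
Lemma closed_irr_ballP B : closed_ball B \/ irrational_ball B ->
  (~ B None /\ exists b s, 0 < s /\ B = cball b s) \/
  (B None /\ exists b s, 0 < s /\ B = ~` oball b s).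
Proof.
have compl (C : set (P1 K)) : ~` C = B -> B = ~` C by [].
case=> -[].
- move=> [b [s [s0 _ BE]]]; left; split; first by rewrite BE; exact: cball_None.
  by exists b, s.
- move=> [b [s [s0 _ BE]]]; right; rewrite -[B]setCK BE.
  by split; [exact: oball_None|exists b, s].
- move=> [b [s [s0 vs BE]]]; left; split; first by rewrite BE; exact: oball_None.
  by exists b, s; rewrite cball_irr.
- move=> [b [s [s0 _ BE]]]; right; rewrite -[B]setCK BE.
  by split; [exact: oball_None|exists b, s].
Qed.

Lemma cball_closed_irr a r : 0 < r -> closed_ball (cball a r) \/ irrational_ball (cball a r).
Proof.
move=> r0; have [vr|vr] := pselect (value_group r).
  by left; left; exists a, r.
by right; left; exists a, r; split=> //; exact: cball_irr.
Qed.

Lemma oballC_closed_irr a r : 0 < r ->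
  closed_ball (~` oball a r) \/ irrational_ball (~` oball a r).
Proof.
move=> r0; have [vr|vr] := pselect (value_group r).
  by left; right; exists a, r; rewrite setCK.
by right; right; exists a, r; rewrite setCK.
Qed.

Lemma oball_open_irr a r : 0 < r -> open_ball (oball a r) \/ irrational_ball (oball a r).
Proof.
move=> r0; have [vr|vr] := pselect (value_group r).
  by left; left; exists a, r.
by right; left; exists a, r.
Qed.

Lemma cballC_open_irr a r : 0 < r ->
  open_ball (~` cball a r) \/ irrational_ball (~` cball a r).
Proof.
move=> r0; have [vr|vr] := pselect (value_group r).
  by left; right; exists a, r; rewrite setCK.
by right; right; exists a, r; rewrite setCK; split=> //; exact: cball_irr.
Qed.

Hypothesis p_prime : prime p.

(** Once a member contains a it can be recentred at a, and it is an affine disc because the union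
    misses infinity. Its radius tends to r because every point at distance below r from a is
    eventually covered. *)
Lemma chain_oball c a r : 0 < r -> chain_union c = oball a r ->
  exists N (rho : nat -> R),
  [/\ forall i, (N <= i)%N -> chain_ball c i = cball a (rho i) /\ 0 < rho i < r,
      forall i j, (N <= i)%N -> (i <= j)%N -> rho i <= rho j &
      forall t, t < r -> exists M, forall i, (M <= i)%N -> t < rho i].
Proof.
move=> r0 cE.
have [N BNa] : exists N, chain_ball c N (Some a).
  by apply: chain_unionP; rewrite cE; exact: oball_mem.
have ex i : exists s, (N <= i)%N -> chain_ball c i = cball a s /\ 0 < s < r.
  have [Ni|iN] := leqP N i; last by exists 0.
  have sub : chain_ball c i `<=` oball a r by rewrite -cE; exact: chain_ball_sub.
  have Ba := chain_ball_mono Ni BNa.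
  case: (closed_irr_ballP (chain_closed_or_irr (chainP c) i)) => -[BN [b [s [s0 BE]]]]; last first.
    by case: (oball_None (sub _ BN)).
  have BE' : chain_ball c i = cball a s.
    by rewrite BE; apply: cball_center; rewrite absBC; apply/cballP; rewrite -BE.
  exists s => _; split=> //; rewrite s0 /=.
  have [] // := @cball_sub_oball_radius _ _ _ a a s r.
    by rewrite -BE'.
  by rewrite -BE' -cE; exact: chain_neq (chainP c) i.
have [rho H] := choice ex; exists N, rho.
split=> // [i j Ni ij|t tr].
  have [Ei /andP[i0 _]] := H i Ni; have [Ej _] := H j (leq_trans Ni ij).
  have := chain_ball_mono (c := c) ij; rewrite Ei Ej => /(cball_sub_radius p_prime i0)[] //.
have m0 : 0 <= Num.max 0 t by rewrite le_max lexx.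
have mr : Num.max 0 t < r by rewrite gt_max r0.
have [z [z1 z2]] := between_pt p_prime a m0 mr.
have [M BM] : exists M, chain_ball c M (Some z) by apply: chain_unionP; rewrite cE; apply/oballP.
exists (maxn N M) => i; rewrite geq_max => /andP[Ni Mi].
have := chain_ball_mono Mi BM; rewrite (H i Ni).1 => /cballP; apply: lt_le_trans.
by move: z1; rewrite gt_max => /andP[].
Qed.

(** Infinity plays the role of a here: from the first member that contains it, all members are
    complements of discs, which contain a. *)
Lemma chain_cballC c a r : 0 < r -> chain_union c = ~` cball a r ->
  exists N (rho : nat -> R),
  [/\ forall i, (N <= i)%N -> chain_ball c i = ~` oball a (rho i) /\ r < rho i,
      forall i j, (N <= i)%N -> (i <= j)%N -> rho j <= rho i &
      forall t, r < t -> exists M, forall i, (M <= i)%N -> rho i < t].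
Proof.
move=> r0 cE.
have [N BNa] : exists N, chain_ball c N None.
  by apply: chain_unionP; rewrite cE; exact: cball_None.
have ex i : exists s, (N <= i)%N -> chain_ball c i = ~` oball a s /\ r < s.
  have [Ni|iN] := leqP N i; last by exists 0.
  have sub : chain_ball c i `<=` ~` cball a r by rewrite -cE; exact: chain_ball_sub.
  have Ba := chain_ball_mono Ni BNa.
  case: (closed_irr_ballP (chain_closed_or_irr (chainP c) i)) => -[BN [b [s [s0 BE]]]]; first by [].
  move: sub; rewrite BE classical_sets.setCS => sub.
  have ab : abs (a - b) < s by apply/oballP/sub/cball_mem/ltW.
  rewrite -(oball_center ab) in BE sub *.
  exists s => _; split=> //.
  have [] // := @cball_sub_oball_radius _ _ _ a a r s.
  move=> h; apply: (chain_neq (chainP c) (i := i)).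
  by rewrite BE -h cE.
have [rho H] := choice ex; exists N, rho.
split=> // [i j Ni ij|t rt].
  have [Ei _] := H i Ni; have [Ej j0] := H j (leq_trans Ni ij).
  have := chain_ball_mono (c := c) ij; rewrite Ei Ej classical_sets.setCS.
  by case/(oball_sub_radius p_prime (lt_trans r0 j0)).
have [z [z1 z2]] := between_pt p_prime a (ltW r0) rt.
have [M BM] : exists M, chain_ball c M (Some z).
  by apply: chain_unionP; rewrite cE => /cballP; rewrite leNgt z1.
exists (maxn N M) => i; rewrite geq_max => /andP[Ni Mi].
have := chain_ball_mono Mi BM; rewrite (H i Ni).1 => zo.
by apply: le_lt_trans z2; rewrite leNgt; apply/negP => /oballP.
Qed.

Lemma is_chain_oball a r (rho : nat -> R) : (forall i, 0 < rho i < r) ->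
  (forall i, rho i <= rho i.+1) -> (forall t, t < r -> exists i, t < rho i) ->
  is_chain (oball a r) (fun i => cball a (rho i)).
Proof.
move=> h1 h2 h3; have r0 : 0 < r by case/andP: (h1 0%N); exact: lt_trans.
split=> [i|i||| i].
- by apply: cball_closed_irr; case/andP: (h1 i).
- by move=> _ [z /= zi <-]; apply/cballP; apply: le_trans (h2 i).
- apply/seteqP; split=> [_ [z /= /h3[i zi] <-]|_ [i _ [z /= zi <-]]].
    by exists i => //; apply/cballP/ltW.
  by apply/oballP; apply: le_lt_trans zi _; case/andP: (h1 i).
- by have [] := oball_open_irr a r0; [constructor 1|constructor 2].
- move=> e; case/andP: (h1 i) => i0 ir.
  have [z [z1 z2]] := between_pt p_prime a (ltW i0) ir.
  have /oballP := z2; rewrite -e => /cballP; by rewrite leNgt z1.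
Qed.

Lemma is_chain_cballC a r (rho : nat -> R) : 0 < r -> (forall i, r < rho i) ->
  (forall i, rho i.+1 <= rho i) -> (forall t, r < t -> exists i, rho i < t) ->
  is_chain (~` cball a r) (fun i => ~` oball a (rho i)).
Proof.
move=> r0 h1 h2 h3; split=> [i|i||| i].
- by apply: oballC_closed_irr; exact: lt_trans (h1 i).
- by rewrite classical_sets.setCS => _ [z /= zi <-]; apply/oballP; apply: lt_le_trans (h2 i).
- rewrite -setC_bigcap; congr (~` _); apply/seteqP; split.
    by move=> _ [z /= zi <-] i _; apply/oballP; apply: le_lt_trans (h1 i).
  move=> [z|] h; last by case: (oball_None (h 0%N I)).
  apply/cballP; rewrite leNgt; apply/negP => /h3[i zi].
  by have /oballP := h i I; rewrite ltNge (ltW zi).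
- by have [] := cballC_open_irr a r0; [constructor 1|constructor 2].
- move=> /(congr1 setC); rewrite !setCK => e.
  have [z [z1 z2]] := between_pt p_prime a (ltW r0) (h1 i).
  have /oballP := z2; rewrite e => /cballP; by rewrite leNgt z1.
Qed.

Lemma inv_succ_lt e : 0 < e -> exists i : nat, i.+2%:R^-1 < e.
Proof.
move=> e0; exists (Num.Def.archi_bound e^-1); rewrite invf_plt ?posrE ?ltr0n //.
have e0' : 0 < e^-1 by rewrite invr_gt0.
apply: lt_le_trans (archi_boundP (ltW e0')) _; rewrite ler_nat.
by apply: leqW.
Qed.

Lemma exists_chain_oball a r : 0 < r -> exists c, chain_union c = oball a r.
Proof.
move=> r0; have i0 (i : nat) : 0 < i.+2%:R^-1 :> R by rewrite invr_gt0 ltr0n.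
have i1 (i : nat) : i.+2%:R^-1 < 1 :> R by rewrite invf_lt1 ?ltr0n // ltr1n.
(* The offset 2 makes the radius positive already at i = 0. *)
have h1 i : 0 < r * (1 - i.+2%:R^-1) < r.
  by rewrite pmulr_rgt0 // subr_gt0 i1 /= gtr_pMr // ltrBlDr ltrDl.
have h2 i : r * (1 - i.+2%:R^-1) <= r * (1 - i.+3%:R^-1).
  by rewrite ler_pM2l // lerD2l lerN2 lef_pV2 ?posrE ?ltr0n // ler_nat.
have h3 t : t < r -> exists i : nat, t < r * (1 - i.+2%:R^-1).
  move=> tr; have [|i hi] := @inv_succ_lt ((r - t) / r).
    by rewrite divr_gt0 // subr_gt0.
  exists i; rewrite mulrBr mulr1 ltrBrDl -ltrBrDr.
  by rewrite mulrC -ltr_pdivlMr.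
by exists (Chain (is_chain_oball a h1 h2 h3)).
Qed.

Lemma exists_chain_cballC a r : 0 < r -> exists c, chain_union c = ~` cball a r.
Proof.
move=> r0; have i0 (i : nat) : 0 < i.+2%:R^-1 :> R by rewrite invr_gt0 ltr0n.
have h1 i : r < r * (1 + i.+2%:R^-1).
  by rewrite ltr_pMr // ltrDl.
have h2 i : r * (1 + i.+3%:R^-1) <= r * (1 + i.+2%:R^-1).
  by rewrite ler_pM2l // lerD2l lef_pV2 ?posrE ?ltr0n // ler_nat.
have h3 t : r < t -> exists i : nat, r * (1 + i.+2%:R^-1) < t.
  move=> tr; have [|i hi] := @inv_succ_lt ((t - r) / r).
    by rewrite divr_gt0 // subr_gt0.
  exists i; rewrite mulrDr mulr1 -ltrBrDl.
  by rewrite mulrC -ltr_pdivlMr.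
by exists (Chain (is_chain_cballC a r0 h1 h2 h3)).
Qed.

Lemma chain_equiv_refl c : chain_equiv c c.
Proof. by move=> N; exists N; split. Qed.

Lemma chain_equiv_sym c c' : chain_equiv c c' -> chain_equiv c' c.
Proof. by move=> h N; have [n [? ? ?]] := h N; exists n. Qed.

Lemma chain_equiv_trans c c' c'' :
  chain_equiv c c' -> chain_equiv c' c'' -> chain_equiv c c''.
Proof.
move=> h h' N; have [n [Nn h1 h2]] := h N; have [m [Nm h3 h4]] := h' N.
(* Both inclusions have to hold at a common index, so each is pushed to its own index and the
   maximum is taken. *)
have [n' [nn' h5 _]] := h' n; have [m' [mm' _ h6]] := h m.
exists (maxn n' m'); split.
- by rewrite leq_max (leq_trans Nn nn').
- apply: subset_trans h1 _; apply: subset_trans h5 _; apply: chain_ball_mono.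
  exact: leq_maxl.
- apply: subset_trans h4 _; apply: subset_trans h6 _; apply: chain_ball_mono.
  exact: leq_maxr.
Qed.

Lemma chain_equiv_union c c' : chain_equiv c c' -> chain_union c = chain_union c'.
Proof.
move=> h; apply/seteqP; split=> x /chain_unionP[N xN]; have [n [_ h1 h2]] := h N.
  exact: chain_ball_sub (h1 _ xN).
exact: chain_ball_sub (h2 _ xN).
Qed.

Definition end_of c : P1_end := P1End (ex_intro _ c erefl).

Lemma end_chainP P : exists c, end_chains P c.
Proof. by case: (end_class P) => c cE; exists c; rewrite cE; exact: chain_equiv_refl. Qed.

Lemma end_chainE P c : end_chains P c -> forall c', end_chains P c' <-> chain_equiv c c'.
Proof.
case: (end_class P) => c0 c0E; rewrite c0E /= => h c'; split=> h'.
  exact: chain_equiv_trans (chain_equiv_sym h) h'.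
exact: chain_equiv_trans h h'.
Qed.

Lemma end_ballE P c : end_chains P c -> end_ball P = chain_union c.
Proof.
move=> Pc; apply/seteqP; split=> [x [c' /= Pc' xc']|x xc]; last by exists c.
by rewrite (chain_equiv_union ((end_chainE Pc c').1 Pc')).
Qed.

Lemma end_of_ball c : end_ball (end_of c) = chain_union c.
Proof. by apply: end_ballE; exact: chain_equiv_refl. Qed.

Lemma end_eq P P' c c' : end_chains P c -> end_chains P' c' -> chain_equiv c c' -> P = P'.
Proof.
move=> Pc Pc' h.
have E : end_chains P = end_chains P'.
  apply/seteqP; split=> d.
    move=> /(end_chainE Pc) h1; apply/(end_chainE Pc').
    exact: chain_equiv_trans (chain_equiv_sym h) h1.
  move=> /(end_chainE Pc') h1; apply/(end_chainE Pc).
  exact: chain_equiv_trans h h1.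
case: P P' E {Pc Pc'} => [S hS] [S' hS'] /= E; rewrite E in hS *.
by congr P1End; exact: Prop_irrelevance.
Qed.

(** Open and irrational balls together; these are the balls of nonsingular ends. *)
Definition nonsingular_ball B :=
  exists a r, 0 < r /\ (B = oball a r \/ B = ~` cball a r).

(** About a common centre both chains have radii tending to r, so each one eventually overtakes any
    given member of the other. *)
Lemma nonsingular_chain_equiv c c' : nonsingular_ball (chain_union c) ->
  chain_union c = chain_union c' -> chain_equiv c c'.
Proof.
move=> [a [r [r0 [cE|cE]]]] cc'; have c'E := cc'; rewrite cE in c'E; move/esym in c'E.
  have [N0 [rho [h1 h2 h3]]] := chain_oball r0 cE.
  have [N0' [rho' [h1' h2' h3']]] := chain_oball r0 c'E.
  move=> N; pose N1 := maxn N (maxn N0 N0').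
  have [N1N N1N0 N1N0'] : [/\ (N <= N1)%N, (N0 <= N1)%N & (N0' <= N1)%N].
    by rewrite /N1; split; lia.
  have [E1 /andP[_ r1]] := h1 _ N1N0; have [E1' /andP[_ r1']] := h1' _ N1N0'.
  have [M hM] := h3 _ r1'; have [M' hM'] := h3' _ r1.
  pose n := maxn N1 (maxn M M').
  have [nN1 nM nM'] : [/\ (N1 <= n)%N, (M <= n)%N & (M' <= n)%N].
    by rewrite /n; split; lia.
  exists n; split; first exact: leq_trans nN1.
    apply: subset_trans (chain_ball_mono N1N) _.
    rewrite E1 (h1' n (leq_trans N1N0' nN1)).1 => _ [z /= zr <-]; apply/cballP.
    by apply: le_trans zr _; apply/ltW/hM'.
  apply: subset_trans (chain_ball_mono N1N) _.
  rewrite E1' (h1 n (leq_trans N1N0 nN1)).1 => _ [z /= zr <-]; apply/cballP.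
  by apply: le_trans zr _; apply/ltW/hM.
have [N0 [rho [h1 h2 h3]]] := chain_cballC r0 cE.
have [N0' [rho' [h1' h2' h3']]] := chain_cballC r0 c'E.
move=> N; pose N1 := maxn N (maxn N0 N0').
have [N1N N1N0 N1N0'] : [/\ (N <= N1)%N, (N0 <= N1)%N & (N0' <= N1)%N].
  by rewrite /N1; split; lia.
have [E1 r1] := h1 _ N1N0; have [E1' r1'] := h1' _ N1N0'.
have [M hM] := h3 _ r1'; have [M' hM'] := h3' _ r1.
pose n := maxn N1 (maxn M M').
have [nN1 nM nM'] : [/\ (N1 <= n)%N, (M <= n)%N & (M' <= n)%N].
  by rewrite /n; split; lia.
exists n; split; first exact: leq_trans nN1.
  apply: subset_trans (chain_ball_mono N1N) _.
  rewrite E1 (h1' n (leq_trans N1N0' nN1)).1 classical_sets.setCS => _ [z /= zr <-]; apply/oballP.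
  by apply: lt_le_trans zr _; apply/ltW/hM'.
apply: subset_trans (chain_ball_mono N1N) _.
rewrite E1' (h1 n (leq_trans N1N0 nN1)).1 classical_sets.setCS => _ [z /= zr <-]; apply/oballP.
by apply: lt_le_trans zr _; apply/ltW/hM.
Qed.

Lemma nonsingular_end_mem P c : nonsingular_ball (chain_union c) ->
  end_ball P = chain_union c -> end_chains P c.
Proof.
move=> nc PE; have [c' Pc'] := end_chainP P; apply/(end_chainE Pc').
apply: chain_equiv_sym; apply: nonsingular_chain_equiv => //.
by rewrite -PE (end_ballE Pc').
Qed.

Lemma nonsingular_end_inj P P' : nonsingular_ball (end_ball P) ->
  end_ball P = end_ball P' -> P = P'.
Proof.
move=> nP PE; have [c Pc] := end_chainP P; apply: (end_eq Pc _ (chain_equiv_refl c)).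
by apply: nonsingular_end_mem; rewrite -(end_ballE Pc).
Qed.

Lemma nonsingular_end_exists B : nonsingular_ball B -> exists P, end_ball P = B.
Proof.
move=> [a [r [r0 [->|->]]]].
  by have [c cE] := exists_chain_oball a r0; exists (end_of c); rewrite end_of_ball.
by have [c cE] := exists_chain_cballC a r0; exists (end_of c); rewrite end_of_ball.
Qed.

End Ends.

(** * Points of H_p as points zeta_(a, r) *)

Section Points.
Context {p : nat} {R : realType} {K : padicComplexType p R}.
Local Notation abs := (@Cp_abs p R K).
Local Notation uC := (@Cp_ultra p R K).
Local Notation value_group := (value_group K).
Local Notation chain := (chain K).
Local Notation P1_end := (P1_end K).
Local Notation Hp := (Hp K).
Implicit Types (r s t e : R) (a b x y z w : K) (P Q : P1_end) (B : set (P1 K)) (S T : Hp).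

(** The directions at zeta_(a, r): the one of infinity and the open discs of radius r inside the
    closed disc. For r outside the value group only two sets remain. *)
Definition dirs a r : set (set (P1 K)) :=
  [set B | B = ~` cball a r \/ exists2 b, abs (b - a) <= r & B = oball b r].

Lemma dirs_nonsingular a r B : 0 < r -> dirs a r B -> nonsingular_ball B.
Proof.
move=> r0 [->|[b _ ->]]; first by exists a, r; split=> //; right.
by exists b, r; split=> //; left.
Qed.

(* The cell of a point with respect to zeta_(a, r), in homogeneous coordinates
   (u : v), for the norm max |u - a v| (r |v|) attached to zeta_(a, r). *)
Definition hom (x : P1 K) : K * K := if x is Some z then (z, 1) else (1, 0).
Definition hdet (u v : K * K) : K := u.1 * v.2 - v.1 * u.2.
Definition hnorm a r (u : K * K) : R := Num.max (abs (u.1 - a * u.2)) (r * abs u.2).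
Definition hcell a r (u v : K * K) := abs (hdet u v) * r < hnorm a r u * hnorm a r v.
Definition cell a r (x : P1 K) : set (P1 K) := [set y | hcell a r (hom x) (hom y)].

Lemma hnorm_fin a r z : hnorm a r (hom (Some z)) = Num.max (abs (z - a)) r.
Proof. by rewrite /hnorm /= mulr1 (uabs1 uC) mulr1. Qed.

Lemma hnorm_inf a r : hnorm a r (hom None) = 1.
Proof. by rewrite /hnorm /= mulr0 subr0 (uabs1 uC) abs0 mulr0 max_l. Qed.

Lemma hdet_fin x y : hdet (hom (Some x)) (hom (Some y)) = x - y.
Proof. by rewrite /hdet /= !mulr1. Qed.

Lemma cell_inf a r : 0 < r -> cell a r None = ~` cball a r.
Proof.
move=> r0; apply/seteqP; split=> -[z|]; rewrite /cell /hcell /= ?hnorm_inf.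
- rewrite mul1r hnorm_fin /hdet /= mulr0 subr0 mulr1 (uabs1 uC) mul1r.
  by rewrite lt_max ltxx orbF => h /cballP; rewrite leNgt h.
- by move=> _; exact: cball_None.
- move=> h; rewrite mul1r hnorm_fin /hdet /= mulr0 subr0 mulr1 (uabs1 uC) mul1r.
  by rewrite lt_max ltNge; apply/orP; left; apply/negP => /cballP.
- by rewrite /hdet /= mulr0 subrr abs0 mul0r mulr1.
Qed.

Lemma cell_fin_in a r x : 0 < r -> abs (x - a) <= r -> cell a r (Some x) = oball x r.
Proof.
move=> r0 xa; apply/seteqP; split=> -[z|]; rewrite /cell /hcell /= ?hnorm_inf ?hnorm_fin.
- rewrite hdet_fin max_r // mulrC ltr_pM2l // lt_max => /orP[|] h; apply/oballP.
    have [zr|rz] := leP (abs (z - a)) r; first by rewrite absBC (lt_le_trans h).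
    by move: h; rewrite (absBC x z) (abs_dom (y := a)) ?ltxx // absBC (le_lt_trans xa).
  by rewrite absBC.
- by rewrite mulr1 max_r // /hdet /= mulr0 sub0r mulr1 (uabsN uC) (uabs1 uC) mul1r ltxx.
- move=> /oballP h; rewrite hdet_fin max_r // mulrC ltr_pM2l // lt_max; apply/orP; right.
  by rewrite absBC.
- by move/oball_None.
Qed.

Lemma cell_fin_out a r x : 0 < r -> r < abs (x - a) -> cell a r (Some x) = ~` cball a r.
Proof.
move=> r0 xa; apply/seteqP; split=> -[z|]; rewrite /cell /hcell /= ?hnorm_inf ?hnorm_fin.
- rewrite hdet_fin max_l ?(ltW xa) // => h /cballP za; move: h.
  rewrite max_r // (abs_dom (y := a)) ?ltxx //.
  by rewrite absBC (le_lt_trans za).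
- by move=> _; exact: cball_None.
- move=> h; have za : r < abs (z - a) by rewrite ltNge; apply/negP => /cballP.
  rewrite hdet_fin !max_l ?(ltW xa) ?(ltW za) //.
  have [h1|h1] := leP (abs (x - a)) (abs (z - a)).
    apply: (@le_lt_trans _ _ (abs (z - a) * r)); last first.
      by rewrite mulrC ltr_pM2r // (lt_trans r0).
    rewrite ler_pM2r //; apply: (abs_trans (y := a)) => //; by rewrite absBC.
  apply: (@le_lt_trans _ _ (abs (x - a) * r)).
    rewrite ler_pM2r //; apply: (abs_trans (y := a)) => //; by rewrite absBC ltW.
  by rewrite ltr_pM2l // (lt_trans r0).
- move=> _; rewrite mulr1 max_l ?(ltW xa) // /hdet /= mulr0 sub0r mulr1 (uabsN uC) (uabs1 uC).
  by rewrite mul1r.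
Qed.

Lemma dirs_cell a r B : 0 < r -> dirs a r B <-> exists x : P1 K, B = cell a r x.
Proof.
move=> r0; split=> [[->|[b ba ->]]|[[x|] ->]].
- by exists None; rewrite cell_inf.
- by exists (Some b); rewrite cell_fin_in.
- have [xa|ax] := leP (abs (x - a)) r.
    by right; exists x; rewrite ?cell_fin_in.
  by left; rewrite cell_fin_out.
- by left; rewrite cell_inf.
Qed.

(** * Homographies and residue classes *)

Definition mat (a b c d : K) (u : K * K) : K * K := (a * u.1 + b * u.2, c * u.1 + d * u.2).

Lemma hom_mobius a b c d (x : P1 K) : a * d - b * c != 0 -> exists2 l, l != 0 &
  mat a b c d (hom x) = (l * (hom (mobius a b c d x)).1, l * (hom (mobius a b c d x)).2).
Proof.
move=> D0; case: x => [x|]; rewrite /mat /=; case: eqP => [h|/eqP h].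
- exists (a * x + b); rewrite /= ?mulr1 ?mulr0 ?h //.
  apply: contraNneq D0 => h'; have -> : a * d - b * c = a * (c * x + d) - c * (a * x + b) by ring.
  by rewrite h h' !mulr0 subrr.
- by exists (c * x + d) => //=; rewrite !mulr1; congr pair; rewrite [RHS]mulrC divfK.
- exists a; rewrite /= ?h ?mulr1 ?mulr0 ?addr0 //.
  by apply: contraNneq D0 => h'; rewrite h h' mul0r mulr0 subrr.
- by exists c => //=; rewrite !mulr1 !mulr0 !addr0; congr pair; rewrite [RHS]mulrC divfK.
Qed.

Lemma mobius_surj a b c d (y : P1 K) : a * d - b * c != 0 -> exists x : P1 K, mobius a b c d x = y.
Proof.
move=> D0; exists (mobius d (- b) (- c) a y); case: y => [y|] /=.
  case: eqP => [h|/eqP h] /=.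
    have h1 : a = c * y by apply/eqP; rewrite -subr_eq0 -mulNr addrC h.
    case: eqP => [c0|/eqP c0]; last by rewrite h1 mulrC mulKf.
    by move: D0; rewrite h1 c0 !mul0r mulr0 subrr eqxx.
  have h' : a - c * y != 0 by rewrite addrC -mulNr.
  have -> : c * ((d * y - b) / (- c * y + a)) + d = (a * d - b * c) / (- c * y + a).
    by field.
  rewrite mulf_eq0 invr_eq0 (negPf h) (negPf D0) /=; congr Some; field.
  by rewrite h D0.
rewrite oppr_eq0; case: eqP => [c0|/eqP c0] /=; first by rewrite c0 eqxx.
have -> : c * (d / - c) + d = 0 by field; rewrite ?oppr_eq0 ?c0.
by rewrite eqxx.
Qed.

Lemma hcell_scale a r l m u v : l != 0 -> m != 0 ->
  hcell a r (l * u.1, l * u.2) (m * v.1, m * v.2) <-> hcell a r u v.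
Proof.
move=> l0 m0; have al := uabs_gt0 uC l0; have am := uabs_gt0 uC m0.
have hn k (w : K * K) : hnorm a r (k * w.1, k * w.2) = abs k * hnorm a r w.
  rewrite /hnorm /= mulrCA -mulrBr !(uabsM uC) mulrCA maxr_pMr ?abs_ge0 //.
rewrite /hcell !hn.
have -> : hdet (l * u.1, l * u.2) (m * v.1, m * v.2) = (l * m) * hdet u v.
  by rewrite /hdet /=; ring.
rewrite !(uabsM uC) [X in _ < X]mulrACA -mulrA ltr_pM2l //.
exact: mulr_gt0.
Qed.

(** The matrix carries the norm max(|u|, |v|) to a multiple of the norm attached to some zeta_(e,
    s). The clause on c and d fixes e and s for affine maps, which are used to produce a given
    zeta_(b, |a|). *)
Lemma mobius_cell a b c d : a * d - b * c != 0 -> exists (e : K) (s : R),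
  [/\ 0 < s, value_group s, (c == 0 -> d == 1 -> e = b /\ s = abs a) &
  forall x y : P1 K, cell 0 1 x y <-> cell e s (mobius a b c d x) (mobius a b c d y)].
Proof.
move=> D0; set D := a * d - b * c in D0.
have aD := uabs_gt0 uC D0.
(* Determinants are multiplied by D and products of two norms by (|D| / k) ^ 2; the radius |D| / k ^
   2 makes up the difference. *)
suff [e [k [vk k0 e01 hn]]] : exists (e : K) (k : R), [/\ value_group k, 0 < k,
    (c == 0 -> d == 1 -> e = b /\ k = 1) &
    forall u, hnorm e (abs D / k ^+ 2) (mat a b c d u) = abs D / k * hnorm 0 1 u].
  exists e, (abs D / k ^+ 2); split.
  - by rewrite divr_gt0 ?exprn_gt0.
  - apply: value_groupM; first exact: value_group_abs.
    exact/value_groupV/value_groupX.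
  - move=> c0 d1; have [-> ->] := e01 c0 d1; split=> //.
    by rewrite /D (eqP c0) (eqP d1) mulr1 mulr0 subr0 expr1n divr1.
  move=> x y; have [l l0 xE] := hom_mobius x D0; have [m m0 yE] := hom_mobius y D0.
  rewrite /cell /= -(hcell_scale e _ (hom (mobius a b c d x)) (hom (mobius a b c d y)) l0 m0).
  rewrite -xE -yE /hcell !hn.
  have -> : hdet (mat a b c d (hom x)) (mat a b c d (hom y)) = D * hdet (hom x) (hom y).
    by rewrite /hdet /mat /D /=; ring.
  rewrite (uabsM uC) mulr1.
  have -> : abs D * abs (hdet (hom x) (hom y)) * (abs D / k ^+ 2) =
      (abs D / k) ^+ 2 * abs (hdet (hom x) (hom y)) by field; rewrite gt_eqF.
  have -> : abs D / k * hnorm 0 1 (hom x) * (abs D / k * hnorm 0 1 (hom y)) =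
      (abs D / k) ^+ 2 * (hnorm 0 1 (hom x) * hnorm 0 1 (hom y)) by ring.
  by rewrite ltr_pM2l // exprn_gt0 // divr_gt0.
have h01 (u : K * K) : hnorm 0 1 u = Num.max (abs u.1) (abs u.2).
  by rewrite /hnorm mul0r subr0 mul1r.
(* k is max(|c|, |d|), and e is accordingly the image a / c of infinity or the image b / d of 0. *)
have [dc|cd] := leP (abs d) (abs c).
  have c0 : c != 0.
    apply: contraNneq D0 => c0; move: dc; rewrite c0 abs0 -[_ <= 0]orFb.
    have : 0 <= abs d by exact: abs_ge0.
    move=> h1; rewrite orFb => h2; have /eqP : abs d = 0 by apply/eqP; rewrite eq_le h1 h2.
    by rewrite abs_eq0 => /eqP d0; rewrite /D c0 d0 !mulr0 subrr.
  have ac := uabs_gt0 uC c0.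
  exists (a / c), (abs c); split=> //; first exact: value_group_abs.
    by move=> /eqP c0'; rewrite c0' eqxx in c0.
  move=> [u v]; rewrite h01 /hnorm /mat /=.
  have -> : a * u + b * v - a / c * (c * u + d * v) = - (D / c * v) by rewrite /D; field.
  rewrite (uabsN uC) (uabsM uC) (uabs_div uC).
  have -> : abs D / abs c ^+ 2 * abs (c * u + d * v) =
      abs D / abs c * abs (u + d / c * v).
    have -> : c * u + d * v = c * (u + d / c * v) by field.
    by rewrite (uabsM uC); field; rewrite gt_eqF.
  rewrite -maxr_pMr ?divr_ge0 ?abs_ge0 //; congr (_ * _).
  have h : abs (d / c * v) <= abs v.
    rewrite (uabsM uC) (uabs_div uC) -[leRHS]mul1r ler_wpM2r ?abs_ge0 //.
    by rewrite ler_pdivrMr // mul1r.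
  have [uv|vu] := leP (abs u) (abs v).
    by rewrite max_l //; exact: (uabsD_le uC uv h).
  by rewrite (uabs_addl uC) ?max_r ?(ltW vu) // (le_lt_trans h).
have ad : 0 < abs d by apply: le_lt_trans cd; exact: abs_ge0.
have d0 : d != 0 by rewrite -abs_eq0 gt_eqF.
exists (b / d), (abs d); split=> //; first exact: value_group_abs.
  by move=> _ /eqP ->; rewrite divr1 (uabs1 uC).
move=> [u v]; rewrite h01 /hnorm /mat /=.
have -> : a * u + b * v - b / d * (c * u + d * v) = D / d * u by rewrite /D; field.
rewrite (uabsM uC) (uabs_div uC).
have -> : abs D / abs d ^+ 2 * abs (c * u + d * v) =
    abs D / abs d * abs (v + c / d * u).
  have -> : c * u + d * v = d * (v + c / d * u) by field.
  by rewrite (uabsM uC); field; rewrite gt_eqF.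
rewrite -maxr_pMr ?divr_ge0 ?abs_ge0 //; congr (_ * _).
have h : abs (c / d * u) <= abs u.
  rewrite (uabsM uC) (uabs_div uC) -[leRHS]mul1r ler_wpM2r ?abs_ge0 //.
  by rewrite ler_pdivrMr // mul1r ltW.
have [uv|vu] := leP (abs v) (abs u).
  by rewrite max_l //; exact: (uabsD_le uC uv h).
by rewrite (uabs_addl uC) ?max_r ?(ltW vu) // (le_lt_trans h).
Qed.

Lemma reduction_cell (x y : P1 K) : reduction x = reduction y <-> cell 0 1 x y.
Proof.
case: x => [x|]; last first.
  rewrite cell_inf //; case: y => [y|] /=; last by split=> // _; exact: cball_None.
  case: ifP => h; split=> //.
    by move=> /cballP; rewrite subr0 h.
  by move=> _ /cballP; rewrite subr0 h.
have [x1|x1] := leP (abs x) 1; last first.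
  rewrite cell_fin_out ?subr0 //= leNgt x1 /=; case: y => [y|] /=; last first.
    by split=> // _; exact: cball_None.
  case: ifP => h; split=> //.
    by move=> /cballP; rewrite subr0 h.
  by move=> _ /cballP; rewrite subr0 h.
rewrite cell_fin_in ?subr0 //= x1; case: y => [y|] /=; last first.
  by split=> // /oball_None.
split=> [|/oballP yx].
  case: ifP => // _ [] E; apply/oballP.
  have : [set y0 | abs (y0 - x) < 1] x by rewrite /= subrr abs0.
  by rewrite E /= absBC.
have y1 : abs y <= 1 by rewrite -(subrK x y); apply: (uabsD_le uC _ x1); apply: ltW.
rewrite y1; congr Some; apply/seteqP; split=> z /= zx.
  by apply: abs_lttrans zx _; rewrite absBC.
exact: abs_lttrans zx yx.
Qed.

Lemma mobius_dirs a b c d : a * d - b * c != 0 -> exists (e : K) (s : R),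
  [/\ 0 < s, value_group s, (c == 0 -> d == 1 -> e = b /\ s = abs a) &
  forall B, (exists2 zeta, range (@reduction p R K) zeta &
       B = mobius a b c d @` (@reduction p R K @^-1` [set zeta])) <-> dirs e s B].
Proof.
move=> D0; have [e [s [s0 vs e01 H]]] := mobius_cell D0; exists e, s; split=> // B.
have img (x : P1 K) : mobius a b c d @` (@reduction p R K @^-1` [set reduction x]) =
    cell e s (mobius a b c d x).
  apply/seteqP; split=> [_ [y /= yx <-]|y].
    by apply/(H x y).1/reduction_cell.
  have [z <-] := mobius_surj y D0 => /(H x z).2/reduction_cell xz.
  by exists z.
rewrite dirs_cell //; split=> [[_ [x _ <-] ->]|[x ->]].
  by exists (mobius a b c d x).
have [z <-] := mobius_surj x D0; exists (reduction z); last by rewrite img.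
by exists z.
Qed.

(* S is the point zeta_(a, r), whether r is in the value group or not: if it is
   not, then oball b r = cball a r for all b in it. *)
Definition is_zeta a r S := 0 < r /\ Hp_ends S = [set P | dirs a r (end_ball P)].

Lemma Hp_eq S T : Hp_ends S = Hp_ends T -> S = T.
Proof.
case: S T => [S hS] [T hT] /= E; rewrite E in hS *; congr HpPoint.
exact: Prop_irrelevance.
Qed.

Lemma dirs_center a b r : abs (a - b) <= r -> dirs a r = dirs b r.
Proof.
move=> ab; apply/seteqP; split=> B [->|[z za ->]].
- by left; rewrite (cball_center ab).
- by right; exists z => //; exact: abs_trans za ab.
- by left; rewrite (cball_center ab).
- by right; exists z => //; apply: abs_trans za _; rewrite absBC.
Qed.

Lemma is_zeta_center a b r S : abs (a - b) <= r -> is_zeta a r S -> is_zeta b r S.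
Proof. by move=> ab [r0 SE]; split=> //; rewrite -(dirs_center ab). Qed.

Lemma is_zeta_uniq a r S T : is_zeta a r S -> is_zeta a r T -> S = T.
Proof. by move=> [_ SE] [_ TE]; apply: Hp_eq; rewrite SE TE. Qed.

Hypothesis p_prime : prime p.

Lemma dirs_irr a r B : 0 < r -> ~ value_group r ->
  dirs a r B <-> (B = ~` cball a r \/ B = oball a r).
Proof.
move=> r0 vr; split=> [[->|[b ba ->]]|[->|->]]; first by left.
- right; apply: oball_center; apply/oballP; rewrite -cball_irr //.
  exact/cballP.
- by left.
- by right; exists a; rewrite // subrr abs0 ltW.
Qed.

Lemma is_zeta_exists a r : 0 < r -> exists S, is_zeta a r S /\ (value_group r -> rational_point S).
Proof.
move=> r0; have [vr|vr] := pselect (value_group r).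
  have [c c0 cr] := vr.
  (* The map z -> c z + a, with |c| = r, sends zeta_(0, 1) to zeta_(a, r). *)
  have D0 : c * 1 - a * 0 != 0 by rewrite mulr1 mulr0 subr0.
  have [e [s [s0 vs es H]]] := mobius_dirs D0.
  have [eE sE] := es (eqxx _) (eqxx _); rewrite eE sE cr in H.
  have hS : rational_point [set P | dirs a r (end_ball P)].
    exists (mobius c a 0 1); first by exists c, a, 0, 1.
    by apply/seteqP; split=> P /= /H.
  exists (HpPoint (Or33 _ _ hS)); split=> //.
have [P PE] : exists P, end_ball P = oball a r.
  by apply: (nonsingular_end_exists p_prime); exists a, r; split=> //; left.
have [Q QE] : exists P, end_ball P = ~` cball a r.
  by apply: (nonsingular_end_exists p_prime); exists a, r; split=> //; right.
have hS : irrational_point [set P; Q].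
  exists P, Q; split=> //.
  - rewrite /irrational_end PE QE; split; first by left; exists a, r.
    by right; exists a, r; rewrite setCK; split=> //; exact: cball_irr.
  - by rewrite PE QE cball_irr // setICr.
  - by rewrite PE QE cball_irr // setUCr.
exists (HpPoint (Or32 _ _ hS)); split=> //; split=> //=.
apply/seteqP; split=> P' /=.
  by move=> [->|->]; apply/dirs_irr => //; rewrite ?PE ?QE; [right|left].
move=> h; have nP' := dirs_nonsingular r0 h; move: h => /dirs_irr[] // E.
  by right; apply: (nonsingular_end_inj p_prime); rewrite ?QE.
by left; apply: (nonsingular_end_inj p_prime); rewrite ?PE.
Qed.

Lemma end_ball_neqT P B : nonsingular_ball B -> end_ball P = B -> ~ singular_end P.
Proof.
move=> [a [r [r0 [->|->]]]] PE; rewrite /singular_end PE => /seteqP[_ h].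
  by have /oball_None := h None I.
by have /(_ (cball_mem a (ltW r0))) := h (Some a) I.
Qed.

Lemma is_zeta_HpR a r S : is_zeta a r S -> HpR S.
Proof.
move=> [r0 SE] [P sP PE]; apply: end_ball_neqT sP; last by [].
apply: (dirs_nonsingular (a := a) r0); have : Hp_ends S P by rewrite PE.
by rewrite SE.
Qed.

Lemma HpR_zeta S : HpR S -> exists a r, is_zeta a r S.
Proof.
move=> nS; case: (Hp_axiom S) => [/nS//|[P [P' [[iP iP'] disj cov SE]]]|[phi [a [b [c [d [D0 ->]]]]] SE]].
  have P'E : end_ball P' = ~` end_ball P.
    apply/seteqP; split=> x.
      by move=> h h'; have : set0 x; [rewrite -disj; split|].
    by move=> h; have : setT x by []; rewrite -cov => -[/h|].
  (* Of the two complementary irrational balls, the one that misses infinity gives the disc. *)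
  suff [a [r [r0 vr E]]] : exists a r, [/\ 0 < r, ~ value_group r &
      (end_ball P = oball a r /\ end_ball P' = ~` cball a r) \/
      (end_ball P' = oball a r /\ end_ball P = ~` cball a r)].
    exists a, r; split=> //; rewrite SE; apply/seteqP; split=> Q /=.
      by move=> [->|->]; apply/dirs_irr => //; case: E => -[E1 E2]; rewrite ?E1 ?E2; by [left|right].
    move=> h; have nQ := dirs_nonsingular r0 h; move: h => /dirs_irr[] // QE; case: E => -[E1 E2].
    - by right; apply: (nonsingular_end_inj p_prime); rewrite // E2.
    - by left; apply: (nonsingular_end_inj p_prime); rewrite // E2.
    - by left; apply: (nonsingular_end_inj p_prime); rewrite // E1.
    - by right; apply: (nonsingular_end_inj p_prime); rewrite // E1.
  case: iP => -[a [r [r0 vr E]]]; exists a, r; split=> //.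
    by left; split=> //; rewrite P'E cball_irr // E.
  by right; split; rewrite ?P'E // -[LHS]setCK E cball_irr.
have [e [s [s0 vs _ H]]] := mobius_dirs D0.
exists e, s; split=> //; rewrite SE; apply/seteqP; split=> P /= h; exact/H.
Qed.

Lemma is_zeta_associated a r S B : is_zeta a r S -> associated_ball S B <-> dirs a r B.
Proof.
move=> [r0 SE]; split=> [[P SP <-]|h]; first by move: SP; rewrite SE.
have [P PE] := nonsingular_end_exists p_prime (dirs_nonsingular r0 h).
by exists P; rewrite // SE /= PE.
Qed.

End Points.

(** * Action on the points zeta_(a, r) *)

Section Image.
Context {p : nat} {R : realType} {K : padicComplexType p R}.
Local Notation abs := (@Cp_abs p R K).
Local Notation uC := (@Cp_ultra p R K).
Local Notation value_group := (value_group K).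
Local Notation chain := (chain K).
Local Notation P1_end := (P1_end K).
Local Notation Hp := (Hp K).
Implicit Types (r s t e : R) (a b x y z w : K) (P Q : P1_end) (B : set (P1 K)) (S T : Hp)
  (k n N : nat) (q rho : nat -> R) (f : {fraction {poly K}}).

Lemma oball_diff a r t : oball a r `\` cball a t = annulus a t r.
Proof.
apply/seteqP; split=> [_ [[z /= zr <-] zt]|_ [z /= [tz zr] <-]].
  by apply/annulusP; split=> //; rewrite ltNge; apply/negP => h; apply: zt; apply/cballP.
by split; [apply/oballP|move/cballP; rewrite leNgt tz].
Qed.

Lemma cballC_diff a r t : ~` cball a r `\` ~` oball a t = annulus a r t.
Proof.
apply/seteqP; split=> [x [xr /contrapT xt]|_ [z /= [tz zr] <-]].
  case: xt xr => z /= zt <- zr; apply/annulusP; split=> //.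
  by rewrite ltNge; apply/negP => h; apply: zr; apply/cballP.
by split; [move/cballP; rewrite leNgt tz|move=> h; apply: h; apply/oballP].
Qed.

Hypothesis p_prime : prime p.

(** q stands for the source radii divided by their limit, or for the inverse quotients, so that one
    lemma serves both orientations of the map on annuli. *)
Lemma chain_annulus_in b s k q : 0 < s -> (0 < k)%N -> (forall i, 0 < q i < 1) ->
  (forall i, q i <= q i.+1) -> (forall t, t < 1 -> exists i, t < q i) ->
  exists c : chain, chain_union c = oball b s /\
    forall i, chain_set c i = annulus b (s * q i ^+ k) s.
Proof.
move=> s0 k0 h1 h2 h3; have q0 i : 0 < q i by case/andP: (h1 i).
have g1 i : 0 < s * q i ^+ k < s.
  rewrite mulr_gt0 ?exprn_gt0 //= gtr_pMr // exprn_ilt1 ?lt0n_neq0 ?(ltW (q0 i)) //.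
  by case/andP: (h1 i).
have g2 i : s * q i ^+ k <= s * q i.+1 ^+ k.
  by rewrite ler_pM2l // lerXn2r ?nnegrE ?(ltW (q0 _)).
have g3 t : t < s -> exists i, t < s * q i ^+ k.
  move=> ts; have [t0|t0] := leP t 0.
    by exists 0%N; apply: le_lt_trans t0 _; case/andP: (g1 0%N).
  (* A threshold t for the image radii s q ^ k becomes the threshold (t / s) ^ (1 / k) for q. *)
  have [y y0 yE] := real_nth_root (divr_gt0 t0 s0) k0.
  have [|i yi] := h3 y.
    by rewrite -(@expr_lt1 _ k) ?(ltW y0) // yE ltr_pdivrMr // mul1r.
  by exists i; rewrite mulrC -ltr_pdivrMr // -yE ltrXn2r -?lt0n // (ltW y0).
exists (Chain (is_chain_oball p_prime b g1 g2 g3)); split=> // i.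
exact: oball_diff.
Qed.

Lemma chain_annulus_out b s k q : 0 < s -> (0 < k)%N -> (forall i, 1 < q i) ->
  (forall i, q i.+1 <= q i) -> (forall t, 1 < t -> exists i, q i < t) ->
  exists c : chain, chain_union c = ~` cball b s /\
    forall i, chain_set c i = annulus b s (s * q i ^+ k).
Proof.
move=> s0 k0 h1 h2 h3; have q0 i : 0 < q i by exact: lt_trans (h1 i).
have g1 i : s < s * q i ^+ k.
  by rewrite ltr_pMr // exprn_egt1 // -lt0n.
have g2 i : s * q i.+1 ^+ k <= s * q i ^+ k.
  by rewrite ler_pM2l // lerXn2r ?nnegrE ?(ltW (q0 _)).
have g3 t : s < t -> exists i, s * q i ^+ k < t.
  move=> st; have t0 := lt_trans s0 st.
  have [y y0 yE] := real_nth_root (divr_gt0 t0 s0) k0.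
  have [|i yi] := h3 y.
    by rewrite -(@expr_gt1 _ k) ?(ltW y0) // yE ltr_pdivlMr // mul1r.
  by exists i; rewrite mulrC -ltr_pdivlMr // -yE ltrXn2r -?lt0n // (ltW (q0 i)).
exists (Chain (is_chain_cballC p_prime b s0 g1 g2 g3)); split=> // i.
exact: cballC_diff.
Qed.

(** A chain whose union is a nonsingular ball belongs to the end of that ball, so the class of an
    image chain is decided by its union alone. *)
Lemma end_image_intro f P Q : nonsingular_ball (end_ball Q) ->
  (forall c : chain, end_chains P c -> exists N, forall n, (N <= n)%N ->
    exists c' : chain, chain_union c' = end_ball Q /\
      forall i, chain_set c' i = rat_eval f @` chain_set c (n + i)%N) ->
  end_image f P Q.
Proof.
move=> nQ H c Pc; have [N HN] := H c Pc; exists N => // n /= Nn.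
have [c' [c'Q c'E]] := HN n Nn; exists c' => //.
by apply: (nonsingular_end_mem p_prime); rewrite c'Q.
Qed.

Lemma zeta_image f a r b s S T : nonconstant f -> is_zeta a r S -> is_zeta b s T ->
  gauss_image f a r b s -> Hp_image f S T.
Proof.
move=> nc zS zT gi P; have [r0 SE] := zS; have [s0 TE] := zT.
rewrite SE => dP.
have fromT b' Q : abs (b - b') <= s -> dirs b' s (end_ball Q) -> Hp_ends T Q.
  by move=> bb'; rewrite -(dirs_center bb') TE.
(* The centre b' found for one direction may differ from b, but it lies in the same closed disc, so
   its disc and the outside are directions at the image point. *)
have mk b' : abs (b - b') <= s -> exists Qi Qo, [/\ end_ball Qi = oball b' s,
    end_ball Qo = ~` cball b' s, Hp_ends T Qi & Hp_ends T Qo].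
  move=> bb'.
  have di : dirs b' s (oball b' s) by right; exists b'; rewrite ?subrr ?abs0 ?(ltW s0).
  have dou : dirs b' s (~` cball b' s) by left.
  have [Qi QiE] := nonsingular_end_exists p_prime (dirs_nonsingular s0 di).
  have [Qo QoE] := nonsingular_end_exists p_prime (dirs_nonsingular s0 dou).
  by exists Qi, Qo; split=> //; apply: (fromT b' _ bb'); rewrite ?QiE ?QoE.
have nsb b' Q : end_ball Q = oball b' s \/ end_ball Q = ~` cball b' s ->
    nonsingular_ball (end_ball Q) by move=> h; exists b', s.
(* The direction of infinity is computed outside the disc; any other one is computed inside, after
   recentring at its own point a'. *)
case: dP => [PE|[a' a'a PE]].
  have [b' [s' [k [e [gi' k0 re H]]]]] := gauss_image_right a nc r0.
  have [ss' bb'] := gauss_image_uniq r0 gi gi'; rewrite -ss' in H.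
  have [Qi [Qo [QiE QoE TQi TQo]]] := mk b' bb'.
  have chn (c : chain) : end_chains P c -> exists N rho, [/\
      forall n, (N <= n)%N -> chain_set c n = annulus a r (rho n) /\ r < rho n < e,
      forall i j, (N <= i)%N -> (i <= j)%N -> rho j <= rho i &
      forall t n, r < t -> exists i, rho (n + i)%N < t].
    move=> Pc; have cE : chain_union c = ~` cball a r by rewrite -(end_ballE Pc).
    have [N [rho [h1 h2 h3]]] := chain_cballC p_prime r0 cE.
    have [M hM] := h3 _ re; exists (maxn N M), rho; split.
    - move=> n; rewrite geq_max => /andP[Nn Mn]; have [cn rn] := h1 _ Nn.
      by rewrite /chain_set cE cn cballC_diff rn hM.
    - by move=> i j; rewrite geq_max => /andP[Ni _]; exact: h2.
    - move=> t n /h3[M' hM']; exists M'; apply: hM'; exact: leq_addl.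
  case: H => H.
    exists Qo => //; apply: end_image_intro; first by apply: (nsb b'); right.
    move=> c /chn[N [rho [h1 h2 h3]]]; exists N => n Nn.
    have Nni i : (N <= n + i)%N by rewrite (leq_trans Nn) // leq_addr.
    have [|||c' [c'E c'i]] := @chain_annulus_out b' s k (fun i => rho (n + i)%N / r) s0 k0.
    - by move=> i; have [_ /andP[ri _]] := h1 _ (Nni i); rewrite ltr_pdivlMr // mul1r.
    - by move=> i; rewrite ler_pM2r ?invr_gt0 // h2 // leq_add2l.
    - move=> t t1; have [|i hi] := h3 (t * r) n; first by rewrite ltr_pMl.
      by exists i; rewrite ltr_pdivrMr.
    exists c'; rewrite c'E QoE; split=> // i; rewrite c'i.
    by have [-> /andP[ri re']] := h1 _ (Nni i); rewrite H.
  exists Qi => //; apply: end_image_intro; first by apply: (nsb b'); left.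
  move=> c /chn[N [rho [h1 h2 h3]]]; exists N => n Nn.
  have Nni i : (N <= n + i)%N by rewrite (leq_trans Nn) // leq_addr.
  have rp i : 0 < rho (n + i)%N.
    by have [_ /andP[ri _]] := h1 _ (Nni i); exact: lt_trans ri.
  (* The map reverses annuli here: outer radii decreasing to r give quotients r / rho increasing to
     1. *)
  have [|||c' [c'E c'i]] := @chain_annulus_in b' s k (fun i => r / rho (n + i)%N) s0 k0.
  - move=> i; have [_ /andP[ri _]] := h1 _ (Nni i).
    by rewrite divr_gt0 //= ltr_pdivrMr // mul1r.
  - by move=> i; rewrite ler_pM2l // lef_pV2 ?posrE // h2 // leq_add2l.
  - move=> t t1; have [t0|t0] := leP t 0.
      by exists 0%N; apply: le_lt_trans t0 _; rewrite divr_gt0.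
    have [|i hi] := h3 (r / t) n; first by rewrite ltr_pdivlMr // gtr_pMr.
    by exists i; rewrite ltr_pdivlMr // mulrC -ltr_pdivlMr.
  exists c'; rewrite c'E QiE; split=> // i; rewrite c'i.
  by have [-> /andP[ri re']] := h1 _ (Nni i); rewrite H.
have aa' : abs (a - a') <= r by rewrite absBC.
have [b' [s' [k [e [gi' k0 /andP[e0 er] H]]]]] := gauss_image_left a' nc r0.
have [ss' bb'] := gauss_image_uniq r0 (gauss_image_center r0 aa' gi) gi'; rewrite -ss' in H.
have [Qi [Qo [QiE QoE TQi TQo]]] := mk b' bb'.
have chn (c : chain) : end_chains P c -> exists N rho, [/\
    forall n, (N <= n)%N -> chain_set c n = annulus a' (rho n) r /\ e < rho n < r,
    forall i j, (N <= i)%N -> (i <= j)%N -> rho i <= rho j &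
    forall t n, t < r -> exists i, t < rho (n + i)%N].
  move=> Pc; have cE : chain_union c = oball a' r by rewrite -(end_ballE Pc).
  have [N [rho [h1 h2 h3]]] := chain_oball p_prime r0 cE.
  have [M hM] := h3 _ er; exists (maxn N M), rho; split.
  - move=> n; rewrite geq_max => /andP[Nn Mn]; have [cn /andP[_ rn]] := h1 _ Nn.
    by rewrite /chain_set cE cn oball_diff rn hM.
  - by move=> i j; rewrite geq_max => /andP[Ni _]; exact: h2.
  - move=> t n /h3[M' hM']; exists M'; apply: hM'; exact: leq_addl.
case: H => H.
  exists Qi => //; apply: end_image_intro; first by apply: (nsb b'); left.
  move=> c /chn[N [rho [h1 h2 h3]]]; exists N => n Nn.
  have Nni i : (N <= n + i)%N by rewrite (leq_trans Nn) // leq_addr.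
  have [|||c' [c'E c'i]] := @chain_annulus_in b' s k (fun i => rho (n + i)%N / r) s0 k0.
  - move=> i; have [_ /andP[ri ri']] := h1 _ (Nni i).
    by rewrite divr_gt0 ?(lt_trans e0) //= ltr_pdivrMr // mul1r.
  - by move=> i; rewrite ler_pM2r ?invr_gt0 // h2 // leq_add2l.
  - move=> t t1; have [|i hi] := h3 (t * r) n; first by rewrite gtr_pMl.
    by exists i; rewrite ltr_pdivlMr.
  exists c'; rewrite c'E QiE; split=> // i; rewrite c'i.
  by have [-> /andP[ri re']] := h1 _ (Nni i); rewrite H.
exists Qo => //; apply: end_image_intro; first by apply: (nsb b'); right.
move=> c /chn[N [rho [h1 h2 h3]]]; exists N => n Nn.
have Nni i : (N <= n + i)%N by rewrite (leq_trans Nn) // leq_addr.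
have rp i : 0 < rho (n + i)%N.
  by have [_ /andP[ri _]] := h1 _ (Nni i); exact: lt_trans ri.
have [|||c' [c'E c'i]] := @chain_annulus_out b' s k (fun i => r / rho (n + i)%N) s0 k0.
- move=> i; have [_ /andP[_ ri]] := h1 _ (Nni i).
  by rewrite ltr_pdivlMr // mul1r.
- by move=> i; rewrite ler_pM2l // lef_pV2 ?posrE // h2 // leq_add2l.
- move=> t t1; have t0 : 0 < t by apply: lt_trans t1.
  have [|i hi] := h3 (r / t) n; first by rewrite ltr_pdivrMr // ltr_pMr.
  by exists i; rewrite ltr_pdivrMr // mulrC -ltr_pdivrMr.
exists c'; rewrite c'E QoE; split=> // i; rewrite c'i.
by have [-> /andP[ri re']] := h1 _ (Nni i); rewrite H.
Qed.

Lemma gauss_image_exists f a r : nonconstant f -> value_group r ->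
  exists b s, gauss_image f a r b s /\ value_group s.
Proof.
move=> nc vr; have r0 := value_group_gt0 vr.
have Q0 : shift a (den f) != 0 by rewrite shift_eq0 den_neq0.
have [j [Qj gj _]] := dominates_left Q0 r0.
have [_ bE] := gauss_image_best nc r0 Qj gj.
eexists; eexists; split; first exact: bE.
apply: value_groupM; first by apply: gn_value_group => //; exact: nonconstant_sub.
by apply/value_groupV/gn_value_group => //; exact: den_neq0.
Qed.

End Image.

(** * Distance functions of points and convexity of connected sets *)

Section Delta.
Context {p : nat} {R : realType} {K : padicComplexType p R}.
Local Notation abs := (@Cp_abs p R K).
Local Notation uC := (@Cp_ultra p R K).
Local Notation value_group := (value_group K).
Local Notation chain := (chain K).
Local Notation P1_end := (P1_end K).
Local Notation Hp := (Hp K).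
Implicit Types (r t e : R) (a x y z w : K) (P Q : P1_end) (B : set (P1 K)) (S T U V : Hp)
  (i j k n N M : nat) (c : chain) (u v : nat -> Hp) (d : K -> R).

(* |z - x| at the point zeta_(a, r). *)
Definition zn a r x : R := Num.max (abs (a - x)) r.

Lemma zn_ge a r x : r <= zn a r x.
Proof. by rewrite le_max lexx orbT. Qed.

Lemma zn_trans a r x y : zn a r x <= Num.max (zn a r y) (abs (x - y)).
Proof.
rewrite ge_max; apply/andP; split; last by rewrite !le_max lexx orbT.
apply: (abs_trans (y := y)); first by rewrite !le_max lexx.
by rewrite absBC le_max lexx orbT.
Qed.

Lemma zn_abs a r x y : abs (x - y) <= Num.max (zn a r x) (zn a r y).
Proof.
apply: (abs_trans (y := a)); first by rewrite absBC !le_max lexx.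
by rewrite !le_max lexx !orbT.
Qed.

(** Values stabilise at each x instead of merely converging: along discs with empty intersection x
    is eventually left outside, and its distance to them no longer changes. *)
Definition dlim (b : nat -> K) (s : nat -> R) d :=
  forall x, exists M, forall i, (M <= i)%N -> zn (b i) (s i) x = d x.

Record singular_data c N (b : nat -> K) (rho : nat -> R) : Prop := SingularData {
  sd_oball : forall i, (N <= i)%N -> chain_set c i = oball (b i) (rho i) /\ 0 < rho i;
  sd_lower : exists2 e, 0 < e & forall i, (N <= i)%N -> e <= rho i;
  sd_empty : forall x, exists M, forall i, (M <= i)%N -> ~ chain_set c i (Some x) }.

Lemma chain_set_mono c i j : (i <= j)%N -> chain_set c j `<=` chain_set c i.
Proof. by move=> ij x [h1 h2]; split=> // h3; apply: h2; apply: chain_ball_mono ij _ h3. Qed.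

Hypothesis p_prime : prime p.

Lemma singular_data_exists c : chain_union c = setT -> exists N b rho, singular_data c N b rho.
Proof.
move=> cT.
have [N BN] : exists N, chain_ball c N None by apply: chain_unionP; rewrite cT.
have empty x : exists M, forall i, (M <= i)%N -> ~ chain_set c i (Some x).
  have [M BM] : exists N, chain_ball c N (Some x) by apply: chain_unionP; rewrite cT.
  by exists M => i Mi [_]; apply; apply: chain_ball_mono Mi _ BM.
have ex i : exists bs : K * R, (N <= i)%N -> chain_set c i = oball bs.1 bs.2 /\ 0 < bs.2.
  have [Ni|_] := leqP N i; last by exists (0, 0).
  have Bi := chain_ball_mono Ni BN.
  case: (closed_irr_ballP (chain_closed_or_irr (chainP c) i)) => -[BN' [b [s [s0 BE]]]] //.
  by exists (b, s) => _; rewrite /chain_set cT BE setTD setCK.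
have [bs H] := choice ex.
exists N, (fun i => (bs i).1), (fun i => (bs i).2); split=> //.
(* If the radii were not bounded below, the centres would be Cauchy by nesting, and their limit
   would lie in every disc, against the empty intersection. *)
apply: contrapT => nlow.
have small e : 0 < e -> exists2 i, (N <= i)%N & (bs i).2 < e.
  move=> e0; apply: contrapT => h; apply: nlow; exists e => // i Ni.
  by rewrite leNgt; apply/negP => h'; apply: h; exists i.
have inb i j : (N <= i)%N -> (i <= j)%N -> abs ((bs j).1 - (bs i).1) < (bs i).2.
  move=> Ni ij; have [Ei i0] := H i Ni; have [Ej j0] := H j (leq_trans Ni ij).
  apply/oballP; rewrite -Ei; apply: (chain_set_mono ij); rewrite Ej.
  exact: oball_mem.
have [|l lP] := Cp_complete (K := K) (u := fun i => (bs i).1).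
  move=> e e0; have [i Ni ie] := small e e0; exists i => m n im ni.
  apply: (abs_lttrans (y := (bs i).1)); first exact: lt_trans (inb _ _ Ni im) ie.
  rewrite absBC; exact: lt_trans (inb _ _ Ni ni) ie.
have [M hM] := empty l; apply: (hM (maxn N M)); first exact: leq_maxr.
have [Ei i0] := H (maxn N M) (leq_maxl _ _); rewrite Ei; apply/oballP.
have [n hn] := lP _ i0; have := hn (maxn n (maxn N M)) (leq_maxl _ _) => h.
apply: (abs_lttrans (y := (bs (maxn n (maxn N M))).1)); first by rewrite absBC.
by apply: inb; rewrite ?leq_maxl ?leq_maxr.
Qed.

Lemma sd_in c N b rho i j : singular_data c N b rho -> (N <= i)%N -> (i <= j)%N ->
  abs (b j - b i) < rho i /\ rho j <= rho i.
Proof.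
move=> [H _ _] Ni ij; have [Ei i0] := H i Ni; have [Ej j0] := H j (leq_trans Ni ij).
have sub : oball (b j) (rho j) `<=` oball (b i) (rho i).
  by rewrite -Ei -Ej; exact: chain_set_mono.
by have [h1 h2] := oball_sub_radius p_prime j0 sub.
Qed.

Lemma sd_far c N b rho i x : singular_data c N b rho -> (N <= i)%N -> ~ chain_set c i (Some x) ->
  rho i <= abs (b i - x) /\ forall j, (i <= j)%N -> zn (b j) (rho j) x = abs (b i - x).
Proof.
move=> sd Ni nx; have [Ei i0] := sd_oball sd Ni.
have xi : rho i <= abs (b i - x).
  by rewrite leNgt; apply/negP => h; apply: nx; rewrite Ei; apply/oballP; rewrite absBC.
split=> // j ij; have [h1 h2] := sd_in sd Ni ij.
have -> : zn (b j) (rho j) x = Num.max (abs (x - b i)) (rho j).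
  rewrite /zn (absBC _ x) (abs_dom (y := b i)) // absBC (absBC x).
  exact: lt_le_trans h1 xi.
by rewrite max_l absBC // (le_trans h2).
Qed.

Lemma sd_dlim c N b rho : singular_data c N b rho -> exists d, dlim b rho d.
Proof.
move=> sd.
have ex x : exists r, exists M, forall i, (M <= i)%N -> zn (b i) (rho i) x = r.
  have [M hM] := sd_empty sd x.
  exists (abs (b (maxn N M) - x)), (maxn N M) => i.
  by have [_] := sd_far sd (leq_maxl N M) (hM _ (leq_maxr N M)); apply.
by have [d dP] := choice ex; exists d.
Qed.

(** Equivalent chains have nested discs, and a point outside the larger disc is equally far from
    both centres. *)
Lemma sd_equiv c N b rho d c' N' b' rho' d' : singular_data c N b rho ->
  singular_data c' N' b' rho' -> dlim b rho d -> dlim b' rho' d' ->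
  chain_union c = setT -> chain_union c' = setT -> chain_equiv c c' -> d = d'.
Proof.
move=> sd sd' dl dl' cT c'T cc'; apply/funext => x.
have [M1 h1] := sd_empty sd x; have [M1' h1'] := sd_empty sd' x.
have [M2 h2] := dl x; have [M2' h2'] := dl' x.
pose n := maxn (maxn N N') (maxn (maxn M1 M1') (maxn M2 M2')).
have [n1 n2 n3 n4] : [/\ N <= n, N' <= n, M1 <= n & M1' <= n]%N by rewrite /n; split; lia.
have [n5 n6] : (M2 <= n /\ M2' <= n)%N by rewrite /n; split; lia.
have [m [nm sub _]] := cc' n.
have {}sub : chain_set c' m `<=` chain_set c n.
  by rewrite /chain_set cT c'T !setTD => y h1y h2y; apply/h1y/sub.
have [xn hn] := sd_far sd n1 (h1 _ n3).
rewrite -(h2 _ n5) (hn _ (leqnn n)).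
rewrite -(h2' m (leq_trans n6 nm)).
have [_ hm] := sd_far sd' (leq_trans n2 nm) (h1' _ (leq_trans n4 nm)).
rewrite (hm _ (leqnn m)).
have [Em m0] := sd_oball sd' (leq_trans n2 nm); have [En _] := sd_oball sd n1.
have /oballP bm : oball (b n) (rho n) (Some (b' m)).
  by rewrite -En; apply: sub; rewrite Em; exact: oball_mem.
rewrite (absBC (b n)) (absBC (b' m)); apply/esym/abs_dom; rewrite absBC.
by apply: lt_le_trans bm _; rewrite (absBC x).
Qed.

Definition has_delta S d :=
  (exists a r, is_zeta a r S /\ d = zn a r) \/
  (exists P c N b rho, [/\ singular_end P, Hp_ends S = [set P], end_chains P c,
     singular_data c N b rho & dlim b rho d]).

Lemma is_zeta_inj a r b s S : is_zeta a r S -> is_zeta b s S -> r = s /\ abs (a - b) <= r.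
Proof.
move=> h h'; have [r0 _] := h; have [s0 _] := h'.
have /(is_zeta_associated p_prime _ h).2/(is_zeta_associated p_prime _ h').1 : dirs a r (~` cball a r) by left.
case=> [/(congr1 setC)|[x _ E]].
  by rewrite !setCK => /(cball_inj p_prime r0 s0).
by case: (@oball_None _ _ _ x s); rewrite -E => /cball_None.
Qed.

Lemma zn_inj a r b s S : is_zeta a r S -> is_zeta b s S -> zn a r = zn b s.
Proof.
move=> h h'; have [<- ab] := is_zeta_inj h h'; apply/funext => x.
apply/eqP; rewrite eq_le !ge_max !zn_ge !andbT; apply/andP; split.
  apply: (abs_trans (y := b)); first by apply: le_trans ab (zn_ge _ _ _).
  by rewrite le_max lexx.
apply: (abs_trans (y := a)); first by rewrite absBC; apply: le_trans ab (zn_ge _ _ _).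
by rewrite le_max lexx.
Qed.

Lemma sing_not_HpR S P : singular_end P -> Hp_ends S = [set P] -> ~ HpR S.
Proof. by move=> h1 h2; apply; exists P. Qed.

Lemma singular_chainT P c : singular_end P -> end_chains P c -> chain_union c = setT.
Proof. by move=> sP Pc; rewrite -(end_ballE Pc). Qed.

Lemma has_delta_exists S : exists d, has_delta S d.
Proof.
have [[P sP SE]|nS] := pselect (singular_point S); last first.
  have [a [r h]] := HpR_zeta p_prime nS.
  by exists (zn a r); left; exists a, r.
have [c Pc] := end_chainP P.
have [N [b [rho sd]]] := singular_data_exists (singular_chainT sP Pc).
have [d dl] := sd_dlim sd.
by exists d; right; exists P, c, N, b, rho.
Qed.

Lemma has_delta_uniq S d d' : has_delta S d -> has_delta S d' -> d = d'.
Proof.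
case=> [[a [r [h ->]]]|[P [c [N [b [rho [sP SE Pc sd dl]]]]]]].
  case=> [[b [s [h' ->]]]|[P [c [N [b [rho [sP SE _ _ _]]]]]]].
    exact: zn_inj h h'.
  by case: (sing_not_HpR sP SE); exact: is_zeta_HpR h.
case=> [[a [s [h' _]]]|[P' [c' [N' [b' [rho' [sP' SE' Pc' sd' dl']]]]]]].
  by case: (sing_not_HpR sP SE); exact: is_zeta_HpR h'.
have PP' : P = P' by have : [set P] P by []; rewrite -SE SE'.
rewrite -PP' in Pc'.
apply: sd_equiv sd sd' dl dl' _ _ _; try exact: singular_chainT sP _.
by apply/(end_chainE Pc).
Qed.

Lemma associated_oball_zeta S b s : 0 < s -> HpR S -> associated_ball S (oball b s) -> is_zeta b s S.
Proof.
move=> s0 /(HpR_zeta p_prime)[a [r h]]; have [r0 _] := h.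
move=> /(is_zeta_associated p_prime _ h).1 [E|[x xa E]].
  by case: (@oball_None _ _ _ b s); rewrite E; exact: cball_None.
have [sr bx] := oball_inj p_prime s0 r0 E; rewrite sr.
apply: is_zeta_center h; rewrite absBC; apply: abs_trans xa; rewrite -sr; exact: ltW.
Qed.

Lemma approximates_dlim u S d : has_delta S d -> approximates u S ->
  exists N b s, (forall i, (N <= i)%N -> is_zeta (b i) (s i) (u i)) /\ dlim b s d.
Proof.
move=> hd [[nS uS]|[P [c [sP SE Pc hu]]]].
  case: hd => [[a [r [h ->]]]|[P [c [N [b [rho [sP SE _ _ _]]]]]]].
    exists 0%N, (fun=> a), (fun=> r); split=> [i _|x]; first by rewrite uS.
    by exists 0%N.
  by case: (sing_not_HpR sP SE).
have [N [b [rho sd]]] := singular_data_exists (singular_chainT sP Pc).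
have [d' dl] := sd_dlim sd.
have <- : d' = d by apply: (has_delta_uniq _ hd); right; exists P, c, N, b, rho.
exists N, b, rho; split=> // i Ni; have [Ei i0] := sd_oball sd Ni.
have [hR ha] := hu i; apply: associated_oball_zeta => //; by rewrite -Ei.
Qed.

(** [approximates] constrains every index, whereas only a tail of a chain is known to have discs as
    complements. *)
Lemma is_chain_shift c N : is_chain (chain_union c) (fun i => chain_ball c (N + i)%N).
Proof.
split=> [i|i||| i].
- exact: chain_closed_or_irr (chainP c) _.
- by rewrite addnS; exact: chain_increasing (chainP c) _.
- apply/seteqP; split=> [x /chain_unionP[i xi]|x [i _]]; last exact: chain_ball_sub.
  by exists i => //; apply: chain_ball_mono xi; exact: leq_addl.
- exact: chain_union_kind (chainP c).
- exact: chain_neq (chainP c) _.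
Qed.

Lemma chain_shift_equiv c N : chain_equiv c (Chain (is_chain_shift c N)).
Proof.
move=> n; exists (N + n)%N; split; first exact: leq_addl.
  by apply: chain_ball_mono; rewrite /=; lia.
by apply: chain_ball_mono => /=; lia.
Qed.

(** Nested discs with radii bounded below are what makes the distances along the sequences converge
    in [dist_attained]. *)
Lemma approximates_exists S : exists u b s, [/\ approximates u S,
  forall i, is_zeta (b i) (s i) (u i),
  forall i, abs (b i.+1 - b i) <= s i /\ s i.+1 <= s i &
  exists2 e, 0 < e & forall i, e <= s i].
Proof.
have [[P sP SE]|nS] := pselect (singular_point S); last first.
  have [a [r h]] := HpR_zeta p_prime nS; have [r0 _] := h.
  exists (fun=> S), (fun=> a), (fun=> r); split=> //; first by left.
    by move=> i; rewrite subrr abs0 ltW.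
  by exists r.
have [c Pc] := end_chainP P.
have [N [b [rho sd]]] := singular_data_exists (singular_chainT sP Pc).
have ex i : exists U, is_zeta (b (N + i)%N) (rho (N + i)%N) U.
  have [_ i0] := sd_oball sd (leq_addr i N).
  by have [U [h _]] := is_zeta_exists p_prime (b (N + i)%N) i0; exists U.
have [u hu] := choice ex.
exists u, (fun i => b (N + i)%N), (fun i => rho (N + i)%N); split=> //.
- right; exists P, (Chain (is_chain_shift c N)); split=> //.
    exact/(end_chainE Pc)/chain_shift_equiv.
  move=> i; split; first exact: is_zeta_HpR (hu i).
  apply/(is_zeta_associated p_prime _ (hu i)).
  have [Ei i0] := sd_oball sd (leq_addr i N).
  rewrite /chain_set /= -/(chain_set c (N + i)) Ei; right.
  by exists (b (N + i)%N); rewrite // subrr abs0 ltW.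
- move=> i; rewrite addnS; have [h1 h2] := sd_in sd (leq_addr i N) (leqnSn (N + i)).
  by split=> //; exact: ltW.
- have [e e0 he] := sd_lower sd; exists e => // i; apply: he; exact: leq_addr.
Qed.

(** * The distance in coordinates *)

Lemma finite_part_zeta a r S : is_zeta a r S -> finite_part S = cball a r.
Proof.
move=> h; have [r0 _] := h; rewrite /finite_part -[RHS]setCK; congr (~` _).
apply/seteqP; split=> [x [B [/(is_zeta_associated p_prime _ h)[->//|[b _ ->]]]]|x xa].
  by move/oball_None.
exists (~` cball a r) => //; split; last exact: cball_None.
by apply/(is_zeta_associated p_prime _ h); left.
Qed.

Lemma diamE (D : set (P1 K)) m :
  (forall x y, D (Some x) -> D (Some y) -> abs (x - y) <= m) ->
  (forall t, 0 <= t -> t < m -> exists x y, [/\ D (Some x), D (Some y) & t < abs (x - y)]) ->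
  (exists x, D (Some x)) -> diam D = m.
Proof.
move=> ub appr [x0 Dx0]; rewrite /diam; set E := [set r | _].
have E0 : E 0 by exists x0, x0; rewrite subrr abs0.
have Eub : ubound E m by move=> _ [x [y [Dx Dy ->]]]; exact: ub.
apply/eqP; rewrite eq_le; apply/andP; split.
  by apply: ge_sup => //; exists 0.
rewrite leNgt; apply/negP => sm.
have s0 : 0 <= sup E by apply: sup_upper_bound => //; split; [exists 0|exists m].
have [x [y [Dx Dy xy]]] := appr _ s0 sm.
have : abs (x - y) <= sup E.
  by apply: sup_upper_bound; [split; [exists 0|exists m]|exists x, y].
by rewrite leNgt xy.
Qed.

Lemma diam_cball a r : 0 < r -> diam (cball a r) = r.
Proof.
move=> r0; apply: diamE => [x y /cballP xa /cballP ya|t t0 tr|].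
- by apply: abs_trans xa _; rewrite absBC.
- have [z [z1 z2]] := between_pt p_prime a t0 tr.
  by exists z, a; split=> //; [apply/cballP/ltW|exact: cball_mem (ltW r0)].
- by exists a; exact: cball_mem (ltW r0).
Qed.

(** The radius of the smallest disc containing both discs, that is, of the point where the paths to
    infinity meet. *)
Definition jrad a r b s : R := Num.max (Num.max r s) (abs (a - b)).

Lemma diam_union a r b s : 0 < r -> 0 < s -> diam (cball a r `|` cball b s) = jrad a r b s.
Proof.
move=> r0 s0; set m := jrad a r b s.
have [rm sm abm] : [/\ r <= m, s <= m & abs (a - b) <= m].
  by rewrite /m /jrad !le_max !lexx !orbT.
have am x : (cball a r `|` cball b s) (Some x) -> abs (x - a) <= m.
  case=> /cballP h; first exact: le_trans rm.
  by apply: (abs_trans (y := b)); [exact: le_trans sm|rewrite absBC].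
apply: diamE => [x y /am xa /am ya|t t0|].
- by apply: abs_trans xa _; rewrite absBC.
- rewrite /m /jrad !lt_max -orbA => /or3P[tr|ts|tab].
  + have [z [z1 z2]] := between_pt p_prime a t0 tr.
    by exists z, a; split=> //; left; [apply/cballP/ltW|exact: cball_mem (ltW r0)].
  + have [z [z1 z2]] := between_pt p_prime b t0 ts.
    by exists z, b; split=> //; right; [apply/cballP/ltW|exact: cball_mem (ltW s0)].
  + exists a, b; split=> //; [left|right]; exact: cball_mem (ltW _).
- by exists a; left; exact: cball_mem (ltW r0).
Qed.

Lemma dist_HpR_zeta a r b s S T : is_zeta a r S -> is_zeta b s T ->
  dist_HpR S T = ln (jrad a r b s ^+ 2 / (r * s)) / ln p%:R.
Proof.
move=> h h'; have [r0 _] := h; have [s0 _] := h'.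
rewrite /dist_HpR /= (finite_part_zeta h) (finite_part_zeta h').
by rewrite diam_union // !diam_cball.
Qed.

Lemma lnp_gt0 : 0 < ln (p%:R : R).
Proof. by rewrite ln_gt0 // ltr1n prime_gt1. Qed.

Lemma jrad_gt0 a r b s : 0 < r -> 0 < jrad a r b s.
Proof. by move=> r0; rewrite !lt_max r0. Qed.

(** With m the joint radius, the left side is at most max(m, zn b s x). As zn b s x >= s, this is at
    most zn b s x * (m / s), and m / r >= 1. *)
Lemma zn_jrad a r b s x : 0 < r -> 0 < s ->
  zn a r x <= zn b s x * (jrad a r b s ^+ 2 / (r * s)).
Proof.
move=> r0 s0; set m := jrad a r b s.
have [rm sm abm] : [/\ r <= m, s <= m & abs (a - b) <= m].
  by rewrite /m /jrad !le_max !lexx !orbT.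
have z0 : 0 < zn b s x by apply: lt_le_trans s0 (zn_ge _ _ _).
have h1 : 1 <= m / r by rewrite ler_pdivlMr // mul1r.
have h2 : 1 <= m / s by rewrite ler_pdivlMr // mul1r.
apply: (@le_trans _ _ (zn b s x * (m / s))); last first.
  rewrite ler_pM2l //; have -> : m ^+ 2 / (r * s) = m / r * (m / s) by field; rewrite !gt_eqF.
  by rewrite ler_peMl // (le_trans _ h2).
apply: (@le_trans _ _ (Num.max m (zn b s x))).
  rewrite ge_max; apply/andP; split; last by rewrite le_max rm.
  apply: (abs_trans (y := b)); first by rewrite le_max abm.
  by rewrite !le_max lexx !orbT.
rewrite ge_max; apply/andP; split; last by rewrite ler_peMr // ltW.
by rewrite mulrC -mulrA ler_peMr ?(le_trans (ltW r0)) // mulrC ler_pdivlMr // mul1r zn_ge.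
Qed.

Lemma jradC a r b s : jrad a r b s = jrad b s a r.
Proof. by rewrite /jrad (maxC r s) absBC. Qed.

(** [get] is meaningful only on a nonempty set. For nested approximations both radii and the joint
    radius decrease to positive limits, and ln is continuous there. *)
Lemma dist_attained S T : exists u v, [/\ approximates u S, approximates v T &
  (fun i => dist_HpR (u i) (v i)) @ \oo --> dist_Hp S T].
Proof.
suff [l hl] : exists l : R, exists u v, [/\ approximates u S, approximates v T &
    (fun i => dist_HpR (u i) (v i)) @ \oo --> l].
  have := @getPex _ [set l : R | exists u v : nat -> Hp, [/\ approximates u S,
    approximates v T & (fun i => dist_HpR (u i) (v i)) @ \oo --> l]].
  by apply; exists l.
have [u [b [s [hu zu nu [e e0 es]]]]] := approximates_exists S.
have [v [b' [s' [hv zv nv [e' e'0 es']]]]] := approximates_exists T.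
pose m i := jrad (b i) (s i) (b' i) (s' i).
have lim (w : nat -> R) e1 : 0 < e1 -> (forall i, w i.+1 <= w i) -> (forall i, e1 <= w i) ->
    exists2 l : R, 0 < l & w @ \oo --> l.
  move=> e10 h1 h2; exists (limn w).
    apply: lt_le_trans e10 _; apply: limr_ge; last by near=> i; exact: h2.
    apply: nonincreasing_is_cvgn; first exact/nonincreasing_seqP.
    by exists e1 => _ [i _ <-].
  apply: nonincreasing_is_cvgn; first exact/nonincreasing_seqP.
  by exists e1 => _ [i _ <-].
have [ls ls0 sl] := lim s e e0 (fun i => (nu i).2) es.
have [ls' ls'0 sl'] := lim s' e' e'0 (fun i => (nv i).2) es'.
have me i : e <= m i by rewrite /m /jrad !le_max es.
have mdec i : m i.+1 <= m i.
  have [n1 n2] := nu i; have [n1' n2'] := nv i.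
  rewrite /m /jrad !ge_max; apply/andP; split.
    by apply/andP; split; rewrite !le_max ?n2 ?n2' ?orbT.
  apply: (abs_trans (y := b i)); first by rewrite !le_max n1.
  apply: (abs_trans (y := b' i)); first by rewrite !le_max lexx !orbT.
  by rewrite absBC !le_max n1' !orbT.
have [lm lm0 ml] := lim m e e0 mdec me.
exists (ln (lm ^+ 2 / (ls * ls')) / ln p%:R), u, v; split=> //.
have -> : (fun i => dist_HpR (u i) (v i)) = (fun i => ln (m i ^+ 2 / (s i * s' i)) / ln p%:R).
  by apply/funext => i; exact: dist_HpR_zeta.
apply: cvgM; last exact: cvg_cst.
apply: (@continuous_cvg _ _ _ _ _ _ (@ln R)).
  by apply: continuous_ln; rewrite divr_gt0 ?exprn_gt0 ?mulr_gt0.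
apply: cvgM; first by rewrite expr2; apply: cvgM.
by apply: cvgV; [rewrite gt_eqF ?mulr_gt0|apply: cvgM].
Unshelve. all: by end_near.
Qed.

Definition delta S : K -> R := sval (cid (has_delta_exists S)).

Lemma deltaP S : has_delta S (delta S).
Proof. by rewrite /delta; case: cid. Qed.

Lemma delta_zeta a r S : is_zeta a r S -> delta S = zn a r.
Proof. by move=> h; apply: has_delta_uniq (deltaP S) _; left; exists a, r. Qed.

Lemma delta_zn S x y : exists a r, [/\ 0 < r, delta S x = zn a r x & delta S y = zn a r y].
Proof.
case: (deltaP S) => [[a [r [[r0 _] ->]]]|[P [c [N [b [rho [sP SE Pc sd dl]]]]]]].
  by exists a, r.
have [M1 h1] := dl x; have [M2 h2] := dl y.
pose n := maxn N (maxn M1 M2).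
have [n1 n2 n3] : [/\ N <= n, M1 <= n & M2 <= n]%N by rewrite /n; split; lia.
exists (b n), (rho n); rewrite h1 // h2 //; split=> //.
by have [] := sd_oball sd n1.
Qed.

Lemma delta_gt0 S x : 0 < delta S x.
Proof. by have [a [r [r0 -> _]]] := delta_zn S x x; apply: lt_le_trans (zn_ge _ _ _). Qed.

Lemma delta_trans S x y : delta S x <= Num.max (delta S y) (abs (x - y)).
Proof. by have [a [r [r0 -> ->]]] := delta_zn S x y; exact: zn_trans. Qed.

Lemma delta_abs S x y : abs (x - y) <= Num.max (delta S x) (delta S y).
Proof. by have [a [r [r0 -> ->]]] := delta_zn S x y; exact: zn_abs. Qed.

(** Along approximating sequences the values at x are eventually those of delta, so the bound for
    zeta points passes to the limit of the distances. *)
Lemma delta_dist S T x :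
  delta S x <= delta T x * expR (dist_Hp S T * ln p%:R) /\
  delta T x <= delta S x * expR (dist_Hp S T * ln p%:R).
Proof.
have [u [v [hu hv hl]]] := dist_attained S T; set l := dist_Hp S T in hl *.
have [N [b [s [zu du]]]] := approximates_dlim (deltaP S) hu.
have [N' [b' [s' [zv dv]]]] := approximates_dlim (deltaP T) hv.
have [M hM] := du x; have [M' hM'] := dv x.
have lp := lnp_gt0; have dS := delta_gt0 S x; have dT := delta_gt0 T x.
pose n0 := maxn (maxn N N') (maxn M M').
have main n : (n0 <= n)%N ->
    ln (delta S x / delta T x) / ln p%:R <= dist_HpR (u n) (v n) /\
    ln (delta T x / delta S x) / ln p%:R <= dist_HpR (u n) (v n).
  move=> n0n; have [n1 n2 n3 n4] : [/\ N <= n, N' <= n, M <= n & M' <= n]%N.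
    by move: n0n; rewrite /n0; split; lia.
  have zn1 := zu n n1; have zn2 := zv n n2; have [s0 _] := zn1; have [s'0 _] := zn2.
  rewrite (dist_HpR_zeta zn1 zn2) -(hM n n3) -(hM' n n4).
  rewrite !ler_pM2r ?invr_gt0 //.
  have j0 := jrad_gt0 (b n) (b' n) (s' n) s0.
  have z1 : 0 < zn (b n) (s n) x by apply: lt_le_trans s0 (zn_ge _ _ _).
  have z2 : 0 < zn (b' n) (s' n) x by apply: lt_le_trans s'0 (zn_ge _ _ _).
  have q0 : 0 < jrad (b n) (s n) (b' n) (s' n) ^+ 2 / (s n * s' n).
    by rewrite divr_gt0 ?exprn_gt0 ?mulr_gt0.
  split; rewrite ler_ln ?posrE ?divr_gt0 ?exprn_gt0 ?mulr_gt0 // ler_pdivrMr // mulrC.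
    exact: zn_jrad.
  by rewrite jradC [s n * _]mulrC; exact: zn_jrad.
have lim A : (forall n, (n0 <= n)%N -> A <= dist_HpR (u n) (v n)) -> A <= l.
  move=> hA; rewrite leNgt; apply/negP => lA.
  have e0 : 0 < A - l by rewrite subr_gt0.
  move/cvgrPdist_lt: hl => hl; have [n1 _ hn] := hl _ e0.
  have := hn (maxn n0 n1) (leq_maxr _ _); have := hA (maxn n0 n1) (leq_maxl _ _).
  by rewrite /= ltr_norml => h1 /andP[h2 h3]; lra.
have fin (y z : R) : 0 < y -> 0 < z -> ln (y / z) / ln p%:R <= l -> y <= z * expR (l * ln p%:R).
  move=> y0 z0 yz; rewrite mulrC -ler_pdivrMr // -[leLHS]lnK ?posrE ?divr_gt0 //.
  by rewrite ler_expR -ler_pdivrMr.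
by split; apply: fin => //; apply: lim => n /main[].
Qed.

Lemma delta_lt_open x r : Hp_open [set S | delta S x < r].
Proof.
move=> S /= Sr; have d0 := delta_gt0 S x; have lp := lnp_gt0; have r0 := lt_trans d0 Sr.
exists (ln (r / delta S x) / ln p%:R).
  by rewrite divr_gt0 // ln_gt0 // ltr_pdivlMr // mul1r.
move=> T /= dl; have h : expR (dist_Hp S T * ln p%:R) < r / delta S x.
  by rewrite -[ltRHS]lnK ?posrE ?divr_gt0 // ltr_expR -ltr_pdivlMr.
have [_ h'] := delta_dist S T x; apply: le_lt_trans h' _.
by rewrite -ltr_pdivlMl // [ltRHS]mulrC.
Qed.

Lemma delta_gt_open x r : 0 < r -> Hp_open [set S | r < delta S x].
Proof.
move=> r0 S /= rS; have d0 := delta_gt0 S x; have lp := lnp_gt0.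
exists (ln (delta S x / r) / ln p%:R).
  by rewrite divr_gt0 // ln_gt0 // ltr_pdivlMr // mul1r.
move=> T /= dl; have h : expR (dist_Hp S T * ln p%:R) < delta S x / r.
  by rewrite -[ltRHS]lnK ?posrE ?divr_gt0 // ltr_expR -ltr_pdivlMr.
have [h' _] := delta_dist S T x; have dT := delta_gt0 T x.
have : delta S x < delta T x * (delta S x / r).
  by apply: le_lt_trans h' _; rewrite ltr_pM2l.
rewrite mulrCA -[X in X < _]mulr1 ltr_pM2l //.
by rewrite ltr_pdivlMr // mul1r.
Qed.

(** At zeta_(a, r) the function delta attains its minimum r; at a singular point no minimum is
    attained. This tells the two kinds of points apart. *)
Lemma singular_no_min S P c N b rho x : singular_end P -> Hp_ends S = [set P] -> end_chains P c ->
  singular_data c N b rho -> (forall i, (N <= i)%N -> delta S (b i) < rho i) /\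
  exists y, delta S y < delta S x.
Proof.
move=> sP SE Pc sd; have [d dl] := sd_dlim sd.
have dE : delta S = d.
  by apply: has_delta_uniq (deltaP S) _; right; exists P, c, N, b, rho.
have small i : (N <= i)%N -> delta S (b i) < rho i.
  move=> Ni; have [M hM] := sd_empty sd (b i); have [M' hM'] := dl (b i).
  pose n := maxn i (maxn M M').
  have [n1 n2 n3] : [/\ i <= n, M <= n & M' <= n]%N by rewrite /n; split; lia.
  have [_ h] := sd_far sd (leq_trans Ni n1) (hM _ n2).
  rewrite dE -(hM' n n3) (h n (leqnn n)).
  by have [] := sd_in sd Ni n1.
split=> //.
have [M hM] := sd_empty sd x; have [M' hM'] := dl x.
pose n := maxn N (maxn M M').
have [n1 n2 n3] : [/\ N <= n, M <= n & M' <= n]%N by rewrite /n; split; lia.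
exists (b n); apply: lt_le_trans (small n n1) _.
have [h1 h2] := sd_far sd n1 (hM _ n2).
by rewrite dE -(hM' n n3) (h2 n (leqnn n)).
Qed.

Lemma zn_eq a r b s : 0 < r -> 0 < s -> zn a r = zn b s -> r = s /\ abs (a - b) <= r.
Proof.
move=> r0 s0 E.
have e1 : r = zn b s a by rewrite -E /zn subrr abs0 max_r // ltW.
have e2 : s = zn a r b by rewrite E /zn subrr abs0 max_r // ltW.
have rs : r = s.
  apply/eqP; rewrite eq_le; apply/andP; split; [rewrite e2|rewrite e1]; exact: zn_ge.
by split=> //; rewrite rs e2 /zn le_max lexx.
Qed.

(** A value of d below rho i at b i means that the discs behind d eventually lie inside the i-th
    disc of the other chain. *)
Lemma singular_sub c c' N b rho N' b' rho' d : chain_union c = setT -> chain_union c' = setT ->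
  singular_data c N b rho -> singular_data c' N' b' rho' -> dlim b' rho' d ->
  (forall i, (N <= i)%N -> d (b i) < rho i) ->
  forall n, exists M, forall m, (M <= m)%N -> chain_ball c n `<=` chain_ball c' m.
Proof.
move=> cT c'T sd sd' dl small n; pose n1 := maxn N n.
have [M hM] := dl (b n1); exists (maxn M N') => m; rewrite geq_max => /andP[Mm N'm].
have := small n1 (leq_maxl _ _); rewrite -(hM m Mm) gt_max => /andP[h1 h2].
have sub : chain_set c' m `<=` chain_set c n1.
  rewrite (sd_oball sd' N'm).1 (sd_oball sd (leq_maxl N n)).1 => _ [z /= zb <-].
  by apply/oballP; apply: abs_lttrans h1; exact: lt_trans h2.
apply: (subset_trans (chain_ball_mono (leq_maxr N n))).
by move: sub; rewrite /chain_set cT c'T !setTD classical_sets.setCS.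
Qed.

Lemma delta_inj S T : delta S = delta T -> S = T.
Proof.
have nsing a r U V : is_zeta a r U -> delta U = delta V -> singular_point V -> False.
  move=> h E [P sP VE]; have [c Pc] := end_chainP P.
  have [N [b [rho sd]]] := singular_data_exists (singular_chainT sP Pc).
  have [_ [y]] := singular_no_min a sP VE Pc sd; rewrite -E (delta_zeta h).
  have [r0 _] := h; rewrite {2}/zn subrr abs0 max_r ?(ltW r0) //.
  by rewrite ltNge zn_ge.
move=> E.
have [[P sP SE]|nS] := pselect (singular_point S); last first.
  have [a [r h]] := HpR_zeta p_prime nS.
  have [sT|nT] := pselect (singular_point T); first by case: (nsing _ _ _ _ h E sT).
  have [b [s h']] := HpR_zeta p_prime nT.
  rewrite (delta_zeta h) (delta_zeta h') in E; have [r0 _] := h; have [s0 _] := h'.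
  have [rs ab] := zn_eq r0 s0 E; rewrite -rs in h'.
  apply: is_zeta_uniq h _; apply: is_zeta_center h'; by rewrite absBC.
have [[P' sP' TE]|nT] := pselect (singular_point T); last first.
  have [b [s h']] := HpR_zeta p_prime nT.
  by case: (nsing _ _ _ S h') => //; exists P.
have [c Pc] := end_chainP P; have [c' Pc'] := end_chainP P'.
have cT := singular_chainT sP Pc; have c'T := singular_chainT sP' Pc'.
have [N [b [rho sd]]] := singular_data_exists cT.
have [N' [b' [rho' sd']]] := singular_data_exists c'T.
have [small _] := singular_no_min 0 sP SE Pc sd.
have [small' _] := singular_no_min 0 sP' TE Pc' sd'.
have [d dl] := sd_dlim sd; have [d' dl'] := sd_dlim sd'.
have dE : delta S = d.
  by apply: has_delta_uniq (deltaP S) _; right; exists P, c, N, b, rho.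
have dE' : delta T = d'.
  by apply: has_delta_uniq (deltaP T) _; right; exists P', c', N', b', rho'.
rewrite E dE' in small; rewrite -E dE in small'.
apply: Hp_eq; rewrite SE TE; congr [set _]; apply: (end_eq Pc Pc') => n.
have [M hM] := singular_sub cT c'T sd sd' dl' small n.
have [M' hM'] := singular_sub c'T cT sd' sd dl small' n.
exists (maxn n (maxn M M')); split; first exact: leq_maxl.
  by apply: hM; lia.
by apply: hM'; lia.
Qed.

Lemma delta_zeta_char a r V U : is_zeta a r U -> delta V a = r -> (forall x, r <= delta V x) -> V = U.
Proof.
move=> h Va ge; apply: delta_inj; rewrite (delta_zeta h); apply/funext => x.
have := delta_trans V x a; have := delta_abs V a x; rewrite Va /zn (absBC x).
have := ge x; have [ar|ra] := leP (abs (a - x)) r.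
  by move=> h1 _ h2; apply/eqP; rewrite eq_le h2 h1.
rewrite le_max => _ /orP[|h1]; first by rewrite leNgt ra.
by move=> h2; apply/eqP; rewrite eq_le h2 h1.
Qed.

Lemma connected_convex (X : set Hp) S T U a r : connected X -> X S -> X T ->
  is_zeta a r U -> delta S a < r -> r <= delta T a -> X U.
Proof.
move=> cX XS XT h Sr rT; have [r0 _] := h; apply: contrapT => nXU.
pose B := X `&` [set V | delta V a < r].
(* O covers every point other than U with delta(a) >= r. If delta(a) = r without minimum there, some
   x has delta(x) < r, and x is at distance at least r from a. So B is relatively closed as well as
   open in X. *)
pose O := [set V | r < delta V a] `|` [set V | exists2 b, r <= abs (b - a) & delta V b < r].
have oO : Hp_open O.
  move=> V [/(delta_gt_open r0)[e e0 he]|[b ba /(delta_lt_open)[e e0 he]]].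
    by exists e => // W /he; left.
  by exists e => // W /he hW; right; exists b.
suff BX : B = X by move: XT; rewrite -BX => -[_ /=]; rewrite ltNge rT.
apply: cX.
- by exists S.
- by exists [set V | delta V a < r] => //; exact: delta_lt_open.
exists (~` O); first by apply: open_closedC; exact: oO.
apply/seteqP; split=> V [XV hV]; split=> //.
  move=> [|[b ba Vb]] /=; first by rewrite ltNge (ltW hV).
  have := delta_abs V b a; rewrite leNgt => /negP; apply.
  by rewrite gt_max !(lt_le_trans _ ba).
rewrite /= ltNge; apply/negP => rV; apply: nXU.
suff <- : V = U by [].
have Va : delta V a = r.
  apply/eqP; rewrite eq_le rV andbT leNgt; apply/negP => rV'; apply: hV; by left.
apply: (delta_zeta_char h Va) => x; rewrite leNgt; apply/negP => xr.
have [ax|xa] := leP r (abs (x - a)); first by apply: hV; right; exists x.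
have := delta_trans V a x; rewrite Va leNgt => /negP; apply.
by rewrite gt_max xr absBC.
Qed.

End Delta.

(** * Descent along a ray *)

Lemma horner_gt0_near (R : realType) (q : {poly R}) (r : R) : 0 < q.[r] ->
  exists2 e, 0 < e & forall t, r - e < t -> t < r + e -> 0 < q.[t].
Proof.
move=> q0; have /(cvgr_gt _)/(_ 0 q0) : q.[t] @[t --> r] --> q.[r].
  exact: derive.continuous_horner.
case/nbhs_ballP => e /= e0 h; exists e => // t h1 h2.
by apply: h; rewrite /ball /= ltr_norml; apply/andP; split; lra.
Qed.

Section Descent.
Context {R : realType} (V : set R) (Y : R -> Prop) (g : R -> R).

(** Two natural exponents encode a monomial whose exponent i - j may be negative. The formula
    includes t = r, so that it can be evaluated at a fixed radius. *)
Definition monomial_left r := exists C i j e, [/\ V C, 0 <= e, e < r &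
  forall t, e < t -> t <= r -> g t * t ^+ j = C * t ^+ i].
Definition monomial_right r := exists C i j e, [/\ V C, r < e &
  forall t, r <= t -> t < e -> g t * t ^+ j = C * t ^+ i].

Hypothesis V_gt0 : forall r, V r -> 0 < r.
Hypothesis V_dense : forall x y, 0 <= x -> x < y -> exists r, [/\ V r, x < r & r < y].
Hypothesis V_root : forall r n, (0 < n)%N -> 0 <= r -> V (r ^+ n) -> V r.
Hypothesis g_left : forall r, 0 < r -> monomial_left r.
Hypothesis g_right : forall r, 0 < r -> monomial_right r.

Lemma right_lt r : 0 < r -> g r < r -> exists2 e, r < e & forall t, r <= t -> t < e -> g t < r.
Proof.
move=> r0 gr; have [C [i [j [e [vC re hg]]]]] := g_right r0.
(* Multiplying by t ^ j turns g t < r into positivity of a polynomial, which persists near r. *)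
pose q : {poly R} := r *: 'X^j - C *: 'X^i.
have qE t : q.[t] = r * t ^+ j - C * t ^+ i by rewrite !hornerE.
have q0 : 0 < q.[r] by rewrite qE -hg // subr_gt0 ltr_pM2r ?exprn_gt0.
have [d d0 hd] := horner_gt0_near q0.
exists (Num.min e (r + d)); first by rewrite lt_min re ltrDl.
move=> t rt; rewrite lt_min => /andP[te td].
have t0 : 0 < t by exact: lt_le_trans rt.
rewrite -(ltr_pM2r (exprn_gt0 j t0)) hg // -subr_gt0 -qE; apply: hd => //.
by apply: lt_le_trans rt; rewrite ltrBlDr ltrDl.
Qed.

Lemma right_gt r : 0 < r -> r < g r -> exists2 e, r < e & forall t, r <= t -> t < e -> t < g t.
Proof.
move=> r0 gr; have [C [i [j [e [vC re hg]]]]] := g_right r0.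
pose q : {poly R} := C *: 'X^i - 'X^(j.+1).
have qE t : q.[t] = C * t ^+ i - t * t ^+ j by rewrite !hornerE exprS.
have q0 : 0 < q.[r] by rewrite qE -hg // subr_gt0 ltr_pM2r ?exprn_gt0.
have [d d0 hd] := horner_gt0_near q0.
exists (Num.min e (r + d)); first by rewrite lt_min re ltrDl.
move=> t rt; rewrite lt_min => /andP[te td].
have t0 : 0 < t by exact: lt_le_trans rt.
rewrite -(ltr_pM2r (exprn_gt0 j t0)) hg // -subr_gt0 -qE; apply: hd => //.
by apply: lt_le_trans rt; rewrite ltrBlDr ltrDl.
Qed.

Lemma left_lt r : 0 < r -> g r < r ->
  exists e, [/\ 0 <= e, e < r & forall t, e < t -> t <= r -> g t < t].
Proof.
move=> r0 gr; have [C [i [j [e [vC e0 er hg]]]]] := g_left r0.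
pose q : {poly R} := 'X^(j.+1) - C *: 'X^i.
have qE t : q.[t] = t * t ^+ j - C * t ^+ i by rewrite !hornerE exprS.
have q0 : 0 < q.[r] by rewrite qE -hg // subr_gt0 ltr_pM2r ?exprn_gt0.
have [d d0 hd] := horner_gt0_near q0.
exists (Num.max e (r - d)); split; first by rewrite le_max e0.
  by rewrite gt_max er ltrBlDr ltrDl.
move=> t; rewrite gt_max => /andP[et dt] tr.
have t0 : 0 < t by exact: le_lt_trans et.
rewrite -(ltr_pM2r (exprn_gt0 j t0)) hg // -subr_gt0 -qE; apply: hd => //.
by apply: le_lt_trans tr _; rewrite ltrDl.
Qed.

(* Right of the largest fixed radius r below r0 the exponent of g is not
   positive, since g t < t there; hence g is at most r and r is in V. *)
Lemma right_fixed r r1 : 0 < r -> r < r1 -> r <= g r ->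
  (forall t, r < t -> t < r1 -> g t < t) ->
  [/\ g r = r, V r & exists2 e, r < e & forall t, r < t -> t < e -> g t <= r].
Proof.
move=> r0 r01 gr lt1.
have grE : g r = r.
  apply/eqP; rewrite eq_le gr andbT leNgt; apply/negP => /(right_gt r0)[e re he].
  have m : r < Num.min e r1 by rewrite lt_min re.
  have [t [_ rt]] := V_dense (ltW r0) m; rewrite lt_min => /andP[te tr1].
  have := lt_trans (lt1 _ rt tr1) (he _ (ltW rt) te); by rewrite ltxx.
have [C [i [j [e [vC re hg]]]]] := g_right r0.
have C0 := V_gt0 vC.
have m : r < Num.min e r1 by rewrite lt_min re.
have [t1 [_ rt1]] := V_dense (ltW r0) m; rewrite lt_min => /andP[te1 tr1].
have hr := hg r (lexx r) re; rewrite grE in hr.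
(* Otherwise g t / t = C t ^ (i - j - 1) would be nondecreasing, while it equals 1 at r and is below
   1 to the right. *)
have ij : (i <= j)%N.
  rewrite leqNgt; apply/negP => ji.
  have t0 := lt_trans r0 rt1.
  have := lt1 _ rt1 tr1; rewrite -(ltr_pM2r (exprn_gt0 j t0)) hg ?(ltW rt1) //.
  rewrite -{1}(subnK ji) addnS exprS exprD => h.
  have h2 : C * t1 ^+ (i - j.+1) < 1.
    have D0 : 0 < t1 * t1 ^+ j by rewrite mulr_gt0 ?exprn_gt0.
    rewrite -(ltr_pM2r D0) mul1r; apply: le_lt_trans h.
    by rewrite le_eqVlt; apply/orP; left; apply/eqP; ring.
  have h3 : C * r ^+ (i - j.+1) = 1.
    have D0 : 0 < r * r ^+ j by rewrite mulr_gt0 ?exprn_gt0.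
    apply: (mulIf (lt0r_neq0 D0)); rewrite mul1r [RHS]hr -[in RHS](subnK ji) addnS exprS exprD; ring.
  move: h2; rewrite -h3 ltr_pM2l // ltNge => /negP; apply.
  by rewrite lerXn2r ?nnegrE ?(ltW r0) ?(ltW t0) ?(ltW rt1).
(* This is the equation g r = r; it makes r a root of an element of V. *)
have CE : r ^+ (j - i).+1 = C.
  apply: (mulIf (expf_neq0 i (lt0r_neq0 r0))).
  by rewrite -hr exprS -mulrA -exprD subnK.
split=> //; first by apply: (@V_root _ (j - i).+1); rewrite ?(ltW r0) // CE.
exists e => // t rt te; have t0 := lt_trans r0 rt.
rewrite -(ler_pM2r (exprn_gt0 j t0)) hg ?(ltW rt) //.
have -> : t ^+ j = t ^+ (j - i) * t ^+ i by rewrite -exprD subnK.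
rewrite mulrA ler_pM2r ?exprn_gt0 // -CE exprS ler_pM2l //.
by rewrite lerXn2r ?nnegrE ?(ltW r0) ?(ltW t0) ?(ltW rt).
Qed.

(** With Y t meaning that X contains the ray point of radius t, this is convexity between that point
    and its image. *)
Hypothesis Y_step : forall t t', V t -> Y t -> g t < t' -> t' <= t -> Y t'.

Lemma descent r0 : V r0 -> Y r0 -> g r0 < r0 ->
  (forall t, 0 < t -> t <= r0 -> Y t /\ g t < t) \/
  (exists r t, [/\ V r /\ g r = r, 0 < r /\ r < t, V t /\ t <= r0, Y t & g t <= r]).
Proof.
move=> vr0 Yr0 gr0; have r0_gt0 := V_gt0 vr0.
(* F collects the radii down to which the descent succeeds without a gap; its infimum is either 0 or
   the turning radius. *)
pose F := [set t | [/\ 0 < t, t <= r0 & forall u, t <= u -> u <= r0 -> Y u /\ g u < u]].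
have Fr0 : F r0.
  by split=> // u h1 h2; have <- : r0 = u by apply/eqP; rewrite eq_le h1 h2.
have hF : has_inf F by split; [exists r0|exists 0 => t [/ltW]].
pose r := inf F.
have r_ge0 : 0 <= r by apply: lb_le_inf => [|t [/ltW]] //; exists r0.
have rr0 : r <= r0 by apply: ge_inf => //; exact: hF.2.
have above t : r < t -> t <= r0 -> Y t /\ g t < t.
  move=> rt tr0; have e0 : 0 < t - r by rewrite subr_gt0.
  have [u [_ _ hu] ut] := inf_adherent e0 hF.
  by apply: hu => //; move: ut; rewrite -/r addrC subrK => /ltW.
have [r_gt0|r0E] := ltP 0 r; last first.
  by left=> t t0 tr0; apply: above => //; exact: le_lt_trans t0.
have [gr|gr] := ltP (g r) r.
  (* If g r < r, a radius t in V at or just right of r has g t < r, so [Y_step] reaches below r; as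
     g u < u also persists there, F would go below its infimum. *)
  exfalso.
  have [e re he] := right_lt r_gt0 gr.
  have [t [vt Yt rt tr0 te]] : exists t, [/\ V t, Y t, r <= t, t <= r0 & t < e].
    have [r0r|rr0'] := leP r0 r.
      have E : r = r0 by apply/eqP; rewrite eq_le rr0.
      by exists r0; split=> //; rewrite -[X in X < _]E.
    have m : r < Num.min e r0 by rewrite lt_min re.
    have [t [vt rt]] := V_dense r_ge0 m; rewrite lt_min => /andP[te tr0].
    by exists t; split=> //; [have [] := above t rt (ltW tr0)|exact: ltW|exact: ltW].
  have gt := he t rt te.
  have [e1 [e10 e1r he1]] := left_lt r_gt0 gr.
  have m : Num.max e1 (g t) < r by rewrite gt_max e1r.
  have m0 : 0 <= Num.max e1 (g t) by rewrite le_max e10.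
  have [u [vu mu ur]] := V_dense m0 m.
  move: mu; rewrite gt_max => /andP[e1u gu].
  have Fu : F u.
    split; [exact: V_gt0|exact/ltW/(lt_le_trans ur)|].
    move=> w uw wr0; have [wr|rw] := leP w r; last exact: above.
    split; last by apply: he1 => //; exact: lt_le_trans uw.
    apply: (Y_step vt Yt); first exact: lt_le_trans uw.
    exact: le_trans rt.
  have : r <= u by apply: ge_inf => //; exact: hF.2.
  by rewrite leNgt ur.
right; have rr0' : r < r0.
  by rewrite lt_neqAle rr0 andbT; apply: contraTneq gr => ->; rewrite -ltNge.
have [grE vr [e re he]] := right_fixed r_gt0 rr0' gr (fun t h1 h2 => (above t h1 (ltW h2)).2).
have m : r < Num.min e r0 by rewrite lt_min re.
have [t [vt rt]] := V_dense r_ge0 m; rewrite lt_min => /andP[te tr0].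
exists r, t; split=> //; first by split=> //; exact: ltW.
  by have [] := above t rt (ltW tr0).
exact: he.
Qed.

End Descent.

(** * The alternative *)

Section HalfGeodesic.
Context {p : nat} {R : realType} {K : padicComplexType p R}.
Local Notation abs := (@Cp_abs p R K).
Local Notation uC := (@Cp_ultra p R K).
Local Notation value_group := (value_group K).
Local Notation Hp := (Hp K).
Implicit Types (r s t e : R) (a b x y z w : K) (B : set (P1 K)) (S T : Hp).

Lemma dirs_disj a r B B' (x : P1 K) : dirs a r B -> dirs a r B' -> B x -> B' x -> B = B'.
Proof.
move=> [->|[b ba ->]] [->|[b' b'a ->]] //.
- by case: x => [x|_ /oball_None//] xa /oballP xb; case: xa; apply/cballP; apply: abs_trans b'a; exact: ltW.
- by case: x => [x|/oball_None//] /oballP xb []; apply/cballP; apply: abs_trans ba; exact: ltW.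
- case: x => [x|/oball_None//] /oballP xb /oballP xb'; apply: oball_center.
  by apply: (abs_lttrans (y := x)); rewrite // absBC.
Qed.

Hypothesis p_prime : prime p.

Lemma dirs_not_separates a r B T (Y : set (P1 K)) : is_zeta a r T -> dirs a r B -> Y `<=` B ->
  ~ separates T Y.
Proof.
move=> h dB sub [B1 [B2 [/(is_zeta_associated p_prime _ h) d1 /(is_zeta_associated p_prime _ h) d2 neq
  [x [Yx B1x]] [y [Yy B2y]]]]].
apply: neq; rewrite (dirs_disj d1 dB B1x (sub _ Yx)).
by rewrite (dirs_disj d2 dB B2y (sub _ Yy)).
Qed.

(** T is some zeta_(b, s). If its closed disc misses z, one of the two sets lies entirely in the
    direction of infinity at T; if it contains z and s >= r, the first set lies in the direction of
    z. *)
Lemma separates_fin z r T : HpR T -> separates T (oball z r `\ Some z) ->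
  separates T (~` (oball z r `\ Some z)) -> exists2 t, 0 < t < r & is_zeta z t T.
Proof.
move=> /(HpR_zeta p_prime)[b [s h]] sep1 sep2; have [s0 _] := h.
have [zb|bz] := leP (abs (z - b)) s.
  have {h}h : is_zeta z s T by apply: is_zeta_center h; rewrite absBC.
  exists s => //; rewrite s0 ltNge; apply/negP => rs.
  apply: (dirs_not_separates h _ _ sep1); first by right; exists z; rewrite ?subrr ?abs0 ?(ltW s0).
  by move=> _ [[x /= xz <-] _]; apply/oballP; exact: lt_le_trans rs.
exfalso; have [zbr|rzb] := ltP (abs (z - b)) r.
  apply: (dirs_not_separates h _ _ sep2); first by left.
  move=> x nx xb; apply: nx; case: xb => y /= yb <-; split.
    by apply/oballP; apply: (abs_lttrans (y := b)); [exact: le_lt_trans yb (lt_trans bz zbr)|rewrite absBC].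
  by move=> [yz]; move: bz; rewrite -yz ltNge yb.
apply: (dirs_not_separates h _ _ sep1); first by left.
move=> _ [[x /= xz <-] _] /cballP xb.
have : abs (z - b) < abs (z - b); last by rewrite ltxx.
apply: (abs_lttrans (y := x)); first by rewrite absBC; exact: lt_le_trans rzb.
exact: le_lt_trans bz.
Qed.

Lemma separates_inf a r T : 0 < r -> HpR T -> separates T (~` cball a r `\ None) ->
  separates T (~` (~` cball a r `\ None)) -> exists2 t, r < t & is_zeta a t T.
Proof.
move=> r0 /(HpR_zeta p_prime)[b [s h]] sep1 sep2; have [s0 _] := h.
have [ab|ba] := leP (abs (a - b)) s.
  have {h}h : is_zeta a s T by apply: is_zeta_center h; rewrite absBC.
  exists s => //; rewrite ltNge; apply/negP => sr.
  apply: (dirs_not_separates h _ _ sep1); first by left.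
  by move=> x [xa _] xs; apply: xa; case: xs => y /= ys <-; apply/cballP; exact: le_trans sr.
exfalso; have [abr|rab] := leP (abs (a - b)) r.
  apply: (dirs_not_separates h _ _ sep1); first by left.
  move=> x [xa _] [y /= yb xE]; apply: xa; rewrite -xE; apply/cballP.
  by apply: (abs_trans (y := b)); [exact: le_trans yb (le_trans (ltW ba) abr)|rewrite absBC].
apply: (dirs_not_separates h _ _ sep2); first by left.
move=> x nx [y /= yb xE]; apply: nx; rewrite -xE; split=> // /cballP ya.
have : abs (a - b) < abs (a - b); last by rewrite ltxx.
apply: (abs_lttrans (y := y)); first by rewrite absBC; exact: le_lt_trans rab.
exact: le_lt_trans ba.
Qed.

Lemma half_geodesic_fin (X : set Hp) z r : 0 < r ->
  (forall t, 0 < t -> t <= r -> exists2 U, is_zeta z t U & X U) ->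
  exists (S : Hp) (G : set Hp), half_geodesic (Some z) S G /\ G `<=` X.
Proof.
move=> r0 hX; have [S [h _]] := is_zeta_exists p_prime z r0.
have dB : dirs z r (oball z r) by right; exists z; rewrite ?subrr ?abs0 ?(ltW r0).
have [P SP PE] := (is_zeta_associated p_prime _ h).2 dB.
exists S, [set T | [/\ HpR T, separates T (end_ball P `\ Some z) &
                     separates T (~` (end_ball P `\ Some z))]]; split.
  split; first exact: is_zeta_HpR h.
  by exists P; split=> //; rewrite PE; exact: oball_mem.
move=> T [hT]; rewrite PE => s1 s2; have [t /andP[t0 tr] hz] := separates_fin hT s1 s2.
have [U hU XU] := hX t t0 (ltW tr).
by rewrite (is_zeta_uniq hz hU).
Qed.

Lemma half_geodesic_inf (X : set Hp) a r : 0 < r ->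
  (forall t, r <= t -> exists2 U, is_zeta a t U & X U) ->
  exists (S : Hp) (G : set Hp), half_geodesic None S G /\ G `<=` X.
Proof.
move=> r0 hX; have [S [h _]] := is_zeta_exists p_prime a r0.
have dB : dirs a r (~` cball a r) by left.
have [P SP PE] := (is_zeta_associated p_prime _ h).2 dB.
exists S, [set T | [/\ HpR T, separates T (end_ball P `\ None) &
                     separates T (~` (end_ball P `\ None))]]; split.
  split; first exact: is_zeta_HpR h.
  by exists P; split=> //; rewrite PE; exact: cball_None.
move=> T [hT]; rewrite PE => s1 s2; have [t rt hz] := separates_inf r0 hT s1 s2.
have [U hU XU] := hX t (ltW rt).
by rewrite (is_zeta_uniq hz hU).
Qed.

End HalfGeodesic.

(** * Rays in an invariant connected set *)

Section Dynamics.
Context {p : nat} {R : realType} {K : padicComplexType p R}.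
Local Notation abs := (@Cp_abs p R K).
Local Notation uC := (@Cp_ultra p R K).
Local Notation value_group := (value_group K).
Local Notation Hp := (Hp K).
Implicit Types (r s t e : R) (a b x y z w : K) (B : set (P1 K)) (S T U : Hp).

Hypothesis p_prime : prime p.
Variable f : {fraction {poly K}}.
Hypothesis f_nc : nonconstant f.

(* |f - a| at zeta_(a, t), that is, |z - a| at the image of zeta_(a, t). *)
Definition grad a t : R := gn (num f - a *: den f) a t / gn (den f) a t.

Lemma den_gn_gt0 a t : 0 < t -> 0 < gn (den f) a t.
Proof. by move=> t0; rewrite gn_gt0 ?den_neq0. Qed.

Lemma grad_gt0 a t : 0 < t -> 0 < grad a t.
Proof. by move=> t0; rewrite divr_gt0 ?den_gn_gt0 // gn_gt0 // nonconstant_sub. Qed.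

Lemma gauss_image_zn a t b s c : 0 < t -> gauss_image f a t b s ->
  gn (num f - c *: den f) a t / gn (den f) a t = zn b s c.
Proof. by move=> t0 [_ ->]; rewrite mulfK // gt_eqF // den_gn_gt0. Qed.

Lemma grad_ratio P Q a t i j : 0 < t -> gn P a t = abs (shift a P)`_i * t ^+ i ->
  gn Q a t = abs (shift a Q)`_j * t ^+ j -> (shift a Q)`_j != 0 ->
  gn P a t / gn Q a t * t ^+ j = abs (shift a P)`_i / abs (shift a Q)`_j * t ^+ i.
Proof.
move=> t0 -> -> Qj; field.
by rewrite expf_neq0 ?gt_eqF // (uabs_gt0 uC).
Qed.

Lemma grad_left a r : 0 < r -> monomial_left value_group (grad a) r.
Proof.
move=> r0.
have P0 : shift a (num f - a *: den f) != 0 by rewrite shift_eq0 nonconstant_sub.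
have Q0 : shift a (den f) != 0 by rewrite shift_eq0 den_neq0.
have [i [Pi gi [e1 /andP[e10 e1r] d1]]] := dominates_left P0 r0.
have [j [Qj gj [e2 /andP[e20 e2r] d2]]] := dominates_left Q0 r0.
exists (abs (shift a (num f - a *: den f))`_i / abs (shift a (den f))`_j), i, j.
exists (Num.max e1 e2); split.
- by apply: value_groupM; [|apply: value_groupV]; apply: value_group_abs.
- by rewrite le_max e10.
- by rewrite gt_max e1r.
move=> t; rewrite gt_max => /andP[e1t e2t] tr.
have t0 : 0 < t by exact: le_lt_trans e1t.
apply: grad_ratio => //.
  have [->|tr'] := eqVneq t r; first exact: gi.
  by apply: dominates_gaussnorm (ltW t0) _; apply: d1 => //; rewrite lt_neqAle tr'.
have [->|tr'] := eqVneq t r; first exact: gj.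
by apply: dominates_gaussnorm (ltW t0) _; apply: d2 => //; rewrite lt_neqAle tr'.
Qed.

Lemma grad_right a r : 0 < r -> monomial_right value_group (grad a) r.
Proof.
move=> r0.
have P0 : shift a (num f - a *: den f) != 0 by rewrite shift_eq0 nonconstant_sub.
have Q0 : shift a (den f) != 0 by rewrite shift_eq0 den_neq0.
have [i [Pi gi [e1 re1 d1]]] := dominates_right P0 r0.
have [j [Qj gj [e2 re2 d2]]] := dominates_right Q0 r0.
exists (abs (shift a (num f - a *: den f))`_i / abs (shift a (den f))`_j), i, j.
exists (Num.min e1 e2); split.
- by apply: value_groupM; [|apply: value_groupV]; apply: value_group_abs.
- by rewrite lt_min re1.
move=> t rt; rewrite lt_min => /andP[te1 te2].
have t0 : 0 < t by exact: lt_le_trans rt.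
apply: grad_ratio => //.
  have [->|tr'] := eqVneq t r; first exact: gi.
  by apply: dominates_gaussnorm (ltW t0) _; apply: d1 => //; rewrite lt_neqAle eq_sym tr'.
have [->|tr'] := eqVneq t r; first exact: gj.
by apply: dominates_gaussnorm (ltW t0) _; apply: d2 => //; rewrite lt_neqAle eq_sym tr'.
Qed.

Lemma coef1_shift a (P : {poly K}) : (shift a P)`_1 = P^`().[a].
Proof.
have -> : (shift a P)`_1 = (shift a P)^`()`_0 by rewrite coef_deriv mulr1n.
by rewrite /shift deriv_comp derivD derivX derivC addr0 mulr1 -/(shift a _) shift0.
Qed.

(** For small t the norm of [den f] is its value at z, and the linear coefficient of
    [num f - z *: den f] is the multiplier times that value. Its term in the Gauss norm gives
    |multiplier| t <= [grad z t] < t. *)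
Lemma attracting_fin z r : 0 < r -> root (num f - 'X * den f) z ->
  (forall t, 0 < t -> t <= r -> grad z t < t) -> attracting_fixed_point f (Some z).
Proof.
move=> r0; rewrite rootE !hornerE subr_eq0 => /eqP Nz lt_g.
have D0 : (den f).[z] != 0.
  by apply/eqP => d0; apply: (@numden_nroot _ _ _ f z); rewrite rootE ?Nz d0 ?mulr0.
split; first by apply: rat_eval_root; rewrite rootE !hornerE Nz subrr.
have -> : multiplier f (Some z) = (num f - z *: den f)^`().[z] / (den f).[z].
  rewrite /= /rat_deriv derivB derivZ !hornerE Nz; field.
  by rewrite D0.
have s0 : (shift z (den f))`_0 != 0 by rewrite shift0.
have [e e0 small] := dominates_small s0.
rewrite (uabs_div uC) ltr_pdivrMr ?(uabs_gt0 uC) // mul1r.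
pose t := Num.min r (e / 2).
have t0 : 0 < t by rewrite lt_min r0 divr_gt0.
have te : t < e by rewrite gt_min; apply/orP; right; rewrite ltr_pdivrMr // ltr_pMr // ltr1n.
have tr : t <= r by rewrite ge_min lexx.
have gD : gn (den f) z t = abs (den f).[z].
  by rewrite /gn (dominates_gaussnorm (ltW t0) (small _ t0 te)) expr0 mulr1 shift0.
have := lt_g t t0 tr; rewrite /grad ltr_pdivrMr ?den_gn_gt0 // gD => h.
rewrite -(ltr_pM2r t0) [ltRHS]mulrC; apply: le_lt_trans h.
rewrite -coef1_shift -[X in _ * X <= _]expr1; exact: gaussnorm_ge (ltW t0).
Qed.

(** For large t the norm of num - a den is its leading term. Comparison with the leading term of den
    makes infinity a pole; comparison with the term of degree deg num - 1 then bounds the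
    multiplier. *)
Lemma attracting_inf a r : 0 < r -> (forall t, r <= t -> t < grad a t) ->
  attracting_fixed_point f None.
Proof.
move=> r0 gt_g; set N := num f; set D := den f.
have D0 : D != 0 by exact: den_neq0.
pose P := N - a *: D; have P0 : P != 0 by exact: nonconstant_sub.
have sP0 : shift a P != 0 by rewrite shift_eq0.
have [e1 e10 l1] := dominates_large sP0.
have big t : e1 < t -> gn P a t = abs (lead_coef P) * t ^+ (size P).-1.
  move=> h; rewrite /gn (dominates_gaussnorm (ltW (lt_trans e10 h)) (l1 _ h)).
  by rewrite size_shift -(lead_coef_shift a P) lead_coefE size_shift.
have aP : 0 < abs (lead_coef P) by rewrite (uabs_gt0 uC) // lead_coef_eq0.
have aD : 0 < abs (lead_coef D) by rewrite (uabs_gt0 uC) // lead_coef_eq0.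
have lower t i : 0 < t -> abs (shift a D)`_i * t ^+ i <= gn D a t.
  by move=> t0; exact: gaussnorm_ge (ltW t0).
have sND : (size D < size N)%N.
  rewrite ltnNge; apply/negP => ND.
  have PD : (size P <= size D)%N.
    rewrite /P (leq_trans (size_polyD _ _)) // geq_max ND size_polyN.
    exact: size_scale_leq.
  (* t exceeds e1, so that the leading term of P dominates, and is large enough for |lead P| <= t
     |lead D|. *)
  pose t := Num.max (Num.max (e1 + 1) r) (Num.max 1 (abs (lead_coef P) / abs (lead_coef D))).
  have [t1 t2 t3 t4] : [/\ e1 + 1 <= t, r <= t, 1 <= t & abs (lead_coef P) / abs (lead_coef D) <= t].
    by rewrite /t !le_max !lexx !orbT.
  have t0 : 0 < t by lra.
  have := gt_g t t2; rewrite /grad ltr_pdivlMr ?den_gn_gt0 // -/P -/D big; last by lra.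
  rewrite ltNge => /negP; apply.
  have := lower t (size D).-1 t0.
  have -> : (shift a D)`_(size D).-1 = lead_coef D.
    by rewrite -(lead_coef_shift a D) lead_coefE size_shift.
  move=> h; apply: le_trans (_ : t * (abs (lead_coef D) * t ^+ (size D).-1) <= _); last first.
    by rewrite ler_pM2l.
  rewrite mulrA ler_pM ?abs_ge0 ?exprn_ge0 ?(ltW t0) //.
    by rewrite -ler_pdivrMr.
  by rewrite ler_weXn2l // -!subn1 leq_sub2r.
have sP : size P = size N.
  by rewrite /P size_polyDl // size_polyN (leq_ltn_trans (size_scale_leq _ _)).
have lP : lead_coef P = lead_coef N.
  by rewrite /P lead_coefDl // size_polyN (leq_ltn_trans (size_scale_leq _ _)).
split; first by rewrite /= sND.
have sD : (0 < size D)%N by rewrite size_poly_gt0.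
pose m := size N; have mE : maxn (size N) (size D) = m by apply/maxn_idPl; exact: ltnW.
pose rv (q : {poly K}) : {poly K} := \poly_(i < m) q`_(m.-1 - i).
have rvE q i : (i < m)%N -> (rv q)`_i = q`_(m.-1 - i) by move=> im; rewrite coef_poly im.
have m1 : (1 < m)%N by apply: leq_ltn_trans sND.
have m0 : (0 < m)%N by exact: ltnW.
have N0 : (rv N).[0] = lead_coef N by rewrite horner_coef0 rvE // subn0 lead_coefE.
have lN0 : lead_coef N != 0 by rewrite -lP lead_coef_eq0.
have D00 : (rv D).[0] = 0.
  by rewrite horner_coef0 rvE // subn0 nth_default // -ltnS prednK.
have hE : inv_conj f = tofrac (rv D) / tofrac (rv N) by rewrite /inv_conj -/N -/D mE.
have rN0 : rv N != 0 by apply: contraNneq lN0 => h; rewrite -N0 h horner0.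
(* The reduced pair of [inv_conj f] is not computed: differentiating this identity at 0 is enough
   for its multiplier. *)
have cross := numden_cross rN0 hE.
set H := inv_conj f in hE cross *.
have nH0 : (num H).[0] = 0.
  have := congr1 (horner^~ 0) cross; rewrite !hornerM D00 mul0r N0 => /eqP.
  by rewrite mulf_eq0 (negPf lN0) orbF => /eqP.
have dH0 : (den H).[0] != 0.
  by apply/eqP => h; apply: (@numden_nroot _ _ _ H 0); rewrite rootE ?nH0 ?h.
have dcross : (num H)^`().[0] * lead_coef N = (rv D)^`().[0] * (den H).[0].
  have := congr1 (fun q => q^`().[0]) cross.
  by rewrite !derivM !hornerD !hornerM D00 nH0 N0 !mul0r !addr0.
have -> : multiplier f None = (rv D)^`().[0] / lead_coef N.
  rewrite /= -/H /rat_deriv !hornerE nH0 mul0r subr0.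
  apply: (mulIf lN0); rewrite divfK //.
  have -> : (num H)^`().[0] * (den H).[0] / (den H).[0] ^+ 2 * lead_coef N =
     (num H)^`().[0] * lead_coef N / (den H).[0] by field.
  by rewrite dcross mulfK.
have -> : (rv D)^`().[0] = D`_(m.-2).
  by rewrite horner_coef0 coef_deriv rvE // mulr1n subn1.
rewrite (uabs_div uC) ltr_pdivrMr ?(uabs_gt0 uC) // mul1r.
pose t := Num.max (e1 + 1) r.
have [t1 t2] : e1 + 1 <= t /\ r <= t by rewrite /t !le_max !lexx !orbT.
have t0 : 0 < t by lra.
have := gt_g t t2; rewrite /grad ltr_pdivlMr ?den_gn_gt0 // -/P -/D big; last by lra.
rewrite sP lP -/m => h.
(* This coefficient is the leading one of D, or 0 when D has lower degree; recentring at a preserves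
   it in both cases. *)
have cD : (shift a D)`_(m.-2) = D`_(m.-2).
  have : (size D <= m.-1)%N by rewrite -ltnS prednK.
  rewrite leq_eqVlt => /predU1P[sE|sl].
    by rewrite -sE -lead_coefE -(lead_coef_shift a) lead_coefE size_shift.
  rewrite !nth_default // ?size_shift; by case: (m) m1 sl => [|[]].
have := lower t m.-2 t0; rewrite cD => h1.
rewrite -(ltr_pM2r (exprn_gt0 m.-1 t0)); apply: le_lt_trans h.
have -> : m.-1 = m.-2.+1 by case: (m) m1 => [|[]].
by rewrite exprS mulrCA ler_pM2l.
Qed.

Variable X : set Hp.
Hypothesis X_conn : connected X.
Hypothesis X_inv : forall S T, X S -> Hp_image f S T -> X T.

Definition in_X a t := exists2 U, is_zeta a t U & X U.

Definition dynamics_alternative :=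
  (exists S, [/\ X S, rational_point S & Hp_image f S S]) \/
  (exists z0 : P1 K, attracting_fixed_point f z0 /\
     exists (S : Hp) (G : set Hp), half_geodesic z0 S G /\ G `<=` X).

Lemma in_X_center a b t : abs (a - b) <= t -> in_X a t -> in_X b t.
Proof. by move=> ab [U h XU]; exists U => //; exact: is_zeta_center h. Qed.

Lemma in_X_image a t : value_group t -> in_X a t ->
  exists b s, [/\ gauss_image f a t b s, value_group s & in_X b s].
Proof.
move=> vt [U h XU]; have [b [s [gi vs]]] := gauss_image_exists a f_nc vt.
have [T [hT _]] := is_zeta_exists p_prime b gi.1.
by exists b, s; split=> //; exists T => //; apply: X_inv XU _; apply: zeta_image gi.
Qed.

Lemma in_X_between a t b s c u : in_X a t -> in_X b s -> zn a t c < u -> u <= zn b s c ->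
  in_X c u.
Proof.
move=> [U hU XU] [V hV XV] h1 h2; have [t0 _] := hU.
have u0 : 0 < u by apply: lt_trans h1; apply: lt_le_trans t0 (zn_ge _ _ _).
have [W [hW _]] := is_zeta_exists p_prime c u0; exists W => //.
by apply: (connected_convex (p_prime := p_prime) X_conn XU XV hW); rewrite ?(delta_zeta _ hU) ?(delta_zeta _ hV).
Qed.

Lemma fixed_alternative a r b s : value_group r -> in_X a r -> gauss_image f a r b s ->
  s = r -> abs (a - b) <= r -> dynamics_alternative.
Proof.
move=> vr [U h XU] gi sr ab; left; exists U; split=> //.
  have [r0 _] := h; have [V [hV rV]] := is_zeta_exists p_prime a r0.
  by rewrite (is_zeta_uniq h hV); exact: rV.
apply: zeta_image gi => //; rewrite sr; exact: is_zeta_center h.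
Qed.

Lemma zn_leP a r b t : zn b r a = t -> r <= t /\ abs (b - a) <= t.
Proof. by move=> <-; rewrite zn_ge le_max lexx. Qed.

Lemma gauss_image_lt a r b s c : 0 < r -> gauss_image f a r b s ->
  (gn (num f - c *: den f) a r < r * gn (den f) a r) = (zn b s c < r).
Proof. by move=> r0 gi; rewrite -(gauss_image_zn c r0 gi) ltr_pdivrMr // den_gn_gt0. Qed.

(* On the ball num f - 'X den f and - ('X - b) den f have the same dominant
   terms, and the latter vanishes at b. *)
Lemma fixed_point_in_oball b r : 0 < r ->
  gn (num f - b *: den f) b r < r * gn (den f) b r ->
  num f - 'X * den f != 0 /\ exists2 z, root (num f - 'X * den f) z & abs (z - b) < r.
Proof.
move=> r0 lt_r; set P := num f - 'X * den f.
have PE : P = - (('X - b%:P) * den f) + (num f - b *: den f).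
  by rewrite /P -mul_polyC; ring.
have nE : gaussnorm (shift b (- (('X - b%:P) * den f))) r = r * gn (den f) b r.
  rewrite /shift rmorphN /= -/(shift b _) gaussnormN ?(ltW r0) // shiftM shift_XsubC subrr.
  by rewrite gaussnorm_XsubC // abs0 max_r // ltW.
have gP : gn P b r = r * gn (den f) b r.
  by rewrite /gn PE shiftD gaussnorm_dom ?nE // ltW.
split.
  apply: contraTneq (mulr_gt0 r0 (den_gn_gt0 b r0)) => P0.
  by rewrite -gP P0 /gn /shift comp_poly0 gaussnorm0 ltxx.
have [|z rz zr] := @exists_root_ball _ _ _ (shift b P) r r0.
  rewrite -/(gn P b r) gP; apply: le_lt_trans lt_r.
  have -> : (shift b P)`_0 = (shift b (num f - b *: den f))`_0.
    by rewrite !shift0 /P !hornerE.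
  by have := gaussnorm_ge (shift b (num f - b *: den f)) 0 (ltW r0); rewrite expr0 mulr1.
by exists (z + b); rewrite -?shift_root // addrK.
Qed.

(** If f is the identity no finite list holds its fixed points; the condition on rs is therefore
    restricted to a nonzero polynomial, which [fixed_point_in_oball] guarantees once f moves a point
    inwards. *)
Lemma down_alternative (rs : seq K) :
  (forall z, num f - 'X * den f != 0 -> root (num f - 'X * den f) z -> z \in rs) ->
  forall n b r, (count (fun c => (abs (c - b) < r)%R) rs <= n)%N -> value_group r -> in_X b r ->
  gn (num f - b *: den f) b r < r * gn (den f) b r -> dynamics_alternative.
Proof.
move=> rsP; elim=> [|n IH] b r cnt vr Xbr lt_r; have r0 := value_group_gt0 vr;
  have [P0 [z rz zb]] := fixed_point_in_oball r0 lt_r; have zrs := rsP _ P0 rz.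
  move: cnt; rewrite leqn0 => /eqP c0.
  have : has (fun c => abs (c - b) < r) rs by apply/hasP; exists z.
  by rewrite has_count c0.
have bz : abs (b - z) < r by rewrite absBC.
have Xzr : in_X z r by apply: in_X_center Xbr; exact: ltW.
have [b0 [s0 [gi0 _ _]]] := in_X_image vr Xzr.
have gzr : grad z r < r.
  have gi := gauss_image_center r0 (ltW zb) gi0.
  rewrite /grad (gauss_image_zn _ r0 gi0).
  move: lt_r; rewrite (gauss_image_lt _ r0 gi) => lt_r.
  by apply: le_lt_trans (zn_trans b0 s0 z b) _; rewrite gt_max lt_r.
(* delta(z) equals t at zeta_(z, t) and [grad z t] at its image, so t' lies between the two
   values. *)
have step t t' : value_group t -> in_X z t -> grad z t < t' -> t' <= t -> in_X z t'.
  move=> vt Xt; have t0 := value_group_gt0 vt; have [b1 [s1 [gi1 _ X1]]] := in_X_image vt Xt.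
  rewrite /grad (gauss_image_zn _ t0 gi1) => h1 h2.
  by apply: in_X_between X1 Xt h1 _; rewrite /zn subrr abs0 max_r // ltW.
have [H|[t0 [t [[vt0 gt0] [t0_gt0 t0t] [vt tr] Xt gt]]]] :=
  descent (@value_group_gt0 _ _ K) (value_group_dense p_prime) (@value_group_root _ _ K)
    (@grad_left z) (@grad_right z) step vr Xzr gzr.
  right; exists (Some z); split.
    by apply: (attracting_fin r0 rz) => t h1 h2; have [] := H t h1 h2.
  by apply: (half_geodesic_fin p_prime r0) => t h1 h2; have [] := H t h1 h2.
have t_gt0 := lt_trans t0_gt0 t0t.
(* The image of zeta_(z, t) has value at most t0 at z. Either its radius is t0 and it is the wanted
   point, or its radius is smaller and convexity applies. *)
have Xt0 : in_X z t0.
  have [b1 [s1 [gi1 _ X1]]] := in_X_image vt Xt.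
  move: gt; rewrite /grad (gauss_image_zn _ t_gt0 gi1) ge_max => /andP[bz1 st0].
  apply: (in_X_center bz1); move: st0; rewrite le_eqVlt => /predU1P[<- //|st0].
  apply: (in_X_between X1 Xt); first by rewrite /zn subrr abs0 gt_max t0_gt0.
  by apply: le_trans (ltW t0t) (zn_ge _ _ _).
have [b1 [s1 [gi1 vs1 X1]]] := in_X_image vt0 Xt0.
have z1 : zn b1 s1 z = t0 by rewrite -(gauss_image_zn z t0_gt0 gi1).
have [st0 bz1] := zn_leP z1.
have [s1E|s1lt] := eqVneq s1 t0.
  by apply: (fixed_alternative vt0 Xt0 gi1 s1E); rewrite absBC.
have {st0 s1lt}s1t0 : s1 < t0 by rewrite lt_neqAle s1lt.
(* The value t0 at z is not due to the radius s1, so z lies outside the open disc of radius t0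
   around b1. *)
have bzE : abs (b1 - z) = t0.
  by move: z1; rewrite /zn; case: leP => // _ h; move: s1t0; rewrite h ltxx.
have zb1 : abs (z - b1) <= t0 by rewrite absBC bzE.
apply: (IH b1 t0) => //; last 2 first.
- exact: in_X_center Xt0.
- have gi1' := gauss_image_center t0_gt0 zb1 gi1.
  by rewrite (gauss_image_lt _ t0_gt0 gi1') /zn subrr abs0 gt_max t0_gt0.
rewrite -ltnS; apply: leq_trans cnt.
have sub c : abs (c - b1) < t0 -> abs (c - b) < r.
  move=> h; apply: (abs_lttrans (y := z)) => //.
  have t0r : t0 < r by exact: lt_le_trans tr.
  by apply: (abs_lttrans (y := b1)); rewrite ?bzE // (lt_trans h).
(* The root z is counted in the old disc and not in the new one, which the old disc contains. *)
have : (count (fun c => (abs (c - b1) < t0)%R) rs + count (pred1 z) rs <=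
        count (fun c => (abs (c - b) < r)%R) rs)%N.
  rewrite -count_predUI; rewrite [X in (_ + X)%N](_ : _ = 0%N); last first.
    apply/eqP; rewrite -leqn0 leqNgt -has_count; apply/hasPn => c _ /=.
    by apply/negP => /andP[h /eqP cz]; move: h; rewrite cz absBC bzE ltxx.
  by rewrite addn0; apply: sub_count => c /= /orP[/sub//|/eqP ->].
have : (0 < count (pred1 z) rs)%N by rewrite -has_count has_pred1.
by move=> pos le; apply: leq_trans le; rewrite -addn1 leq_add2l.
Qed.

Lemma toward_alternative a r b s : value_group r -> in_X a r -> gauss_image f a r b s ->
  zn b s a <= r -> dynamics_alternative.
Proof.
move=> vr Xar gi; rewrite ge_max => /andP[ba sr]; have r0 := value_group_gt0 vr.
rewrite absBC in ba.
have [sE|sne] := eqVneq s r; first exact: fixed_alternative vr Xar gi sE ba.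
have [rs rsE] := closed_factor (@Cp_closed p R K) (num f - 'X * den f).
apply: (@down_alternative rs _ _ b r (leqnn _) vr).
- move=> z P0 rz; move: rz; rewrite rsE rootZ ?lead_coef_eq0 //.
  by rewrite root_prod_XsubC.
- exact: in_X_center Xar.
have gi' := gauss_image_center r0 ba gi; have [s0 _] := gi.
by rewrite (gauss_image_lt _ r0 gi') /zn subrr abs0 gt_max r0 lt_neqAle sne.
Qed.

Lemma in_X_alternative a r : value_group r -> in_X a r -> dynamics_alternative.
Proof.
move=> vr Xar; have r0 := value_group_gt0 vr.
have [b [s [gi vs Xbs]]] := in_X_image vr Xar.
have [le_r|gt_r] := leP (zn b s a) r; first exact: toward_alternative vr Xar gi le_r.
(* Inversion of radii turns the ray to infinity into a decreasing one, for which [descent] applies;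
   the two monomial conditions are exchanged. *)
pose g t := (grad a t^-1)^-1.
have gE t : 0 < t -> 0 < g t by move=> t0; rewrite invr_gt0 grad_gt0 ?invr_gt0.
have flip (C u v w : R) i j : 0 < u -> 0 < w -> w * u ^+ j = C * u ^+ i ->
    w^-1 * u^-1 ^+ j = C^-1 * u^-1 ^+ i.
  by move=> u0 w0 h; rewrite !exprVn -!invfM [X in X^-1]mulrC mulrC h mulrC.
have gl t : 0 < t -> monomial_left value_group g t.
  move=> t0; have ti0 : 0 < t^-1 by rewrite invr_gt0.
  have [C [i [j [e [vC te he]]]]] := grad_right a ti0.
  have e0 := lt_trans ti0 te.
  exists C^-1, i, j, e^-1; split.
  - exact: value_groupV.
  - by rewrite invr_ge0 ltW.
  - by rewrite -[t]invrK ltf_pV2 ?posrE.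
  move=> u eu ut; have u0 : 0 < u by apply: lt_trans eu; rewrite invr_gt0.
  have ui0 : 0 < u^-1 by rewrite invr_gt0.
  rewrite /g -{2 3}[u]invrK; apply: flip => //; first exact: grad_gt0.
  by apply: he; [rewrite lef_pV2 ?posrE|rewrite -[e]invrK ltf_pV2 ?posrE ?invr_gt0].
have gr t : 0 < t -> monomial_right value_group g t.
  move=> t0; have ti0 : 0 < t^-1 by rewrite invr_gt0.
  have [C [i [j [e [vC e0 et he]]]]] := grad_left a ti0.
  (* The bound e may be 0 and has to be inverted, hence a positive lower bound for it. *)
  pose e' := Num.max e (t^-1 / 2).
  have e'0 : 0 < e' by rewrite lt_max; apply/orP; right; rewrite divr_gt0.
  have e't : e' < t^-1 by rewrite gt_max et ltr_pdivrMr // ltr_pMr // ltr1n.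
  exists C^-1, i, j, e'^-1; split.
  - exact: value_groupV.
  - by rewrite -[t]invrK ltf_pV2 ?posrE.
  move=> u tu ue; have u0 : 0 < u by apply: lt_le_trans tu.
  have ui0 : 0 < u^-1 by rewrite invr_gt0.
  rewrite /g -{2 3}[u]invrK; apply: flip => //; first exact: grad_gt0.
  apply: he; last by rewrite lef_pV2 ?posrE.
  have : e' < u^-1 by rewrite -[e']invrK ltf_pV2 ?posrE ?invr_gt0.
  by rewrite gt_max => /andP[].
have step t t' : value_group t -> in_X a t^-1 -> g t < t' -> t' <= t -> in_X a t'^-1.
  move=> vt Xt; have t0 := value_group_gt0 vt; have ti0 : 0 < t^-1 by rewrite invr_gt0.
  have [b1 [s1 [gi1 _ X1]]] := in_X_image (value_groupV vt) Xt.
  rewrite /g /grad (gauss_image_zn _ ti0 gi1) => h1.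
  rewrite le_eqVlt => /predU1P[-> //|h2].
  have z0 : 0 < zn b1 s1 a by apply: lt_le_trans gi1.1 (zn_ge _ _ _).
  have t'0 : 0 < t' by apply: lt_trans h1; rewrite invr_gt0.
  apply: (in_X_between Xt X1).
    by rewrite /zn subrr abs0 gt_max invr_gt0 t'0 ltf_pV2 ?posrE.
  by rewrite -[leRHS]invrK lef_pV2 ?posrE ?invr_gt0 // ltW.
have gr' : g r^-1 < r^-1.
  rewrite /g invrK ltf_pV2 ?posrE ?grad_gt0 //.
  by rewrite /grad (gauss_image_zn _ r0 gi).
have Xar' : in_X a (r^-1)^-1 by rewrite invrK.
have [H|[t0 [t [[vt0 gt0] [t0_gt0 t0t] [vt tr] Xt gt]]]] :=
  descent (@value_group_gt0 _ _ K) (value_group_dense p_prime) (@value_group_root _ _ K)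
    gl gr step (value_groupV vr) Xar' gr'.
  have H' t : r <= t -> in_X a t /\ t < grad a t.
    move=> rt; have t_gt0 := lt_le_trans r0 rt.
    have ti0 : 0 < t^-1 by rewrite invr_gt0.
    have [|] := H t^-1 ti0; first by rewrite lef_pV2 ?posrE.
    by rewrite /g invrK ltf_pV2 ?posrE ?grad_gt0.
  right; exists None; split.
    by apply: (attracting_inf r0 (a := a)) => t /H'[].
  by apply: (half_geodesic_inf p_prime (a := a) r0) => t /H'[].
have t_gt0 := lt_trans t0_gt0 t0t.
have u0 : 0 < t0^-1 by rewrite invr_gt0.
have ti0 : 0 < t^-1 by rewrite invr_gt0.
have Xt0 : in_X a t0^-1.
  have [b1 [s1 [gi1 _ X1]]] := in_X_image (value_groupV vt) Xt.
  have z0 : 0 < zn b1 s1 a by apply: lt_le_trans gi1.1 (zn_ge _ _ _).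
  move: gt; rewrite /g /grad (gauss_image_zn _ ti0 gi1) => gt.
  apply: (in_X_between Xt X1).
    by rewrite /zn subrr abs0 gt_max u0 ltf_pV2 ?posrE.
  by rewrite -[leRHS]invrK lef_pV2 ?posrE ?invr_gt0.
have vu := value_groupV vt0.
have [b1 [s1 [gi1 _ X1]]] := in_X_image vu Xt0.
apply: (toward_alternative vu Xt0 gi1).
(* At the turning radius |f - a| equals the radius, so the image stays in the closed disc around a
   and the inward case takes over. *)
suff -> : zn b1 s1 a = t0^-1 by [].
by rewrite -(gauss_image_zn a u0 gi1) -[in RHS]gt0 invrK.
Qed.

(** X might a priori have only singular points in evidence; two points with different delta at some
    a enclose an interval of radii, which meets the value group. *)
Lemma connected_alternative : (exists S T, [/\ X S, X T & S <> T]) -> dynamics_alternative.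
Proof.
move=> [S [T [XS XT ST]]].
have [a neq] : exists a, delta p_prime S a != delta p_prime T a.
  apply: contrapT => h; apply: ST; apply: (delta_inj (p_prime := p_prime)); apply/funext => a.
  by apply/eqP/negPn/negP => h'; apply: h; exists a.
wlog lt_a : S T XS XT ST neq / delta p_prime S a < delta p_prime T a.
  move=> W; have [h|h|h] := ltgtP (delta p_prime S a) (delta p_prime T a).
  - exact: W XS XT ST neq h.
  - by apply: (W T S) => //; [exact: nesym|rewrite eq_sym].
  - by rewrite h eqxx in neq.
have [r [vr h1 h2]] := value_group_dense (K := K) p_prime (ltW (delta_gt0 p_prime S a)) lt_a.
apply: (@in_X_alternative a r vr).
have [U [hU _]] := is_zeta_exists p_prime a (value_group_gt0 vr).
exists U => //; exact: (connected_convex X_conn XS XT hU h1 (ltW h2)).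
Qed.

End Dynamics.

Theorem mainTheorem2 (p : nat) (p_prime : prime p) (R : realType)
    (Cp : padicComplexType p R) (f : {fraction {poly Cp}}) (X : set (Hp Cp)) :
  nonconstant f ->
  connected X ->
  (exists S T : Hp Cp, [/\ X S, X T & S <> T]) ->
  (forall S T : Hp Cp, X S -> Hp_image f S T -> X T) ->
  (exists S : Hp Cp, [/\ X S, rational_point S & Hp_image f S S]) \/
  (exists z0 : P1 Cp, attracting_fixed_point f z0 /\
     exists (S : Hp Cp) (G : set (Hp Cp)), half_geodesic z0 S G /\ G `<=` X).
Proof.
by move=> nc cX two inv; exact: (connected_alternative p_prime nc cX inv two).
Qed.
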